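(* Let $\Omega$ be a bounded, smooth domain of $\mathbb{R}^N$ and let $p>N\geq 1$. Let $x\in\Omega$ be fixed and let $u_p\in W_0^{1,p}(\Omega)$ be the only weak solution of $$-\Delta_p u=(s_p(x))^{-p}\,\delta_x\ \text{ in }\Omega,\qquad u=0\ \text{ on }\partial\Omega.$$ Then $u_p\in\mathcal{M}_p(x)$, $u_p$ is strictly positive in $\Omega$, $u_p$ attains its maximum value only at $x$, and $$s_p(x)=\left(\|\nabla u_p\|_p\right)^{-1}.$$ Moreover: (a) $|v(y)|\leq s_p(y)\,\|\nabla v\|_p$ for all $(y,v)\in\overline{\Omega}\times W_0^{1,p}(\Omega)$; (b) for $v\in W_0^{1,p}(\Omega)$, one has $|v(x)|=s_p(x)\,\|\nabla v\|_p$ if, and only if, $v$ is a scalar multiple of $u_p$; (c) $s_p\in C_0^{0,1-(N/p)}(\overline{\Omega})$.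
   Context: $\|\cdot\|_p$ is the standard norm of $L^p(\Omega)$ and $\|\cdot\|_\infty$ that of $L^\infty(\Omega)$. Since $p>N$, each $v\in W_0^{1,p}(\Omega)$ is identified with its continuous representative on $\overline\Omega$, which vanishes on $\partial\Omega$. The function $s_p:\overline\Omega\to[0,\infty)$ is defined by $s_p(x):=\sup\{|v(x)|/\|\nabla v\|_p: v\in W_0^{1,p}(\Omega)\setminus\{0\}\}$ if $x\in\Omega$, and $s_p(x):=0$ if $x\in\partial\Omega$. For $x\in\Omega$, $\mathcal{M}_p(x):=\{v\in W_0^{1,p}(\Omega): |v(x)|=\|v\|_\infty=1\}$. For $\mu>0$ and $x\in\Omega$, a weak solution of $-\Delta_p u=\mu\delta_x$ in $\Omega$, $u=0$ on $\partial\Omega$, is a function $u\in W_0^{1,p}(\Omega)$ such that $\int_\Omega|\nabla u|^{p-2}\nabla u\cdot\nabla\phi\,\mathrm{d}y=\mu\,\phi(x)$ for all $\phi\in W_0^{1,p}(\Omega)$; such a solution exists and is unique. $C_0^{0,1-(N/p)}(\overline\Omega)$ is the space of functions that are $(1-(N/p))$-Hölder continuous in $\overline\Omega$ and vanish on $\partial\Omega$. *)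

(* Defs.v *)
From HB Require Import structures.
From mathcomp Require Import all_boot all_order all_algebra.
From mathcomp Require Import all_classical all_reals all_analysis.

Set Implicit Arguments.
Unset Strict Implicit.
Unset Printing Implicit Defensive.
Import Order.TTheory GRing.Theory Num.Theory.
Import numFieldNormedType.Exports.
Local Open Scope classical_set_scope.
Local Open Scope ring_scope.

(* R^n is 'rV[R]_n with its product (= Borel) sigma-algebra, as the library
   does for tuples. *)
Definition rV_display : measure_display. Proof. exact: default_measure_display. Qed.

Section measurable_rV.
Context {R : realType} (n : nat).

Definition rV_coord (i : 'I_n) (x : 'rV[R]_n) : measurableTypeR R := x 0 i.

Let rV_set0 : g_sigma_preimage rV_coord set0.
Proof. exact: sigma_algebra0. Qed.

Let rV_setC A : g_sigma_preimage rV_coord A -> g_sigma_preimage rV_coord (~` A).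
Proof. exact: sigma_algebraC. Qed.

Let rV_bigcup (F : (set 'rV[R]_n)^nat) :
  (forall i, g_sigma_preimage rV_coord (F i)) ->
  g_sigma_preimage rV_coord (\bigcup_i (F i)).
Proof. exact: sigma_algebra_bigcup. Qed.

HB.instance Definition _ := @isMeasurable.Build rV_display
  'rV[R]_n (g_sigma_preimage rV_coord) rV_set0 rV_setC rV_bigcup.

End measurable_rV.

Section rV_cons.
Context {R : realType}.

Lemma measurable_rV_coord n (i : 'I_n) :
  measurable_fun [set: 'rV[R]_n] (@rV_coord R n i).
Proof.
move=> _ Y mY; rewrite setTI; apply: sub_sigma_algebra => /=.
rewrite -bigcup_seq/=; exists i => /=; first by rewrite mem_index_enum.
by exists Y => //; rewrite setTI.
Qed.

Lemma measurable_fun_rV d (T : measurableType d) n (f : T -> 'rV[R]_n) :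
  (forall i, measurable_fun setT (@rV_coord R n i \o f)) ->
  measurable_fun setT f.
Proof.
move=> mf.
suff h : g_sigma_preimage (fun i => @rV_coord R n i \o f) `<=` measurable.
  rewrite g_sigma_preimage_comp in h.
  by move=> _ A mA; apply: h; exists A.
apply: smallest_sub; first exact: sigma_algebra_measurable.
rewrite -bigcup_seq/= => A/= [i _ [B mB <-]].
exact: mf.
Qed.

Definition rV_cons n (z : measurableTypeR R * 'rV[R]_n) : 'rV[R]_n.+1 :=
  \row_(i < n.+1) (if unlift ord0 i is Some j then z.2 0 j else z.1).

Definition rV_uncons n (x : 'rV[R]_n.+1) : measurableTypeR R * 'rV[R]_n :=
  (x 0 ord0, \row_(i < n) x 0 (lift ord0 i)).

Lemma rV_consK n : cancel (@rV_cons n) (@rV_uncons n).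
Proof.
case=> a x; rewrite /rV_uncons /rV_cons; congr pair.
  by rewrite mxE unlift_none.
by apply/rowP => i; rewrite !mxE liftK.
Qed.

Lemma measurable_rV_cons n : measurable_fun setT (@rV_cons n).
Proof.
apply: measurable_fun_rV => i.
case: (unliftP ord0 i) => [j|] ->.
  rewrite (_ : _ \o _ = @rV_coord R n j \o snd); last first.
    by apply/funext => z; rewrite /= /rV_coord mxE liftK.
  by apply: measurableT_comp => //; exact: measurable_rV_coord.
rewrite (_ : _ \o _ = fst)//.
by apply/funext => z; rewrite /= /rV_coord mxE unlift_none.
Qed.

Lemma measurable_rV_uncons n : measurable_fun setT (@rV_uncons n).
Proof.
apply: measurable_fun_pair; first exact: measurable_rV_coord.
apply: measurable_fun_rV => i.
rewrite (_ : _ \o _ = @rV_coord R n.+1 (lift ord0 i)).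
  exact: measurable_rV_coord.
by apply/funext => z; rewrite /= /rV_coord mxE.
Qed.

Section lebesgue_cons.
Local Open Scope ereal_scope.
Variables (n : nat) (m : {sigma_finite_measure set 'rV[R]_n -> \bar R}).

Definition lebesgue_cons : set 'rV[R]_n.+1 -> \bar R :=
  pushforward (@lebesgue_measure R \x m) (@rV_cons n).

Let lebesgue_cons0 : lebesgue_cons set0 = 0.
Proof. by rewrite /lebesgue_cons /pushforward preimage_set0 measure0. Qed.

Let lebesgue_cons_ge0 A : 0 <= lebesgue_cons A.
Proof. by rewrite /lebesgue_cons /pushforward measure_ge0. Qed.

Let lebesgue_cons_sigma_additive : semi_sigma_additive lebesgue_cons.
Proof.
have mf := @measurable_rV_cons n.
move=> F mF tF mUF; rewrite /lebesgue_cons /pushforward preimage_bigcup.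
apply: measure_semi_sigma_additive.
- by move=> k; rewrite -[X in measurable X]setTI; exact: mf.
- apply/trivIsetP => /= i j _ _ ij; rewrite -preimage_setI.
  by move/trivIsetP : tF => /(_ _ _ _ _ ij) ->//; rewrite preimage_set0.
- by rewrite -preimage_bigcup -[X in measurable X]setTI; exact: mf.
Qed.

HB.instance Definition _ := isMeasure.Build _ _ _ lebesgue_cons
  lebesgue_cons0 lebesgue_cons_ge0 lebesgue_cons_sigma_additive.

Let lebesgue_cons_sigma_finite : sigma_finite setT lebesgue_cons.
Proof.
have /sigma_finiteP[F [TF ndF Foo]] := sigma_finiteT (@lebesgue_measure R).
have /sigma_finiteP[G [TG ndG Goo]] := sigma_finiteT m.
exists (fun k => @rV_uncons n @^-1` (F k `*` G k)).
  apply/seteqP; split=> // x _; have [k _ Fk] : (\bigcup_k F k) (rV_uncons x).1.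
    by rewrite -TF.
  have [l _ Gl] : (\bigcup_k G k) (rV_uncons x).2 by rewrite -TG.
  exists (maxn k l) => //; split => /=.
  - by move: Fk; exact/subsetPset/ndF/leq_maxl.
  - by move: Gl; exact/subsetPset/ndG/leq_maxr.
move=> k; have [? ?] := Foo k; have [? ?] := Goo k; split.
  rewrite -[X in measurable X]setTI; apply: measurable_rV_uncons => //.
  exact: measurableX.
rewrite /lebesgue_cons /pushforward -comp_preimage.
rewrite (_ : _ \o _ = id); last by apply/funext => z; exact: rV_consK.
by rewrite preimage_id product_measure1E// lte_mul_pinfty// ge0_fin_numE.
Qed.

HB.instance Definition _ := Measure_isSigmaFinite.Build _ _ _ lebesgue_cons
  lebesgue_cons_sigma_finite.

End lebesgue_cons.

Fixpoint lebesgue_rV n : {sigma_finite_measure set 'rV[R]_n -> \bar R} :=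
  if n is k.+1 then lebesgue_cons (lebesgue_rV k) else \d_(0 : 'rV[R]_0).

Lemma measurable_rV_box n (A : 'I_n -> set (measurableTypeR R)) :
  (forall i, measurable (A i)) -> measurable [set x : 'rV[R]_n | forall i, A i (x 0 i)].
Proof.
move=> mA; rewrite (_ : mkset _ = \big[setI/setT]_(i < n) (@rV_coord R n i @^-1` A i)).
  apply: bigsetI_measurable => i _; rewrite -[X in measurable X]setTI.
  exact: measurable_rV_coord.
by rewrite -bigcap_seq; apply/seteqP; split=> x /= h i; [move=> _|];
  apply: h; rewrite /= ?mem_index_enum.
Qed.

Lemma lebesgue_rV_box n (a b : 'rV[R]_n) : (forall i, a 0 i <= b 0 i) ->
  lebesgue_rV n [set x | forall i, x 0 i \in `[a 0 i, b 0 i]] =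
  (\prod_(i < n) (b 0 i - a 0 i))%:E.
Proof.
elim: n a b => [|n IH] a b ab.
  rewrite big_ord0 /= diracE mem_set//; case=> //.
have mB : measurable [set x : 'rV[R]_n | forall i,
    x 0 i \in `[a 0 (lift ord0 i), b 0 (lift ord0 i)]].
  by apply: (@measurable_rV_box n (fun i => `[a 0 (lift ord0 i), b 0 (lift ord0 i)]%classic)).
rewrite /= /lebesgue_cons /pushforward.
rewrite [X in (_ \x _)%E X](_ : _ = `[a 0 ord0, b 0 ord0]%classic `*`
    [set x : 'rV[R]_n | forall i,
      x 0 i \in `[a 0 (lift ord0 i), b 0 (lift ord0 i)]]).
  have l1 : @lebesgue_measure R `[a 0 ord0, b 0 ord0]%classic = (b 0 ord0 - a 0 ord0)%:E.
    rewrite lebesgue_measure_itv/= lte_fin EFinB; case: ltgtP (ab ord0) => // -> _.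
    by rewrite -EFinB subrr.
  rewrite product_measure1E//= l1.
  have := IH (\row_i a 0 (lift ord0 i)) (\row_i b 0 (lift ord0 i)).
  rewrite (eq_bigr (fun i => b 0 (lift ord0 i) - a 0 (lift ord0 i))); last first.
    by move=> i _; rewrite !mxE.
  rewrite big_ord_recl EFinM => <-; last by move=> i; rewrite !mxE.
  congr (_ * lebesgue_rV n _)%E.
  by apply/seteqP; split=> x /= h i; move: (h i); rewrite !mxE.
apply/seteqP; split=> [[c x]|[c x] [/= hc hx] i].
  move=> /= h; split=> [|i /=].
    by have := h ord0; rewrite mxE unlift_none.
  by have := h (lift ord0 i); rewrite mxE liftK.
by case: (unliftP ord0 i) => [j|] ->; rewrite mxE ?liftK ?unlift_none//; exact: hx.
Qed.

End rV_cons.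

Section Sobolev.
Context {R : realType} {n : nat}.
Implicit Types (D U : set 'rV[R]_n) (f v u : 'rV[R]_n -> R)
  (G : 'rV[R]_n -> 'rV[R]_n) (p : R) (x y z : 'rV[R]_n).

Let mu := @lebesgue_rV R n.

(* The library norm on 'rV[R]_n is the max norm; Euclidean lengths are needed
   in the p-Laplacian. *)
Definition dotrV x y : R := \sum_(i < n) x 0 i * y 0 i.
Definition enorm x : R := Num.sqrt (dotrV x x).

Definition pderiv (i : 'I_n) f : 'rV[R]_n -> R :=
  fun y => 'D_(delta_mx 0 i) f y.
Definition grad f : 'rV[R]_n -> 'rV[R]_n := fun y => \row_i pderiv i f y.

(* C^oo on the open set U: partial derivatives of all orders exist and are
   continuous at every point of U. *)
Definition smooth_on U f := forall (s : seq 'I_n) y, U y ->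
  {for y, continuous (foldr pderiv f s)} /\
  forall i, derivable (foldr pderiv f s) y (delta_mx 0 i).

(* Near each boundary point, D is the sublevel set {r < 0} of a smooth
   function r without critical points. *)
Definition smooth_boundary D := forall z, (closure D `\` D) z ->
  exists (U : set 'rV[R]_n) (r : 'rV[R]_n -> R),
    [/\ open U, U z, smooth_on U r, (forall y, U y -> grad r y != 0) &
        D `&` U = [set y | U y /\ r y < 0]].

Definition smooth_bounded_domain D :=
  [/\ open D, D !=set0, connected D, bounded_set D & smooth_boundary D].

(* The standard norm of L^q(D), 1 <= q <= +oo. *)
Definition LqnormE D (q : \bar R) f : \bar R := Lnorm mu q (EFin \o (f \_ D)).
Definition Lqnorm D (q : \bar R) f : R := fine (LqnormE D q f).

Definition in_Lq D (q : \bar R) f :=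
  measurable_fun D f /\ (LqnormE D q f < +oo)%E.

Definition loc_integrable D f :=
  forall K, compact K -> K `<=` D -> mu.-integrable K (EFin \o f).

(* C_c^oo(D) *)
Definition test_fun D f := [/\ smooth_on setT f,
  compact (closure [set y | f y != 0]) & closure [set y | f y != 0] `<=` D].

Definition is_wgrad D f G := [/\ loc_integrable D f,
  (forall i, loc_integrable D (fun y => G y 0 i)) &
  forall phi i, test_fun D phi ->
    \int[mu]_(y in D) (f y * pderiv i phi y) =
    - \int[mu]_(y in D) (G y 0 i * phi y)].

(* The weak gradient is unique up to a null set; wgrad is one of its
   representatives (and 0 if there is none). *)
Definition wgrad D f : 'rV[R]_n -> 'rV[R]_n :=
  xget (fun=> 0) [set G | is_wgrad D f G].

Definition W1p D p f := [/\ in_Lq D p%:E f, exists G, is_wgrad D f G &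
  forall i, in_Lq D p%:E (fun y => wgrad D f y 0 i)].

(* W_0^{1,p}(D) is the closure of C_c^oo(D) in W^{1,p}(D). For p > n, an element
   is given by its representative that is continuous on closure D; only the
   values on closure D matter, and they vanish on the boundary as a consequence
   of the density of C_c^oo(D). *)
Definition W01p D p v := [/\ {within closure D, continuous v}, W1p D p v &
  forall e : R, 0 < e -> exists phi, [/\ test_fun D phi,
    (LqnormE D p%:E (fun y => v y - phi y)%R < e%:E)%E &
    (LqnormE D p%:E (fun y => enorm (wgrad D v y - grad phi y))%R < e%:E)%E]].

Definition grad_norm D p v : R := Lqnorm D p%:E (fun y => enorm (wgrad D v y)).

Definition s_ D p x : R :=
  if x \in D then
    sup [set `|v x| / grad_norm D p v | v in
          [set v | W01p D p v /\ exists2 z, closure D z & v z != 0]]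
  else 0.

Definition M_ D p x v :=
  [/\ W01p D p v, `|v x| = 1 & Lqnorm D +oo%E v = 1].

(* Weak solutions of - Delta_p u = m delta_x in D, u = 0 on the boundary. If
   p < 2, the integrand is 0 where the gradient of u vanishes. *)
Definition dirac_weak_solution D p (m : R) x u := W01p D p u /\
  forall phi, W01p D p phi ->
    \int[mu]_(y in D) (enorm (wgrad D u y) `^ (p - 2) *
                       dotrV (wgrad D u y) (wgrad D phi y)) = m * phi x.

(* C_0^{0,a}(closure D) *)
Definition holder0 D (a : R) f :=
  (exists C : R, forall y z, closure D y -> closure D z ->
     `|f y - f z| <= C * enorm (y - z) `^ a) /\
  forall y, (closure D `\` D) y -> f y = 0.

End Sobolev.

(* Main.v *)
Require Import Defs.
From HB Require Import structures.
From mathcomp Require Import all_boot all_order all_algebra.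
From mathcomp Require Import all_classical all_reals all_analysis.
From mathcomp Require Import measurable_realfun ess_sup_inf ring lra.

Set Implicit Arguments.
Unset Strict Implicit.
Unset Printing Implicit Defensive.
Import Order.TTheory GRing.Theory Num.Theory.
Import numFieldNormedType.Exports.
Local Open Scope classical_set_scope.
Local Open Scope ring_scope.

(* Sobolev theory is reduced to one fact: by Morrey's inequality on cubes (obtained for C^1
   functions by differentiating t |-> int_Q f (z + t (y - z)) dy), the elements of W_0^{1,p} and
   their weak gradients are exactly the pairs (v, H) for which some test functions phi tend to v
   uniformly while grad phi tends to H in L^p.  Sup bounds, Hoelder bounds and chain rules pass
   to these limits; this gives (a) and (c).

   Testing the equation with u and using Young's inequality |A|^(p-2) A.B <= (1 - 1/p) |A|^p +
   |B|^p / p gives s_p(x) |grad u|_p = 1 and u(x) = 1; the equality case gives (b).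

   Range of u: with P' = (2t - 1)^(2j) (up to a factor), the test function P(u) shows that the
   even moments of 2u - 1 against |grad u|^p are at most s_p(x)^(-p), so that |(2u - 1)^(2j+1)|
   grows at most linearly in j; hence 0 <= u <= 1.

   Since p > N, Harnack's inequality is elementary.  Let tau = u + e or tau = 1 - u + e.  Testing
   with eta^q tau^(1-p) bounds the L^p norm of grad tau / tau near any point (away from x in the
   second case) independently of e, and Morrey's inequality for tau^(-b), b small, then shows that
   the zero sets of u and of 1 - u are open in D, resp. D minus {x}.  So u > 0 by connectedness;
   and a point of the compact set {u = 1} farther than x in some coordinate direction would
   contradict the existence of a point of this set extremal in that direction. *)

(** * Boxes and Lebesgue measure *)

Section boxes.
Context {R : realType} {n : nat}.
Implicit Types (a b x y z : 'rV[R]_n) (A : set 'rV[R]_n).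

(** Two features of the definitions shape the argument. [wgrad] is one representative among almost
    everywhere equal ones, so nothing can be computed with it pointwise; the calculus is done on
    pairs [W0lim v H] with an explicit [H], which is identified with [wgrad D v] only up to null
    sets. And W_0^{1,p} is given through smooth functions, so a truncation such as min(u, 1) would
    first require a chain rule for Lipschitz maps. Polynomials without constant term and real powers
    of a function bounded away from 0 are used instead, since they act on smooth functions and pass
    to uniform limits. This is why 0 <= u <= 1 comes from the growth of moments; the powers are
    those of 2u - 1 because both bounds are obtained at once. The power tau^(-b) in the Harnack step
    is chosen for its homogeneity: its oscillation is bounded by a multiple of b e^(-b), and e^(-b)
    is its value at a point where tau = e, so some b independent of e makes the oscillation at most
    half of that value. *)

Definition box a b : set 'rV[R]_n := [set x | forall i, x 0 i \in `[a 0 i, b 0 i]].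

Lemma boxP a b x : box a b x <-> forall i, a 0 i <= x 0 i <= b 0 i.
Proof. by split=> h i; move: (h i); rewrite in_itv. Qed.

Lemma rV_norm_le x (e : R) : 0 <= e -> (forall i, `|x 0 i| <= e) -> `|x| <= e.
Proof.
move=> e0 h; rewrite [leLHS]/Num.Def.normr/= mx_normrE; apply/bigmax_leP; split => //.
by move=> [i j] _ /=; rewrite (ord1 i).
Qed.

Lemma rV_coord_le x i : `|x 0 i| <= `|x|.
Proof.
rewrite [leRHS]/Num.Def.normr/= mx_normrE.
by apply/bigmax_geP; right => /=; exists (0, i).
Qed.

Lemma measurable_box a b : measurable (box a b).
Proof.
by apply: (@measurable_rV_box _ n (fun i => `[a 0 i, b 0 i]%classic)).
Qed.

Definition boxes : set (set 'rV[R]_n) := [set A | exists a b, A = box a b].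

Lemma setI_closed_boxes : setI_closed boxes.
Proof.
move=> _ _ [a [b ->]] [c [d ->]].
exists (\row_i Num.max (a 0 i) (c 0 i)), (\row_i Num.min (b 0 i) (d 0 i)).
apply/seteqP; split=> x.
  move=> [/boxP h1 /boxP h2]; apply/boxP => i; rewrite !mxE.
  by rewrite ge_max le_min; move/andP: (h1 i) => [-> ->]; move/andP: (h2 i) => [-> ->].
move/boxP => h; split; apply/boxP => i; move: (h i); rewrite !mxE ge_max le_min.
  by move=> /andP[/andP[-> _] /andP[-> _]].
by move=> /andP[/andP[_ ->] /andP[_ ->]].
Qed.

Definition cube (k : nat) : set 'rV[R]_n := box (const_mx (- k%:R)) (const_mx k%:R).

Lemma bigcup_cube : \bigcup_k cube k = setT.
Proof.
apply/seteqP; split=> // x _; exists (Num.truncn `|x|).+1 => //.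
apply/boxP => i; rewrite !mxE -ler_norml (le_trans (rV_coord_le _ _))//.
exact/ltW/truncnS_gt.
Qed.

(** The product sigma-algebra is generated by the sets {x_i >= r}, and each of them is the union
    over [k] of the boxes with side [r, k] in direction [i] and [-k, k] in the others. *)
Lemma measurable_boxesE : (@measurable _ 'rV[R]_n) = <<s boxes >>.
Proof.
apply/seteqP; split; last first.
  apply: smallest_sub; first exact: sigma_algebra_measurable.
  by move=> _ [a [b ->]]; exact: measurable_box.
apply: smallest_sub; first exact: smallest_sigma_algebra.
rewrite -bigcup_seq => A [i _ [B mB <-]] {A}; rewrite setTI.
have : (@RGenCInfty.G R).-sigma.-measurable B.
  by rewrite -RGenCInfty.measurableE.
move: B {mB}; apply: smallest_sub.
  split => /=.
  - by rewrite preimage_set0; exact: sigma_algebra0.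
  - move=> A mA; rewrite setTD preimage_setC.
    by rewrite -setTD; apply: sigma_algebraCD.
  - by move=> F mF; rewrite preimage_bigcup; exact: sigma_algebra_bigcup.
move=> _ [r ->] /=.
rewrite (_ : _ @^-1` _ = \bigcup_k box
    (\row_j if j == i then r else - k%:R) (const_mx k%:R)); last first.
  apply/seteqP; split=> x /=; rewrite /rV_coord in_itv/= andbT.
    move=> rx; exists (Num.truncn `|x|).+1 => //; apply/boxP => j.
    have : `|x 0 j| <= (Num.truncn `|x|).+1%:R.
      by rewrite (le_trans (rV_coord_le _ _))//; exact/ltW/truncnS_gt.
    by rewrite ler_norml !mxE => /andP[h1 ->]; rewrite andbT; case: eqP => [->|].
  by move=> [k _ /boxP/(_ i)]; rewrite !mxE eqxx => /andP[].
apply: sigma_algebra_bigcup => k; apply: sub_sigma_algebra.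
by exists (\row_j if j == i then r else - k%:R), (const_mx k%:R).
Qed.

Lemma box_lty a b : (lebesgue_rV n (box a b) < +oo)%E.
Proof.
have [ab|] := pselect (forall i, a 0 i <= b 0 i).
  by rewrite lebesgue_rV_box// ltry.
move/existsNP => [i abi]; rewrite (_ : box a b = set0) ?measure0//.
apply/seteqP; split=> // x /boxP/(_ i)/andP[h1 h2].
by apply: abi; exact: le_trans h2.
Qed.

Lemma lebesgue_rV_unique (m1 m2 : {measure set 'rV[R]_n -> \bar R}) :
  (forall a b, m1 (box a b) = m2 (box a b)) ->
  (forall a b, (m1 (box a b) < +oo)%E) ->
  forall A, measurable A -> m1 A = m2 A.
Proof.
move=> m12 m1oo A mA; apply: (measure_unique boxes cube) => //.
- exact: measurable_boxesE.
- exact: setI_closed_boxes.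
- by move=> k; exists (const_mx (- k%:R)), (const_mx k%:R).
- exact: bigcup_cube.
- by move=> _ [a [b ->]].
- by move=> k; exact: m1oo.
Qed.

Definition obox a b : set 'rV[R]_n := [set x | forall i, a 0 i < x 0 i < b 0 i].

Lemma obox_sub_box a b : obox a b `<=` box a b.
Proof. by move=> x h; apply/boxP => i; have /andP[/ltW-> /ltW->] := h i. Qed.

Lemma measurable_obox a b : measurable (obox a b).
Proof.
rewrite (_ : obox a b = [set x | forall i, `]a 0 i, b 0 i[%classic (x 0 i)]).
  exact: (@measurable_rV_box _ n (fun i => `]a 0 i, b 0 i[%classic)).
by apply/seteqP; split=> x h i; move: (h i); rewrite /= in_itv.
Qed.

Lemma nbhs_box y (U : set 'rV[R]_n) : nbhs y U ->
  exists2 r : R, 0 < r & box (y - const_mx r) (y + const_mx r) `<=` U.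
Proof.
move=> /nbhs_ballP[e /= e0 yeU]; exists (e / 2); first by rewrite divr_gt0.
move=> z /boxP h; apply: yeU; rewrite -ball_normE /=.
apply: (@le_lt_trans _ _ (e / 2)); last lra.
apply: rV_norm_le => [|i]; first lra.
by have := h i; rewrite !mxE ler_norml; lra.
Qed.

(** Pairs of rational corners are countable; a pair whose closed box leaves [U] contributes the
    empty set. Closed boxes are kept inside [U] because a locally integrable function is integrable
    on them. *)
Lemma open_bigcup_obox (U : set 'rV[R]_n) : open U ->
  exists F : nat -> set 'rV[R]_n, U = \bigcup_k F k /\
    forall k, F k = set0 \/ exists a b, F k = obox a b /\ box a b `<=` U.
Proof.
move=> oU.
pose F (k : nat) : set 'rV[R]_n :=
  if unpickle k is Some qr then
    let a := map_mx (ratr : rat -> R) (qr : 'rV[rat]_n * 'rV[rat]_n).1 in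
    let b := map_mx ratr qr.2 in
    if `[< box a b `<=` U >] then obox a b else set0 else set0.
exists F; split; last first.
  move=> k; rewrite /F; case: unpickle => [[q r]|]; last by left.
  by case: asboolP => [h|]; [right; exists (map_mx ratr q), (map_mx ratr r)|left].
apply/seteqP; split => [x Ux|x [k _]]; last first.
  rewrite /F; case: unpickle => // -[q r]; case: asboolP => // + h; apply.
  exact: obox_sub_box.
have [e e0 xeU] := nbhs_box (open_nbhs_nbhs (conj oU Ux)).
have h1 i : {q : rat | x 0 i - e < ratr q < x 0 i}.
  have h : x 0 i - e < x 0 i by lra.
  by have /cid[q] := rat_in_itvoo h; rewrite in_itv/=; exists q.
have h2 i : {q : rat | x 0 i < ratr q < x 0 i + e}.
  have h : x 0 i < x 0 i + e by lra.
  by have /cid[q] := rat_in_itvoo h; rewrite in_itv/=; exists q.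
exists (pickle (\row_i sval (h1 i), \row_i sval (h2 i))) => //.
rewrite /F pickleK /=; case: asboolP.
  move=> _ i; rewrite !mxE.
  by case: (h1 i) => q /= /andP[_ ->]; case: (h2 i) => r /= /andP[-> _].
move=> []; move=> y /boxP h; apply: xeU; apply/boxP => i; move: (h i); rewrite !mxE.
by case: (h1 i) => q /= /andP[q1 q2]; case: (h2 i) => r /= /andP[r1 r2] /andP[qy yr]; lra.
Qed.

Lemma open_rV_measurable (U : set 'rV[R]_n) : open U -> measurable U.
Proof.
move=> /open_bigcup_obox[F [-> HF]]; apply: bigcupT_measurable => k.
by have [->|[a [b [-> _]]]] := HF k; [exact: measurable0|exact: measurable_obox].
Qed.

Lemma continuous_rV_measurable (f : 'rV[R]_n -> R) :
  continuous f -> measurable_fun setT f.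
Proof.
move=> /continuousP cf; apply: (measurability (@RGenOpens.G R)).
  exact: RGenOpens.measurableE.
move=> _ [_ [a [b ->] <-]]; rewrite setTI.
by apply: open_rV_measurable; apply: cf; exact: interval_open.
Qed.

Lemma open_continuous_measurable (D : set 'rV[R]_n) (f : 'rV[R]_n -> R) :
  open D -> {in D, continuous f} -> measurable_fun D f.
Proof.
move=> oD cf; apply: (measurability (@RGenOpens.G R)).
  exact: RGenOpens.measurableE.
move=> _ [_ [a [b ->] <-]]; apply: open_rV_measurable.
have /(_ `]a, b[%classic (@interval_open _ _ _ _ _)) := (continuous_inP f oD).1 cf.
exact.
Qed.

Lemma measurable_affine w (t : R) :
  measurable_fun setT (fun y => w + t *: y).
Proof.
apply: measurable_fun_rV => i.
rewrite (_ : _ \o _ = (fun y => w 0 i + t * rV_coord i y)).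
  apply: measurable_funD => //; apply: measurable_realfun.measurable_funM => //.
  exact: measurable_rV_coord.
by apply/funext => y; rewrite /= /rV_coord !mxE.
Qed.

(** Both sides are measures in [A], finite on boxes, so comparing them on boxes is enough; corners
    in the wrong order, which give an empty box, are treated apart. *)
Lemma lebesgue_rV_affine w (t : R) A : 0 < t -> measurable A ->
  lebesgue_rV n ((fun y => w + t *: y) @^-1` A) = ((t ^- n)%:E * lebesgue_rV n A)%E.
Proof.
move=> t0 mA.
have tn0 : 0 <= t ^- n by rewrite invr_ge0 exprn_ge0// ltW.
have mT := measurable_affine w t.
pose S y := w + t *: y.
pose m1 : {measure set _ -> \bar R} := pushforward (lebesgue_rV n) S.
pose m2 : {measure set _ -> \bar R} := mscale (NngNum tn0) (lebesgue_rV n).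
have : m1 mT A = m2 A.
  apply: lebesgue_rV_unique => // a b.
    have tE : S @^-1` box a b = box (t^-1 *: (a - w)) (t^-1 *: (b - w)).
      apply/seteqP; split => y /boxP h; apply/boxP => i; move: (h i);
      rewrite !mxE ler_pdivrMl// ler_pdivlMl// => /andP[h1 h2]; apply/andP; split; lra.
    change (lebesgue_rV n (S @^-1` box a b) = ((t ^- n)%:E * lebesgue_rV n (box a b))%E).
    rewrite tE.
    have [ab|] := pselect (forall i, a 0 i <= b 0 i).
      rewrite !lebesgue_rV_box// => [|i]; last first.
        by rewrite !mxE ler_pM2l ?invr_gt0//; have := ab i; lra.
      rewrite -EFinM; congr _%:E.
      under eq_bigr do rewrite !mxE -mulrBr opprB addrA subrK.
      by rewrite big_split/= prodr_const card_ord exprVn.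
    move/existsNP => [i abi].
    have e0 : box a b = set0.
      apply/seteqP; split=> // x /boxP/(_ i)/andP[h1 h2].
      by apply: abi; exact: le_trans h2.
    by rewrite -tE e0 preimage_set0 !measure0 mule0.
  have -> : m1 mT (box a b) = lebesgue_rV n (box (t^-1 *: (a - w)) (t^-1 *: (b - w))).
    congr (lebesgue_rV n _).
      apply/seteqP; split => y /boxP h; apply/boxP => i; move: (h i);
      rewrite !mxE ler_pdivrMl// ler_pdivlMl// => /andP[h1 h2]; apply/andP; split; lra.
  exact: box_lty.
by [].
Qed.

Lemma integral_rV_affine (w : 'rV[R]_n) (t : R) A (F : 'rV[R]_n -> \bar R) :
  0 < t -> measurable A -> measurable_fun A F ->
  (forall y, A y -> 0 <= F y)%E ->
  (\int[lebesgue_rV n]_(y in (fun y => w + t *: y)%R @^-1` A) F (w + t *: y)%R =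
   (t ^- n)%R%:E * \int[lebesgue_rV n]_(y in A) F y)%E.
Proof.
move=> t0 mA mF F0.
have tn0 : 0 <= t ^- n by rewrite invr_ge0 exprn_ge0// ltW.
have mT := measurable_affine w t.
pose S y := w + t *: y.
have /= <- := @ge0_integral_mscale _ _ _ (lebesgue_rV n) A mA (NngNum tn0) F mF F0.
rewrite -[LHS](@ge0_integral_pushforward _ _ _ _ _ S mT (lebesgue_rV n) A)//; last first.
  by move=> y /[!inE]; exact: F0.
apply: eq_measure_integral => B mB BA.
exact: lebesgue_rV_affine.
Qed.

End boxes.

(** * Directional derivatives and Young's inequality *)

Section directional_derivative.
Context {R : realType} {n : nat}.
Implicit Types (f : 'rV[R]_n -> R) (a v y : 'rV[R]_n).

Lemma is_derive_line f a v t : derivable f (a + t *: v) v ->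
  is_derive t 1 (fun s => f (a + s *: v)) ('D_v f (a + t *: v)).
Proof.
move=> df.
have E : (fun h : R => h^-1 *: (((fun s => f (a + s *: v)) \o shift t) (h *: (1 : R)) -
      f (a + t *: v))) =
    (fun h => h^-1 *: ((f \o shift (a + t *: v)) (h *: v) - f (a + t *: v))).
  apply/funext => h /=; congr (_ *: (f _ - _)).
  by rewrite scaler1 scalerDl addrCA addrA.
apply: DeriveDef; first by rewrite /derivable E.
by rewrite /derive E.
Qed.

Definition C1fun f := continuous f /\
  forall i, (forall y, derivable f y (delta_mx 0 i)) /\ continuous (pderiv i f).

Lemma coord_increment f i y (s c e : R) :
  (forall y, derivable f y (delta_mx 0 i)) ->
  (forall t, `|t| <= `|s| -> `|pderiv i f (y + t *: delta_mx 0 i) - c| <= e) ->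
  `|f (y + s *: delta_mx 0 i) - f y - s * c| <= `|s| * e.
Proof.
move=> df hc.
pose g t := f (y + t *: delta_mx 0 i).
have dg (t : R) : is_derive t 1 g (pderiv i f (y + t *: delta_mx 0 i)) by exact: is_derive_line.
have g0 : f y = g 0 by rewrite /g scale0r addr0.
have cg A : {within A, continuous g}.
  apply: continuous_subspaceT => t.
  by apply/differentiable_continuous/derivable1_diffP; case: (dg t).
rewrite g0 -/(g s).
have [s0|s0] := leP 0 s.
  have [t + ->] := @MVT_segment _ g _ 0 s s0 (fun t _ => dg t) (cg _).
  rewrite in_itv/= => /andP[t0 ts]; rewrite subr0 -mulrC -mulrBr normrM ler_wpM2l//.
  by apply: hc; rewrite !ger0_norm.
have [t + E] := @MVT_segment _ g _ s 0 (ltW s0) (fun t _ => dg t) (cg _).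
rewrite in_itv/= => /andP[t0 ts].
rewrite -(opprB (g 0) (g s)) E sub0r mulrN opprK mulrC -mulrBr normrM ler_wpM2l//.
by apply: hc; rewrite !ler0_norm ?lerN2// ltW.
Qed.

(** The coordinates are changed one at a time: [w k] agrees with [v] in the first [k] coordinates
    and is 0 in the others. Each of the increments is estimated by the mean value theorem, the
    partial derivatives being within [e] of their values at [a] near that point. *)
Lemma C1fun_is_derive f a v : C1fun f ->
  is_derive a v f (\sum_(i < n) v 0 i * pderiv i f a).
Proof.
move=> [cf Cf]; set S := \sum_(i < n) _.
have key (e : R) : 0 < e -> \forall h \near (0 : R),
    `|f (a + h *: v) - f a - h * S| <= `|h| * ((\sum_(i < n) `|v 0 i|) * e).
  move=> e0.
  have : \forall y \near a, forall i, `|pderiv i f y - pderiv i f a| <= e.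
    apply: (@filter_forall _ _ (fun i y => `|pderiv i f y - pderiv i f a| <= e) (nbhs a)) => i; have /cvgrPdist_le/(_ _ e0) := (Cf i).2 a.
    by apply: filterS => y; rewrite distrC.
  move=> /nbhs_ballP[d /= d0 hd].
  have d1 : 0 < d / (1 + `|v|) by rewrite divr_gt0// ltr_wpDr.
  near=> h.
  have hv : `|h| * `|v| < d.
    apply: (@le_lt_trans _ _ (`|h| * (1 + `|v|))); first by rewrite ler_wpM2l// lerDr.
    rewrite -ltr_pdivlMr ?ltr_wpDr//; near: h; exact: nbhs0_lt d1.
  pose w k : 'rV[R]_n := \row_i (if (i < k)%N then v 0 i else 0).
  have aux k : (k <= n)%N ->
      `|f (a + h *: w k) - f a - h * (\sum_(i < n | (i < k)%N) v 0 i * pderiv i f a)| <=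
      `|h| * ((\sum_(i < n | (i < k)%N) `|v 0 i|) * e).
    elim: k => [_|k IH kn].
      rewrite !big_pred0//; rewrite mul0r !mulr0 subr0 (_ : w 0%N = 0).
        by rewrite scaler0 addr0 subrr normr0.
      by apply/rowP => i; rewrite !mxE.
    pose i0 := Ordinal kn.
    have E (F : 'I_n -> R) : \sum_(i < n | (i < k.+1)%N) F i =
        F i0 + \sum_(i < n | (i < k)%N) F i.
      rewrite (bigD1 i0)//=; congr (_ + _); apply: eq_bigl => i.
      by rewrite -(inj_eq val_inj)/= ltnS ltn_neqAle andbC.
    rewrite !E.
    have wE : a + h *: w k.+1 = a + h *: w k + (h * v 0 i0) *: delta_mx 0 i0.
      apply/rowP => i; rewrite !mxE/= -addrA; congr (_ + _).
      rewrite -mulrA -mulrDr; congr (_ * _).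
      case: eqP => [->|/eqP ne]; first by rewrite /= ltnn ltnSn mulr1 add0r.
      by move: ne; rewrite -(inj_eq val_inj)/= mulr0 addr0 ltnS leq_eqVlt => /negbTE->.
    have := @coord_increment f i0 (a + h *: w k) (h * v 0 i0) (pderiv i0 f a) e (Cf i0).1.
    rewrite -wE => /(_ _)/le_trans H.
    have {}H : `|f (a + h *: w k.+1) - f (a + h *: w k) - h * v 0 i0 * pderiv i0 f a| <=
       `|h * v 0 i0| * e.
      apply: H => // t ht; apply: hd; rewrite -ball_normE /=.
      apply: le_lt_trans hv; apply: rV_norm_le; first by rewrite mulr_ge0.
      move=> i; rewrite !mxE/= !opprD !addrA subrr add0r -opprD.
      rewrite normrN; case: eqP => [->|_].
        rewrite /= ltnn mulr0 add0r mulr1 (le_trans ht)// normrM ler_wpM2l//.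
        exact: rV_coord_le.
      rewrite mulr0 addr0 normrM ler_wpM2l//; case: ifP => _; first exact: rV_coord_le.
      by rewrite normr0.
    have := IH (ltnW kn).
    move: H; rewrite normrM mulrDl mulrDr (mulrDr h) !mulrA.
    move: (`|h| * _ * e) => A; move: (`|h| * _ * e) => B.
    rewrite !ler_norml => /andP[h1 h2] /andP[h3 h4]; apply/andP; split; lra.
  have := aux n (leqnn n).
  rewrite (_ : w n = v); last by apply/rowP => i; rewrite mxE ltn_ord.
  have bT (F : 'I_n -> R) : \sum_(i < n | (i < n)%N) F i = \sum_(i < n) F i.
    by apply: eq_bigl => i; rewrite ltn_ord.
  by rewrite !bT.
have cvS : h^-1 *: ((f \o shift a) (h *: v) - f a) @[h --> (0:R)^'] --> S.
  apply/cvgrPdist_le => e e0.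
  pose m := 1 + \sum_(i < n) `|v 0 i|.
  have m0 : 0 < m by rewrite ltr_wpDr// sumr_ge0.
  have em : 0 < e / m by rewrite divr_gt0.
  near=> h.
  have h0 : h != 0 by near: h; exact: nbhs_dnbhs_neq.
  have : `|f (a + h *: v) - f a - h * S| <= `|h| * ((\sum_(i < n) `|v 0 i|) * (e / m)).
    by near: h; apply: nbhs_dnbhs; exact: key.
  rewrite /= (addrC (h *: v)) => H.
  have -> : S - h^-1 *: (f (a + h *: v) - f a) =
      - (h^-1 * (f (a + h *: v) - f a - h * S)).
    by rewrite mulrBr mulKf// opprB; congr (_ - _).
  rewrite normrN normrM normfV ler_pdivrMl ?normr_gt0// (le_trans H)//.
  rewrite ler_wpM2l// mulrCA ler_piMr ?(ltW e0)// ler_pdivrMr// mul1r.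
  by rewrite /m lerDr.
apply: DeriveDef; first by apply/cvg_ex; exists S.
exact: cvg_lim.
Unshelve. all: by end_near. Qed.

End directional_derivative.

Section young.
Context {R : realType}.
Implicit Types (a b t p : R).

(** Strict inequality between the weighted geometric and arithmetic means of 1 and t^p, with weights
    1 - 1/p and 1/p. If M is the arithmetic mean, ln z <= z - 1 at z = t^p / M and at z = 1 / M,
    averaged with these weights, gives ln t < ln M. Strictness comes from 1 / M, since M = 1 would
    force t = 1. *)
Lemma powR_gt_tangent p t : 1 < p -> 0 <= t -> t != 1 ->
  t < 1 - p^-1 + t `^ p / p.
Proof.
move=> p1 t0 t1; have p0 : 0 < p by lra.
have ip0 : 0 < p^-1 by rewrite invr_gt0.
have ip1 : p^-1 < 1 by rewrite invf_lt1.
have [->|tn0] := eqVneq t 0; first by rewrite powR0 ?gt_eqF// mul0r; lra.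
have {}t0 : 0 < t by rewrite lt_neqAle eq_sym tn0.
have tp0 : 0 < t `^ p by exact: powR_gt0.
set M := 1 - p^-1 + t `^ p / p.
have tpp : 0 < t `^ p / p by rewrite divr_gt0.
have M0 : 0 < M by rewrite /M; lra.
have lnle z : 0 < z -> ln z <= z - 1.
  by move=> z0; have := expR_ge1Dx (ln z); rewrite lnK ?posrE//; lra.
have M1 : M != 1.
  apply: contra t1 => /eqP M1.
  have : t `^ p == 1.
    have E : t `^ p = p * (t `^ p / p) by field; rewrite gt_eqF.
    have E2 : t `^ p / p = p^-1 by move: M1; rewrite /M; lra.
    by apply/eqP; rewrite E E2 divff ?gt_eqF.
  by rewrite powR_eq1 (gt_eqF p0) (ltNge t) (ltW t0) !orbF.
have h2 : ln M^-1 < M^-1 - 1.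
  have := @expR_gt1Dx _ (ln M^-1); rewrite lnK ?posrE ?invr_gt0// => H.
  suff: 1 + ln M^-1 < M^-1 by lra.
  apply: H; rewrite ln_eq0 ?invr_gt0//.
  by apply: contra M1 => /eqP/(congr1 GRing.inv); rewrite invrK invr1 => ->.
have h1 : ln (t `^ p / M) <= t `^ p / M - 1 by apply: lnle; rewrite divr_gt0.
rewrite -ltr_ln ?posrE//.
move: h1; rewrite ln_div ?posrE// ln_powR => h1.
move: h2; rewrite lnV ?posrE// => h2.
have E : p^-1 * (t `^ p / M - 1) + (1 - p^-1) * (M^-1 - 1) = 0.
  have -> : p^-1 * (t `^ p / M - 1) + (1 - p^-1) * (M^-1 - 1) = M / M - 1.
    by rewrite /M; ring.
  by rewrite divff ?gt_eqF// subrr.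
have h1' : p^-1 * (p * ln t - ln M) <= p^-1 * (t `^ p / M - 1) by rewrite ler_pM2l.
have h2' : (1 - p^-1) * (- ln M) < (1 - p^-1) * (M^-1 - 1) by rewrite ltr_pM2l// subr_gt0.
move: h1'; rewrite mulrBr mulKf ?gt_eqF// => h1'.
by lra.
Qed.

Lemma powR_ge_tangent p t : 1 < p -> 0 <= t -> t <= 1 - p^-1 + t `^ p / p.
Proof.
move=> p1 t0; have [->|t1] := eqVneq t 1; first by rewrite powR1 mul1r subrK.
exact/ltW/powR_gt_tangent.
Qed.

Lemma powR_inv a p : 0 <= a -> a^-1 `^ p = (a `^ p)^-1.
Proof. by move=> a0; rewrite -powR_inv1// -powRrM mulN1r powRN. Qed.

Lemma powRK p a : p != 0 -> 0 <= a -> (a `^ p) `^ p^-1 = a.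
Proof. by move=> p0 a0; rewrite -powRrM divff// powRr1. Qed.

Lemma powRVK p a : p != 0 -> 0 <= a -> (a `^ p^-1) `^ p = a.
Proof. by move=> p0 a0; rewrite -powRrM mulVf// powRr1. Qed.

Lemma young_powRB1E p a b : 1 < p -> 0 < a -> 0 <= b ->
  (1 - p^-1) * a `^ p + b `^ p / p - a `^ (p - 1) * b =
  a `^ p * (1 - p^-1 + (b / a) `^ p / p - b / a).
Proof.
move=> p1 a0 b0; have p0 : 0 < p by lra.
have a0' := ltW a0.
have ap : 0 < a `^ p by exact: powR_gt0.
have <- : a `^ p * (b / a) = a `^ (p - 1) * b.
  by rewrite -(mulr_powRB1 a0' p0); field; rewrite gt_eqF.
rewrite powRM ?invr_ge0// powR_inv//.
by field; rewrite !gt_eqF.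
Qed.

Lemma young_powRB1 p a b : 1 < p -> 0 <= a -> 0 <= b ->
  a `^ (p - 1) * b <= (1 - p^-1) * a `^ p + b `^ p / p.
Proof.
move=> p1 a0 b0; have p0 : 0 < p by lra.
have [->|an0] := eqVneq a 0.
  rewrite powR0 ?mul0r; last by rewrite gt_eqF//; lra.
  by rewrite powR0 ?gt_eqF// mulr0 add0r divr_ge0 ?powR_ge0// ltW.
have a_gt0 : 0 < a by rewrite lt0r an0.
rewrite -subr_ge0 young_powRB1E// mulr_ge0 ?powR_ge0// subr_ge0.
by apply: powR_ge_tangent; rewrite ?divr_ge0.
Qed.

(** By homogeneity everything depends on b / a, where the tangent inequality is strict away from 1.
    This equality case is what makes extremal functions unique. *)
Lemma young_powRB1_eq p a b : 1 < p -> 0 <= a -> 0 <= b ->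
  a `^ (p - 1) * b = (1 - p^-1) * a `^ p + b `^ p / p -> a = b.
Proof.
move=> p1 a0 b0; have p0 : 0 < p by lra.
have [->|an0] := eqVneq a 0.
  rewrite powR0 ?mul0r; last by rewrite gt_eqF//; lra.
  rewrite powR0 ?gt_eqF// mulr0 add0r => /esym/eqP.
  by rewrite mulf_eq0 invr_eq0 (gt_eqF p0) orbF => /eqP/powR_eq0_eq0 ->.
have a_gt0 : 0 < a by rewrite lt0r an0.
have [/(congr1 ( *%R^~ a))|ba] := eqVneq (b / a) 1; first by rewrite divfK// mul1r.
move=> /esym/eqP; rewrite -subr_eq0 young_powRB1E// mulf_eq0 (gt_eqF (powR_gt0 _ a_gt0))/=.
by rewrite subr_eq0 gt_eqF// powR_gt_tangent// divr_ge0.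
Qed.

End young.

(** * Morrey's inequality on cubes *)

Section real_integrable.
Context d {T : measurableType d} {R : realType} (mu : {measure set T -> \bar R}).
Variables (D : set T) (mD : measurable D).
Implicit Types (f g : T -> R).

Lemma integrable_measurable f : mu.-integrable D (EFin \o f) -> measurable_fun D f.
Proof. by move=> /integrableP[/measurable_EFinP]. Qed.

Lemma integrableRD f g : mu.-integrable D (EFin \o f) -> mu.-integrable D (EFin \o g) ->
  mu.-integrable D (EFin \o (fun x => f x + g x)).
Proof.
move=> fi gi; rewrite (_ : _ \o _ = (EFin \o f) \+ (EFin \o g))%E//.
exact: integrableD.
Qed.

Lemma integrableRB f g : mu.-integrable D (EFin \o f) -> mu.-integrable D (EFin \o g) ->
  mu.-integrable D (EFin \o (fun x => f x - g x)).
Proof.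
move=> fi gi; rewrite (_ : _ \o _ = (EFin \o f) \- (EFin \o g))%E//.
exact: integrableB.
Qed.

Lemma integrableRZ (k : R) f : mu.-integrable D (EFin \o f) ->
  mu.-integrable D (EFin \o (fun x => k * f x)).
Proof.
move=> fi; rewrite (_ : _ \o _ = (fun x => k%:E * (EFin \o f) x)%E)//.
exact: integrableZl.
Qed.

Lemma le_integrableR f g : measurable_fun D f -> (forall x, D x -> `|f x| <= g x) ->
  mu.-integrable D (EFin \o g) -> mu.-integrable D (EFin \o f).
Proof.
move=> mf fg; apply: le_integrable => //; first exact/measurable_EFinP.
by move=> x Dx; rewrite /= lee_fin (le_trans (fg _ Dx))// ler_norm.
Qed.

End real_integrable.

Section continuity.
Context {R : realType} {n : nat}.

Lemma continuous_affine (w : 'rV[R]_n) (t : R) :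
  continuous (fun y : 'rV[R]_n => w + t *: y).
Proof.
move=> y; apply: (@continuousD _ _ _ (cst w) (fun y : 'rV[R]_n => t *: y)).
  exact: cst_continuous.
exact: scaler_continuous.
Qed.

Lemma continuous_mulf (f g : 'rV[R]_n -> R) : continuous f -> continuous g ->
  continuous (fun y => f y * g y).
Proof. by move=> cf cg y; exact: (continuousM (cf y) (cg y)). Qed.

Lemma continuous_addf (f g : 'rV[R]_n -> R) : continuous f -> continuous g ->
  continuous (fun y => f y + g y).
Proof. by move=> cf cg y; exact: (continuousD (cf y) (cg y)). Qed.

Lemma continuous_sumf (F : 'I_n -> 'rV[R]_n -> R) : (forall i, continuous (F i)) ->
  continuous (fun y => \sum_(i < n) F i y).
Proof.
move=> cF; apply: (@continuous_big _ _ +%R) => [y|i _]; first exact: add_continuous.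
exact: cF.
Qed.

Lemma continuous_coordB (z : 'rV[R]_n) i : continuous (fun y : 'rV[R]_n => (y - z) 0 i).
Proof.
have -> : (fun y : 'rV[R]_n => (y - z) 0 i) = (fun y => y 0 i + (cst (- z 0 i)) y).
  by apply/funext => y; rewrite /= !mxE.
by apply: continuous_addf; [exact: coord_continuous|exact: cst_continuous].
Qed.

End continuity.

Section box_integrals.
Context {R : realType} {n : nat}.
Implicit Types (f g : 'rV[R]_n -> R) (a b c y z : 'rV[R]_n).

Local Notation mu := (@lebesgue_rV R n).

Lemma box_compact a b : compact (box a b).
Proof.
apply: (@rV_compact _ n (fun i => `[a 0 i, b 0 i]%classic)) => i.
exact: segment_compact.
Qed.

Lemma continuous_compact_bounded f (K : set 'rV[R]_n) : continuous f -> compact K ->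
  exists2 M, 0 < M & forall y, K y -> `|f y| <= M.
Proof.
move=> cf cK; have [M [Mr HM]] := compact_bounded
  (continuous_compact (continuous_subspaceT cf) cK).
exists (`|M| + 1) => [|y Ky]; first by rewrite ltr_wpDl.
by apply: HM; [rewrite (le_lt_trans (ler_norm _))// ltrDl|exists y].
Qed.

Lemma bounded_integrable (A : set 'rV[R]_n) f M : measurable A -> (mu A < +oo)%E ->
  measurable_fun A f -> (forall y, A y -> `|f y| <= M) -> mu.-integrable A (EFin \o f).
Proof.
move=> mA A8 mf fM; apply: measurable_bounded_integrable => //.
exists M; split; first exact: num_real.
by move=> x Mx y Ay /=; apply: (le_trans (fM _ Ay)); exact: ltW.
Qed.

Lemma continuous_box_integrable f a b : continuous f ->
  mu.-integrable (box a b) (EFin \o f).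
Proof.
move=> cf; have [M _ HM] := continuous_compact_bounded cf (@box_compact a b).
apply: (@bounded_integrable _ _ M) => //.
- exact: measurable_box.
- exact: box_lty.
- by apply: measurable_funTS; exact: continuous_rV_measurable.
Qed.

Lemma continuous_powR_measurable g (p : R) : continuous g ->
  measurable_fun setT (fun y => g y `^ p).
Proof.
move=> cg; apply: (measurableT_comp (measurable_powR p)).
exact: continuous_rV_measurable.
Qed.

Lemma continuous_powR_box_integrable g a b (p : R) : continuous g -> 0 <= p ->
  (forall y, 0 <= g y) -> mu.-integrable (box a b) (EFin \o (fun y => g y `^ p)).
Proof.
move=> cg p0 g0; have [B B0 HB] := continuous_compact_bounded cg (@box_compact a b).
apply: (@bounded_integrable _ _ (B `^ p)).
- exact: measurable_box.
- exact: box_lty.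
- by apply: measurable_funTS; exact: continuous_powR_measurable.
- move=> y Qy; rewrite ger0_norm ?powR_ge0//.
  apply: ge0_ler_powR; rewrite ?nnegrE ?(ltW B0)//.
  by rewrite (le_trans (ler_norm _))//; exact: HB.
Qed.

Lemma Rintegral_EFin (A : set 'rV[R]_n) f : measurable A -> mu.-integrable A (EFin \o f) ->
  (\int[mu]_(y in A) f y)%:E = (\int[mu]_(y in A) (f y)%:E)%E.
Proof. by move=> mA fi; rewrite /Rintegral fineK//; exact: integrable_fin_num. Qed.

(** Jensen's inequality, obtained by integrating the tangent inequality at f / M. [M] is any number
    whose p-th power bounds the mean of f^p. *)
Lemma jensen_box (A : set 'rV[R]_n) f (p M : R) : 1 < p -> 0 < M -> measurable A ->
  (mu A < +oo)%E -> mu.-integrable A (EFin \o f) ->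
  mu.-integrable A (EFin \o (fun y => f y `^ p)) ->
  (forall y, A y -> 0 <= f y) ->
  \int[mu]_(y in A) (f y `^ p) <= M `^ p * fine (mu A) ->
  \int[mu]_(y in A) f y <= M * fine (mu A).
Proof.
move=> p1 M0 mA A8 fi fpi f0 H; have p0 : 0 < p by lra.
have ip0 : 0 < p^-1 by rewrite invr_gt0.
have i1 : mu.-integrable A (EFin \o (fun=> 1 - p^-1 : R)).
  by apply: (@bounded_integrable _ _ `|1 - p^-1|).
have i2 : mu.-integrable A (EFin \o (fun y => (p * M `^ p)^-1 * f y `^ p)).
  rewrite (_ : _ \o _ = (fun y => (p * M `^ p)^-1%:E * (f y `^ p)%:E)%E)//.
  exact: integrableZl.
apply: (@le_trans _ _ (\int[mu]_(y in A) (M * (1 - p^-1 + (p * M `^ p)^-1 * f y `^ p)))).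
  apply: le_Rintegral => //.
    rewrite (_ : _ \o _ = (fun y => M%:E * ((1 - p^-1)%:E + ((p * M `^ p)^-1 * f y `^ p)%:E))%E)//.
    by apply: integrableZl => //; exact: integrableD.
  move=> y Ay; have := powR_ge_tangent p1 (divr_ge0 (f0 _ Ay) (ltW M0)).
  rewrite powRM ?f0// ?invr_ge0 ?(ltW M0)// powR_inv ?(ltW M0)// => h.
  rewrite -ler_pdivrMl// mulrC (le_trans h)// lerD2l invfM.
  by rewrite [leRHS]mulrC [p^-1 / _]mulrC mulrA.
rewrite RintegralZl//; last exact: integrableRD.
rewrite ler_pM2l// RintegralD//= Rintegral_cst// RintegralZl//.
have Mp : 0 < M `^ p by exact: powR_gt0.
have : (p * M `^ p)^-1 * \int[mu]_(y in A) (f y `^ p) <= (p * M `^ p)^-1 * (M `^ p * fine (mu A)).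
  by rewrite ler_pM2l// invr_gt0 mulr_gt0.
have -> : (p * M `^ p)^-1 * (M `^ p * fine (mu A)) = p^-1 * fine (mu A).
  by field; rewrite !gt_eqF.
lra.
Qed.

End box_integrals.

Section one_sided.
Context {R : realType}.

(** The bound on the derivative may blow up at 0, so the mean value theorem is applied to A(t) - (B
    / al) t^al on [s, 1] only, where the derivative of this function is nonpositive; continuity of
    [A] at 0 pays for the gap between 0 and s. *)
Lemma increment_le_powR (A dA : R -> R) (B al : R) : 0 < al -> 0 <= B ->
  {for 0, continuous A} ->
  (forall t : R, 0 < t <= 1 -> is_derive t 1 A (dA t)) ->
  (forall t : R, 0 < t < 1 -> dA t <= B * t `^ (al - 1)) ->
  A 1 - A 0 <= B / al.
Proof.
move=> al0 B0 cA hd hb; apply/ler_addgt0Pr => e e0.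
have /cvgrPdist_le/(_ _ e0) : A t @[t --> (0:R)] --> A 0 by exact: cA.
move=> /nbhs_ballP[d /= d0 hA].
pose s := Num.min (d / 2) (1 / 2).
have s0 : 0 < s by rewrite lt_min; apply/andP; split; lra.
have s1 : s < 1 by rewrite gt_min; apply/orP; right; lra.
have : `|A 0 - A s| <= e.
  by apply: hA; rewrite -ball_normE/= sub0r normrN gtr0_norm// gt_min; apply/orP; left; lra.
rewrite ler_norml => /andP[As _].
suff : A 1 - A s <= B / al by lra.
pose phi t := A t - (B / al) * t `^ al.
have dphi (t : R) : 0 < t <= 1 -> is_derive t 1 phi (dA t - (B / al) * (al * t `^ (al - 1))).
  move=> /andP[t0 t1].
  have h1 : is_derive t 1 A (dA t) by apply: hd; rewrite t0.
  have h2 := is_derive1_powR al t0.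
  have h3 := is_deriveZ (B / al) h2.
  exact: is_deriveB.
have cphi : {within `[s, 1], continuous phi}.
  apply: continuous_in_subspaceT => t; rewrite inE/= in_itv/= => /andP[st t1].
  apply/differentiable_continuous/derivable1_diffP.
  by case: (dphi t _) => //; rewrite t1 (lt_le_trans s0).
have hphi (t : R) : t \in `]s, 1[ ->
    is_derive t 1 phi (dA t - (B / al) * (al * t `^ (al - 1))).
  by rewrite in_itv/= => /andP[st t1]; apply: dphi; rewrite (ltW t1) (lt_trans s0).
have [t] := MVT s1 hphi cphi.
rewrite in_itv/= => /andP[st t1] E.
have t0 := lt_trans s0 st.
have : phi 1 - phi s <= 0.
  rewrite E mulr_le0_ge0// ?subr_ge0 ?(ltW s1)// mulrA divfK ?gt_eqF// subr_le0.
  by apply: hb; rewrite t0.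
rewrite /phi powR1 mulr1.
have : 0 <= B / al * s `^ al by rewrite mulr_ge0 ?divr_ge0 ?powR_ge0// ltW.
lra.
Qed.

End one_sided.

(** * The Euclidean norm *)

Section enorm.
Context {R : realType} {n : nat}.
Implicit Types (x y : 'rV[R]_n).

Lemma dotrVC x y : dotrV x y = dotrV y x.
Proof. by apply: eq_bigr => i _; rewrite mulrC. Qed.

Lemma dotrVDl x y z : dotrV (x + y) z = dotrV x z + dotrV y z.
Proof. by rewrite /dotrV -big_split/=; apply: eq_bigr => i _; rewrite mxE mulrDl. Qed.

Lemma dotrVZl (a : R) x y : dotrV (a *: x) y = a * dotrV x y.
Proof. by rewrite /dotrV mulr_sumr; apply: eq_bigr => i _; rewrite mxE mulrA. Qed.

Lemma dotrVDr x y z : dotrV z (x + y) = dotrV z x + dotrV z y.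
Proof. by rewrite dotrVC dotrVDl !(dotrVC z). Qed.

Lemma dotrVZr (a : R) x y : dotrV x (a *: y) = a * dotrV x y.
Proof. by rewrite dotrVC dotrVZl dotrVC. Qed.

Lemma dotrV_ge0 x : 0 <= dotrV x x.
Proof. by apply: sumr_ge0 => i _; rewrite -expr2 sqr_ge0. Qed.

Lemma enorm_ge0 x : 0 <= enorm x.
Proof. exact: sqrtr_ge0. Qed.

Lemma enorm_sqr x : enorm x ^+ 2 = dotrV x x.
Proof. by rewrite sqr_sqrtr// dotrV_ge0. Qed.

Lemma enormZ (a : R) x : enorm (a *: x) = `|a| * enorm x.
Proof.
by rewrite /enorm dotrVZl dotrVZr mulrA -expr2 sqrtrM ?sqr_ge0// sqrtr_sqr.
Qed.

Lemma enormN x : enorm (- x) = enorm x.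
Proof. by rewrite -scaleN1r enormZ normrN1 mul1r. Qed.

Lemma enorm0 : enorm (0 : 'rV[R]_n) = 0.
Proof. by rewrite -(scale0r 0) enormZ normr0 mul0r. Qed.

Lemma coord_le_enorm x i : `|x 0 i| <= enorm x.
Proof.
rewrite -(ler_pXn2r (ltn0Sn 1)) ?nnegrE ?enorm_ge0// enorm_sqr real_normK ?num_real//.
rewrite /dotrV (bigD1 i)//= expr2 lerDl.
by apply: sumr_ge0 => j _; rewrite -expr2 sqr_ge0.
Qed.

Lemma enorm_eq0 x : enorm x = 0 -> x = 0.
Proof.
move=> x0; apply/rowP => i; rewrite mxE; apply/eqP.
by rewrite -normr_le0 -x0 coord_le_enorm.
Qed.

(** Cauchy-Schwarz, from the nonnegative square of |y| x - |x| y. *)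
Lemma dotrV_le_enorm x y : dotrV x y <= enorm x * enorm y.
Proof.
have [x0|x0] := eqVneq (enorm x) 0.
  by rewrite x0 mul0r (enorm_eq0 x0) /dotrV big1// => i _; rewrite mxE mul0r.
have [y0|y0] := eqVneq (enorm y) 0.
  by rewrite y0 mulr0 (enorm_eq0 y0) /dotrV big1// => i _; rewrite mxE mulr0.
have := dotrV_ge0 (enorm y *: x + (- enorm x) *: y).
rewrite !(dotrVDl, dotrVDr, dotrVZl, dotrVZr) -!enorm_sqr (dotrVC y x) => H.
have xy : 0 < enorm x * enorm y by rewrite mulr_gt0// lt_neqAle eq_sym ?x0 ?y0 enorm_ge0.
rewrite -(ler_pM2l xy).
move: H; set a := enorm x; set b := enorm y; nra.
Qed.

Lemma enorm_triangle x y : enorm (x + y) <= enorm x + enorm y.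
Proof.
rewrite -(ler_pXn2r (ltn0Sn 1)) ?nnegrE ?addr_ge0 ?enorm_ge0//.
rewrite enorm_sqr !(dotrVDl, dotrVDr) -!enorm_sqr (dotrVC y x).
by have := dotrV_le_enorm x y; rewrite sqrrD mulr2n; lra.
Qed.

Lemma enorm_le_sum x : enorm x <= \sum_(i < n) `|x 0 i|.
Proof.
have s0 : 0 <= \sum_(i < n) `|x 0 i| by exact: sumr_ge0.
rewrite -(ler_pXn2r (ltn0Sn 1)) ?nnegrE ?enorm_ge0// enorm_sqr expr2 mulr_suml.
apply: ler_sum => i _; rewrite -expr2 -real_normK ?num_real// expr2 ler_wpM2l//.
by rewrite (bigD1 i)//= lerDl sumr_ge0.
Qed.

Lemma measurable_enorm d (T : measurableType d) (D : set T) (F : T -> 'rV[R]_n) :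
  (forall i, measurable_fun D (fun t => F t 0 i)) ->
  measurable_fun D (fun t => enorm (F t)).
Proof.
move=> mF; rewrite (_ : (fun t => _) = Num.sqrt \o (fun t => dotrV (F t) (F t)))//.
apply: measurableT_comp; first exact: continuous_measurable_fun (@sqrt_continuous R).
apply: measurable_sum => i; exact: measurable_funM.
Qed.

Lemma enorm_powR_le (r : R) x y : 0 <= r ->
  enorm (x + y) `^ r <= 2 `^ r * (enorm x `^ r + enorm y `^ r).
Proof.
move=> r0.
wlog xy : x y / enorm x <= enorm y.
  move=> H; have [/H//|/ltW/H] := leP (enorm x) (enorm y).
  by rewrite addrC (addrC (_ `^ _)).
apply: (@le_trans _ _ ((2 * enorm y) `^ r)).
  apply: ge0_ler_powR; rewrite ?nnegrE ?mulr_ge0 ?enorm_ge0//.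
  by have := enorm_triangle x y; lra.
by rewrite powRM ?enorm_ge0// ler_wpM2l ?powR_ge0// lerDr powR_ge0.
Qed.

End enorm.

(** The contraction of ratio [t] centred at [z] maps [Q] onto a smaller cube [A0], which lies in [Q]
    by convexity; the change of variables costs t^(-n). *)
Lemma integral_cube_contract {R : realType} {n : nat} (c z : 'rV[R]_n) (r t : R)
    (F : 'rV[R]_n -> \bar R) (Q := box c (c + const_mx r)) :
  Q z -> 0 < t <= 1 -> 0 <= r -> measurable_fun setT F -> (forall y, 0 <= F y)%E ->
  (\int[@lebesgue_rV R n]_(y in Q) F (z + t *: (y - z))%R <=
   (t ^- n)%R%:E * \int[@lebesgue_rV R n]_(y in Q) F y)%E.
Proof.
move=> Qz /andP[t0 t1] r0 mF F0.
pose w := z - t *: z.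
have PE (y : 'rV[R]_n) : z + t *: (y - z) = w + t *: y.
  by rewrite /w scalerBr addrA addrAC.
pose A0 := box (w + t *: c) (w + t *: (c + const_mx r)).
have QE : Q = (fun y => w + t *: y) @^-1` A0.
  apply/seteqP; split => y /boxP h; apply/boxP => i; move: (h i); rewrite !mxE.
    by rewrite !lerD2l !ler_pM2l.
  by rewrite !lerD2l !ler_pM2l.
have A0Q : A0 `<=` Q.
  move=> y /boxP h; apply/boxP => i; move: (h i).
  move/boxP/(_ i)/andP: Qz => [h3 h4]; move: h3 h4.
  rewrite !mxE => h3 h4 /andP[h5 h6]; apply/andP; split; nra.
under eq_integral do rewrite PE.
have mA0 : measurable A0 by exact: measurable_box.
have mFA : measurable_fun A0 F by exact: measurable_funTS.
rewrite {1}QE (integral_rV_affine _ t0 mA0 mFA (fun y _ => F0 y)).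
apply: lee_wpmul2l; first by rewrite lee_fin invr_ge0 exprn_ge0// ltW.
apply: ge0_subset_integral => //; first exact: measurable_box.
exact: measurable_funTS.
Qed.

Section morrey.
Context {R : realType} {n : nat}.
Local Notation mu := (@lebesgue_rV R n).
Variables (f : 'rV[R]_n -> R) (c : 'rV[R]_n) (r p e : R).
Hypotheses (n0 : (0 < n)%N) (np : n%:R < p) (r0 : 0 < r) (e0 : 0 < e).
Hypothesis C1f : C1fun f.
Let Q := box c (c + const_mx r).
Hypothesis He : (\int[mu]_(y in Q) (enorm (grad f y) `^ p)%:E <= e%:E)%E.

Let p1 : 1 < p.
Proof. by rewrite (le_lt_trans _ np)// ler1n. Qed.

Let mQ : measurable Q. Proof. exact: measurable_box. Qed.

Let muQ : mu Q = (r ^+ n)%:E.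
Proof.
rewrite lebesgue_rV_box => [|i]; last by rewrite !mxE lerDl ltW.
by under eq_bigr do rewrite !mxE addrAC subrr add0r; rewrite prodr_const card_ord.
Qed.

Let muQ_lty : (mu Q < +oo)%E. Proof. by rewrite muQ ltry. Qed.

Let H (y : 'rV[R]_n) : R := enorm (grad f y).

Let cH : continuous H.
Proof.
have -> : H = Num.sqrt \o (fun y => \sum_(i < n) pderiv i f y * pderiv i f y).
  by apply/funext => y; congr Num.sqrt; apply: eq_bigr => i _; rewrite !mxE.
have c2 : continuous (fun y => \sum_(i < n) pderiv i f y * pderiv i f y).
  by apply: continuous_sumf => i; apply: continuous_mulf; exact: (C1f.2 i).2.
by move=> y; apply: (continuous_comp (c2 y)); exact: sqrt_continuous.
Qed.

Section at_point.
Variable z : 'rV[R]_n.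
Hypothesis Qz : Q z.

Let P (t : R) (y : 'rV[R]_n) : 'rV[R]_n := z + t *: (y - z).

Let cP t : continuous (P t).
Proof.
have -> : P t = fun y => (z - t *: z) + t *: y.
  by apply/funext => y; rewrite /P scalerBr addrA addrAC.
exact: continuous_affine.
Qed.

Let coordQ y i : Q y -> `|(y - z) 0 i| <= r.
Proof.
move=> /boxP/(_ i)/andP[h1 h2]; move/boxP/(_ i)/andP: Qz => [h3 h4].
by move: h1 h2 h3 h4; rewrite !mxE ler_norml => *; apply/andP; split; lra.
Qed.

Let A (t : R) : R := \int[mu]_(y in Q) f (P t y).

Let dP (t : R) (y : 'rV[R]_n) : R := \sum_(i < n) (y - z) 0 i * pderiv i f (P t y).

Let dPE (t : R) (y : 'rV[R]_n) : is_derive t 1 (fun s => f (P s y)) (dP t y).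
Proof.
have h := C1fun_is_derive (P t y) (y - z) C1f.
have := @is_derive_line _ _ f z (y - z) t (@ex_derive _ _ _ _ _ _ _ h).
by rewrite derive_val.
Qed.

Let dP_le t y : Q y -> `|dP t y| <= n%:R * r * H (P t y).
Proof.
move=> Qy; apply: (le_trans (ler_norm_sum _ _ _)).
rewrite -mulrA mulr_natl -[X in _ *+ X]card_ord -sumr_const; apply: ler_sum => i _.
rewrite normrM ler_pM//; first exact: coordQ.
by apply: le_trans (coord_le_enorm _ i); rewrite mxE.
Qed.

(** Differentiation under the integral sign. The interval (-1, 2) makes the endpoints 0 and 1 of the
    path interior points. *)
Let A_derive (t : R) : -1 < t < 2 -> is_derive t 1 A (\int[mu]_(y in Q) dP t y).
Proof.
move=> t12.
(* For |t| < 2 the point z + t (y - z) stays within 2r of z in every coordinate, so a bound for the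
   gradient on this compact box dominates the derivative. *)
pose K := box (z - const_mx (2 * r)) (z + const_mx (2 * r)).
have [M M0 HM] := continuous_compact_bounded cH (@box_compact _ _
  (z - const_mx (2 * r)) (z + const_mx (2 * r))).
have KP s y : -1 < s < 2 -> Q y -> K (P s y).
  move=> /andP[s1 s2] Qy; apply/boxP => i; have := coordQ i Qy.
  rewrite !mxE ler_norml => /andP[h1 h2]; apply/andP; split; nra.
have pE s y : partial1of2 (fun s y => f (P s y)) s y = dP s y.
  by rewrite partial1of2E; exact: derive_val.
have h : cvg ((fun h => h^-1 *: (A (h + t) - A t)) @ (0 : R)^') /\
         lim ((fun h => h^-1 *: (A (h + t) - A t)) @ (0 : R)^') = \int[mu]_(y in Q) dP t y.
  have H1 : h^-1 *: (A (h + t) - A t) @[h --> (0 : R)^'] -->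
      \int[mu]_(y in Q) partial1of2 (fun s y => f (P s y)) t y.
    apply: (@cvg_differentiation_under_integral _ _ _ mu (fun s y => f (P s y)) Q mQ t (-1) 2
      _ _ _ (cst (n%:R * r * M))).
    - by rewrite /= in_itv.
    - move=> s _; apply: continuous_box_integrable.
      by move=> y; apply: continuous_comp; [exact: cP|exact: C1f.1].
    - by move=> s y _ _; case: (dPE s y).
    - by move=> y /=; rewrite !mulr_ge0// ltW.
    - by apply: (@bounded_integrable _ _ _ _ `|n%:R * r * M|).
    - move=> s y; rewrite /= in_itv/= => s12 Qy; rewrite pE (le_trans (dP_le _ Qy))//.
      apply: ler_wpM2l; first by rewrite mulr_ge0 ?ler0n ?(ltW r0).
      by apply: le_trans (ler_norm _) _; apply: HM; exact: KP.
  have <- : \int[mu]_(y in Q) partial1of2 (fun s y => f (P s y)) t y =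
            \int[mu]_(y in Q) dP t y by apply: eq_Rintegral => y _; exact: pE.
  by split; [apply/cvg_ex; eexists; exact: H1|exact: cvg_lim H1].
have E : (fun h => h^-1 *: ((A \o shift t) (h *: (1 : R)) - A t)) =
         (fun h => h^-1 *: (A (h + t) - A t)).
  by apply/funext => h0; rewrite /= scaler1.
by apply: DeriveDef; [rewrite /derivable E|rewrite /derive E]; case: h.
Qed.

(** Jensen on [Q], then the contraction estimate: [M] is chosen so that M^p |Q| = t^(-n) e, the
    energy bound after the change of variables. The resulting exponent of t is -n/p, which is above
    -1 because p > n. *)
Let dA_le (t : R) : 0 < t < 1 -> `|\int[mu]_(y in Q) dP t y| <=
  (n%:R * r * (e / r ^+ n) `^ p^-1 * r ^+ n) * t `^ ((1 - n%:R / p) - 1).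
Proof.
move=> /andP[t0 t1]; have p0 : 0 < p by exact: lt_trans p1.
have cHP : continuous (fun y => H (P t y)).
  by move=> y; apply: continuous_comp; [exact: cP|exact: cH].
have cdP : continuous (dP t).
  apply: continuous_sumf => i; apply: continuous_mulf; first exact: continuous_coordB.
  by move=> x; apply: continuous_comp; [exact: cP|exact: (C1f.2 i).2].
pose M := (e / r ^+ n) `^ p^-1 * t `^ (- (n%:R / p)).
have M0 : 0 < M by rewrite mulr_gt0 ?powR_gt0// divr_gt0// exprn_gt0.
have Mp : M `^ p * r ^+ n = t ^- n * e.
  rewrite powRM ?powR_ge0// -!powRrM mulVf ?gt_eqF// powRr1; last first.
    by rewrite divr_ge0 ?exprn_ge0 ?ltW.
  have pn0 : p != 0 by rewrite gt_eqF.
  have rn0 : r ^+ n != 0 by rewrite gt_eqF// exprn_gt0.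
  by rewrite mulNr (divfK pn0) powR_invn ?(ltW t0)// mulrAC (divfK rn0) mulrC.
have iHP : mu.-integrable Q (EFin \o (fun y => H (P t y))) by exact: continuous_box_integrable.
have iHPp : mu.-integrable Q (EFin \o (fun y => H (P t y) `^ p)).
  by apply: continuous_powR_box_integrable => // [|y]; [exact: ltW|exact: enorm_ge0].
have J : \int[mu]_(y in Q) H (P t y) <= M * fine (mu Q).
  apply: jensen_box p1 _ _ _ _ _ _ _ => //; first by move=> y _; exact: enorm_ge0.
  rewrite muQ/= Mp -lee_fin Rintegral_EFin//.
  rewrite EFinM.
  apply: (le_trans (@integral_cube_contract _ n c z r t (fun y => (H y `^ p)%:E) Qz _ _ _ _)) => //.
  - by rewrite t0 ltW.
  - exact: ltW.
  - by apply/measurable_EFinP; exact: continuous_powR_measurable.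
  - by move=> y; rewrite lee_fin powR_ge0.
  - by apply: lee_wpmul2l => //; rewrite lee_fin invr_ge0 exprn_ge0// ltW.
apply: (le_trans (le_normr_Rintegral mQ (continuous_box_integrable _ _ cdP))).
apply: (@le_trans _ _ (\int[mu]_(y in Q) (n%:R * r * H (P t y)))).
  apply: le_Rintegral => //.
  - have cN : continuous (fun y => `|dP t y|).
      by move=> y; apply: (continuous_comp (cdP y)); exact: norm_continuous.
    exact: continuous_box_integrable.
  - exact: integrableRZ.
  - by move=> y Qy; exact: dP_le.
rewrite RintegralZl//.
have -> : 1 - n%:R / p - 1 = - (n%:R / p) by rewrite addrAC subrr add0r.
have nr0 : 0 <= n%:R * r by rewrite mulr_ge0 ?ler0n ?(ltW r0).
apply: (le_trans (ler_wpM2l nr0 J)).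
by rewrite muQ/= /M le_eqVlt; apply/orP; left; apply/eqP; ring.
Qed.

(** [A] runs from |Q| f(z) at t = 0 to the integral of f at t = 1. Its derivative is bounded by a
    multiple of t^(-n/p), whose integral over [0, 1] is 1 / (1 - n/p). Applying [increment_le_powR]
    to [A] and to its opposite gives both signs. *)
Lemma morrey_average : `|\int[mu]_(y in Q) f y - r ^+ n * f z| <=
  (n%:R * r * (e / r ^+ n) `^ p^-1 * r ^+ n) / (1 - n%:R / p).
Proof.
have p0 : 0 < p by exact: lt_trans p1.
set B := n%:R * r * _ * _.
have B0 : 0 <= B by rewrite !mulr_ge0 ?powR_ge0 ?exprn_ge0// ltW.
have al0 : 0 < 1 - n%:R / p by rewrite subr_gt0 ltr_pdivrMr// mul1r.
have A1 : A 1 = \int[mu]_(y in Q) f y.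
  by apply: eq_Rintegral => y _; rewrite /P scale1r addrC subrK.
have A0 : A 0 = r ^+ n * f z.
  have -> : A 0 = \int[mu]_(y in Q) f z.
    by apply: eq_Rintegral => y _; rewrite /P scale0r addr0.
  transitivity (f z * fine (mu Q)); first exact: Rintegral_cst.
  by rewrite muQ mulrC.
rewrite -A1 -A0.
have dA (t : R) : 0 <= t <= 1 -> is_derive t 1 A (\int[mu]_(y in Q) dP t y).
  by move=> /andP[t0 t1]; apply: A_derive; apply/andP; split; lra.
have cA : {for 0, continuous A}.
  by apply/differentiable_continuous/derivable1_diffP; case: (dA 0 _) => //; rewrite lexx ler01.
rewrite ler_norml -lerNl opprB; apply/andP; split; last first.
  apply: (@increment_le_powR _ A (fun t => \int[mu]_(y in Q) dP t y) B) => //.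
    by move=> t /andP[t0 t1]; apply: dA; rewrite ltW.
  by move=> t t01; exact: le_trans (ler_norm _) (dA_le t01).
have := @increment_le_powR _ (fun t => - A t) (fun t => - \int[mu]_(y in Q) dP t y) B
  (1 - n%:R / p) al0 B0.
rewrite opprK (addrC (- A 1)); apply.
- exact: cvgN.
- by move=> t /andP[t0 t1]; apply: is_deriveN; apply: dA; rewrite ltW.
- by move=> t t01; rewrite (le_trans (ler_norm _))// normrN; exact: dA_le.
Qed.

End at_point.

(** Both values are compared with the average over [Q], hence the factor 2. *)
Lemma morrey_cube y z : Q y -> Q z ->
  `|f y - f z| <= 2 * n%:R / (1 - n%:R / p) * r `^ (1 - n%:R / p) * e `^ p^-1.
Proof.
move=> Qy Qz; have p0 : 0 < p by exact: lt_trans p1.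
have := morrey_average Qy; have := morrey_average Qz.
have al0 : 0 < 1 - n%:R / p by rewrite subr_gt0 ltr_pdivrMr// mul1r.
have rn : 0 < r ^+ n by rewrite exprn_gt0.
have -> : n%:R * r * (e / r ^+ n) `^ p^-1 * r ^+ n / (1 - n%:R / p) =
   r ^+ n * (n%:R / (1 - n%:R / p) * r `^ (1 - n%:R / p) * e `^ p^-1).
  rewrite powRM ?invr_ge0 ?(ltW e0) ?(ltW rn)// powR_inv ?(ltW rn)//.
  rewrite powRB ?(gt_eqF r0) ?implybT// powRr1 ?(ltW r0)// powRrM powR_mulrn ?(ltW r0)//.
  by ring.
move=> h1 h2; rewrite -(ler_pM2l rn).
have -> : r ^+ n * `|f y - f z| = `|r ^+ n * f y - r ^+ n * f z|.
  by rewrite -mulrBr normrM (ger0_norm (ltW rn)).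
move: h1 h2; set a := r ^+ n * f y; set b := r ^+ n * f z.
set m := \int[mu]_(_ in Q) _; set k := r ^+ n * (_ * _ * _).
rewrite (_ : r ^+ n * _ = 2 * k); last by rewrite /k; ring.
by rewrite !ler_norml => /andP[? ?] /andP[? ?]; apply/andP; split; lra.
Qed.

End morrey.

(** * Smooth functions and bumps *)

Section smooth_algebra.
Context {R : realType} {n : nat}.
Implicit Types (f g : 'rV[R]_n -> R) (D : set 'rV[R]_n) (y : 'rV[R]_n).

Lemma is_pderivD f g i y : derivable f y (delta_mx 0 i) -> derivable g y (delta_mx 0 i) ->
  is_derive y (delta_mx 0 i) (fun y => f y + g y) (pderiv i f y + pderiv i g y).
Proof. by move=> df dg; apply: is_deriveD; apply: DeriveDef. Qed.

Lemma is_pderivM f g i y : derivable f y (delta_mx 0 i) -> derivable g y (delta_mx 0 i) ->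
  is_derive y (delta_mx 0 i) (fun y => f y * g y) (f y * pderiv i g y + pderiv i f y * g y).
Proof.
move=> df dg; rewrite (mulrC (pderiv i f y)).
have H1 : is_derive y (delta_mx 0 i) f (pderiv i f y) by exact: DeriveDef.
have H2 : is_derive y (delta_mx 0 i) g (pderiv i g y) by exact: DeriveDef.
exact: (is_deriveM H1 H2).
Qed.

(* The algebra generated by B: if the partial derivatives of the elements of B stay in it, its
   elements are smooth. *)
Inductive salg (B : set ('rV[R]_n -> R)) : ('rV[R]_n -> R) -> Prop :=
| salg_base f : B f -> salg B f
| salg_cst (k : R) : salg B (fun=> k)
| salg_add f g : salg B f -> salg B g -> salg B (fun y => f y + g y)
| salg_mul f g : salg B f -> salg B g -> salg B (fun y => f y * g y).

Lemma smooth_on_salg (B : set ('rV[R]_n -> R)) :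
  (forall f, B f -> continuous f /\ forall i,
     (forall y, derivable f y (delta_mx 0 i)) /\ salg B (pderiv i f)) ->
  forall f, salg B f -> smooth_on setT f.
Proof.
move=> HB.
have C1 f : salg B f -> continuous f /\ forall i,
     (forall y, derivable f y (delta_mx 0 i)) /\ salg B (pderiv i f).
  elim=> {f}[f /HB//|k|f g sf [cf df] sg [cg dg]|f g sf [cf df] sg [cg dg]].
  - split=> [|i]; first exact: cst_continuous.
    split=> [y|]; first exact: derivable_cst.
    rewrite (_ : pderiv i _ = fun=> 0); first exact: salg_cst.
    by apply/funext => y; exact: derive_cst.
  - split=> [|i]; first exact: continuous_addf.
    have H y := is_pderivD ((df i).1 y) ((dg i).1 y).
    split=> [y|]; first by case: (H y).
    rewrite (_ : pderiv i _ = fun y => pderiv i f y + pderiv i g y).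
      by apply: salg_add; [exact: (df i).2|exact: (dg i).2].
    by apply/funext => y; rewrite /pderiv (@derive_val _ _ _ _ _ _ _ (H y)).
  - split=> [|i]; first exact: continuous_mulf.
    have H y := is_pderivM ((df i).1 y) ((dg i).1 y).
    split=> [y|]; first by case: (H y).
    rewrite (_ : pderiv i _ = fun y => f y * pderiv i g y + pderiv i f y * g y).
      by apply: salg_add; apply: salg_mul => //; [exact: (dg i).2|exact: (df i).2].
    by apply/funext => y; rewrite /pderiv (@derive_val _ _ _ _ _ _ _ (H y)).
move=> f sf s; suff : salg B (foldr pderiv f s).
  by move=> /C1[cs ds] y _; split; [exact: cs|move=> i; exact: (ds i).1].
by elim: s => //= i s IH; have [_ /(_ i)[]] := C1 _ IH.
Qed.

Lemma smooth_pderiv f i : smooth_on setT f -> smooth_on setT (pderiv i f).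
Proof. by move=> sf s y _; rewrite -[pderiv i f]/(foldr pderiv f [:: i]) -foldr_cat; exact: sf. Qed.

Lemma smooth_continuous f : smooth_on setT f -> continuous f.
Proof. by move=> sf y; exact: (sf [::] y I).1. Qed.

Lemma smooth_derivable f i y : smooth_on setT f -> derivable f y (delta_mx 0 i).
Proof. by move=> sf; exact: (sf [::] y I).2. Qed.

Lemma smooth_C1 f : smooth_on setT f -> C1fun f.
Proof.
move=> sf; split; first exact: smooth_continuous.
by move=> i; split=> [y|]; [exact: smooth_derivable|exact/smooth_continuous/smooth_pderiv].
Qed.

Lemma smooth_salg f : salg (smooth_on setT) f -> smooth_on setT f.
Proof.
apply: smooth_on_salg => g sg; split; first exact: smooth_continuous.
move=> i; split=> [y|]; first exact: smooth_derivable.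
by apply: salg_base; exact: smooth_pderiv.
Qed.

Lemma smooth_add f g : smooth_on setT f -> smooth_on setT g ->
  smooth_on setT (fun y => f y + g y).
Proof. by move=> sf sg; apply/smooth_salg/salg_add; exact: salg_base. Qed.

Lemma smooth_mul f g : smooth_on setT f -> smooth_on setT g ->
  smooth_on setT (fun y => f y * g y).
Proof. by move=> sf sg; apply/smooth_salg/salg_mul; exact: salg_base. Qed.

Lemma smooth_cst (k : R) : smooth_on setT (fun _ : 'rV[R]_n => k).
Proof. exact/smooth_salg/salg_cst. Qed.

Lemma gradD f g y : C1fun f -> C1fun g ->
  grad (fun y => f y + g y) y = grad f y + grad g y.
Proof.
move=> Cf Cg; apply/rowP => i; rewrite !mxE.
by rewrite {1}/pderiv (@derive_val _ _ _ _ _ _ _ (is_pderivD ((Cf.2 i).1 y) ((Cg.2 i).1 y))).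
Qed.

Lemma gradM f g y : C1fun f -> C1fun g ->
  grad (fun y => f y * g y) y = f y *: grad g y + g y *: grad f y.
Proof.
move=> Cf Cg; apply/rowP => i; rewrite !mxE.
rewrite {1}/pderiv (@derive_val _ _ _ _ _ _ _ (is_pderivM ((Cf.2 i).1 y) ((Cg.2 i).1 y))).
by rewrite (mulrC (g y)).
Qed.

Lemma grad_cst (k : R) y : grad (fun=> k) y = 0.
Proof. by apply/rowP => i; rewrite !mxE; exact: derive_cst. Qed.

Lemma gradZ (k : R) f y : C1fun f -> grad (fun y => k * f y) y = k *: grad f y.
Proof.
by move=> Cf; rewrite (gradM _ (smooth_C1 (smooth_cst k)) Cf) grad_cst scaler0 addr0.
Qed.

Lemma test_fun_supp D f g : test_fun D f -> smooth_on setT g ->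
  (forall y, g y != 0 -> f y != 0) -> test_fun D g.
Proof.
move=> [sf cf fD] sg gf.
have sub : closure [set y | g y != 0] `<=` closure [set y | f y != 0] by exact: closureS.
split=> //; last exact: subset_trans fD.
by apply: subclosed_compact cf sub; exact: closed_closure.
Qed.

Lemma test_funD D f g : test_fun D f -> test_fun D g -> test_fun D (fun y => f y + g y).
Proof.
move=> [sf cf fD] [sg cg gD].
have sub : closure [set y | f y + g y != 0] `<=`
    closure [set y | f y != 0] `|` closure [set y | g y != 0].
  rewrite -closureU; apply: closureS => y /=.
  case: (eqVneq (f y) 0) => [->|]; last by left.
  by rewrite add0r; right.
split; first exact: smooth_add.
  apply: subclosed_compact (compactU cf cg) sub; exact: closed_closure.
by move=> y /sub[/fD|/gD].
Qed.

Lemma test_funM D f g : test_fun D f -> smooth_on setT g -> test_fun D (fun y => f y * g y).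
Proof.
move=> tf sg; have [sf _ _] := tf.
apply: (test_fun_supp tf (smooth_mul sf sg)).
by move=> y; rewrite mulf_eq0 negb_or => /andP[].
Qed.

Lemma test_funZ D (k : R) f : test_fun D f -> test_fun D (fun y => k * f y).
Proof.
move=> tf; apply: (test_fun_supp tf).
  by apply: smooth_mul; [exact: smooth_cst|case: tf].
by move=> y; rewrite mulf_eq0 negb_or => /andP[].
Qed.

Lemma test_fun0 D f y : test_fun D f -> ~ D y -> f y = 0.
Proof.
move=> [_ _ fD] Dy; have [//|fy] := eqVneq (f y) 0; case: Dy.
by apply: fD; exact: subset_closure.
Qed.

Lemma test_fun_grad0 D f y : test_fun D f -> ~ D y -> grad f y = 0.
Proof.
move=> [_ _ fD] Dy; apply/rowP => i; rewrite !mxE.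
have H : \forall z \near y, f z = (fun=> 0) z.
  have : nbhs y (~` closure [set y | f y != 0]).
    apply: open_nbhs_nbhs; split; last by move=> /fD.
    by rewrite openC; exact: closed_closure.
  apply: filterS => z /= Hz; have [//|fz] := eqVneq (f z) 0.
  by case: Hz; exact: subset_closure.
by rewrite /pderiv (near_eq_derive _ H) derive_cst.
Qed.

End smooth_algebra.

Section flat_function.
Context {R : realType}.

(** The family t^(-j) exp(-1/t), extended by 0. The index [j] makes it closed under derivation up to
    linear combinations, which is the form that [smooth_on_salg] accepts. *)
Definition flat (j : nat) (t : R) : R := if 0 < t then t^-1 ^+ j * expR (- t^-1) else 0.

Lemma flat_ge0 j t : 0 <= flat j t.
Proof.
rewrite /flat; case: ifP => // t0.
by rewrite mulr_ge0 ?expR_ge0// exprn_ge0// invr_ge0 ltW.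
Qed.

Lemma flat_le0 j t : t <= 0 -> flat j t = 0.
Proof. by move=> t0; rewrite /flat ltNge t0. Qed.

(** Raising exp(z) >= z with z = 1 / ((j+2) t) to the power j+2 gives exp(-1/t) <= ((j+2) t)^(j+2),
    which beats t^(-j) by two orders. The quadratic bound yields a zero derivative at 0. *)
Lemma flat_quadratic j : exists2 C : R, 0 <= C & forall t, `|flat j t| <= C * t ^+ 2.
Proof.
exists (j.+2%:R ^+ j.+2); first by rewrite exprn_ge0// ler0n.
move=> t; rewrite ger0_norm ?flat_ge0// /flat; case: ifP => t0; last first.
  by rewrite mulr_ge0 ?sqr_ge0// exprn_ge0// ler0n.
have jt : 0 < j.+2%:R * t by rewrite mulr_gt0.
have h : expR (- t^-1) <= (j.+2%:R * t) ^+ j.+2.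
  rewrite (_ : - t^-1 = j.+2%:R * - (j.+2%:R * t)^-1); last first.
    by field; rewrite gt_eqF//= pnatr_eq0.
  rewrite expRM_natl; apply: lerXn2r; rewrite ?nnegrE ?expR_ge0 ?(ltW jt)//.
  rewrite expRN -[leRHS]invrK lef_pV2 ?posrE ?expR_gt0 ?invr_gt0//.
  by apply: le_trans (expR_ge1Dx _); rewrite lerDr.
have tj : 0 <= t^-1 ^+ j by rewrite exprn_ge0// invr_ge0 ltW.
apply: (le_trans (ler_wpM2l tj h)).
rewrite exprMn mulrCA -(addn2 j) (exprD t) (mulrA _ (t ^+ j)) -exprMn mulVf ?gt_eqF//.
by rewrite expr1n mul1r.
Qed.

Lemma is_derive_near (f g : R -> R) (t df : R) :
  (\forall s \near t, f s = g s) -> is_derive t 1 f df -> is_derive t 1 g df.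
Proof.
move=> fg [df1 <-]; apply: DeriveDef; first exact: near_eq_derivable fg df1.
exact/esym/near_eq_derive.
Qed.

Lemma is_derive_flat j (t : R) :
  is_derive t 1 (flat j) (- j%:R * flat j.+1 t + flat j.+2 t).
Proof.
have [t0|t0|t0] := ltgtP t 0.
- rewrite !flat_le0 ?(ltW t0)// mulr0 addr0.
  have h0 : is_derive t 1 (cst 0 : R -> R) 0 by exact: is_derive_cst.
  apply: (is_derive_near _ h0).
  near=> s; rewrite flat_le0//= ltW//; near: s; exact: (cvgr_lt t (@cvg_id _ _)).
- have tn0 : t != 0 by rewrite gt_eqF.
  have H1 : is_derive t 1 (fun s : R => s^-1) (- (t ^- 2)).
    apply: DeriveDef; first exact: derivableV.
    by rewrite deriveV// derive_id; exact: mulr1.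
  have H2 : is_derive t^-1 1 (fun s : R => s ^+ j * expR (- s))
      (t^-1 ^+ j * - expR (- t^-1) + expR (- t^-1) * (j%:R * t^-1 ^+ j.-1)).
    have h1 : is_derive t^-1 1 (fun s : R => s ^+ j) (j%:R * t^-1 ^+ j.-1).
      have := @is_deriveX _ _ id j t^-1 1 1 (is_derive_id _ _).
      congr (is_derive _ _ _ _); last exact: mulr1.
      by apply/funext => s; rewrite exprfctE.
    have h2 : is_derive t^-1 1 (fun s : R => expR (- s)) (- expR (- t^-1)).
      have := @is_derive1_comp _ expR (fun s : R => - s) t^-1 (expR (- t^-1)) (-1)
        (is_derive_expR _) (is_deriveNid _ _).
      by rewrite mulrN1.
    exact: (is_deriveM h1 h2).
  apply: (@is_derive_near ((fun s : R => s ^+ j * expR (- s)) \o (fun s : R => s^-1))).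
    near=> s; rewrite /= /flat ifT//; near: s; exact: (cvgr_gt t (@cvg_id _ _)).
  have := @is_derive1_comp _ _ (fun s : R => s^-1) t _ _ H2 H1.
  rewrite /flat t0; congr (is_derive _ _ _ _).
  rewrite -(exprVn t 2); set E := expR _; set s := t^-1; rewrite -/s.
  by clear H2; case: j => [|j]; rewrite /= !exprS ?expr0; ring.
- rewrite t0 !flat_le0// mulr0 addr0.
  have [C C0 HC] := flat_quadratic j.
  have H : h^-1 *: (flat j (h *: (1 : R) + 0) - flat j 0) @[h --> (0:R)^'] --> 0.
    apply/cvgrPdist_le => e e0; near=> h.
    rewrite (flat_le0 _ (lexx 0)) subr0 addr0 scaler1 sub0r normrN normrM normfV.
    have h0 : h != 0 by near: h; exact: nbhs_dnbhs_neq.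
    rewrite ler_pdivrMl ?normr_gt0// (le_trans (HC h))// -real_normK ?num_real//.
    rewrite expr2 mulrA mulrC ler_wpM2l//.
    have : `|h| <= e / (C + 1).
      by near: h; apply: dnbhs0_le; rewrite divr_gt0// ltr_wpDl.
    rewrite ler_pdivlMr ?ltr_wpDl// mulrDr mulr1 mulrC => hh.
    by apply: le_trans hh; rewrite lerDl.
  by apply: DeriveDef; [apply/cvg_ex; exists 0|exact: cvg_lim H].
Unshelve. all: by end_near.
Qed.

Lemma continuous_flat j : continuous (flat j).
Proof.
move=> t; apply/differentiable_continuous/derivable1_diffP.
by case: (is_derive_flat j t).
Qed.

End flat_function.

Section bumps.
Context {R : realType} {n : nat}.

Lemma is_derive_coord (k : R -> R) (dk : R) (y : 'rV[R]_n) i j :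
  is_derive (y 0 i) 1 k dk ->
  is_derive y (delta_mx 0 j) (fun y => k (y 0 i)) ((i == j)%:R * dk).
Proof.
move=> [dk1 dkE]; have [ij|ij] := eqVneq i j.
  have E : (fun h : R => h^-1 *: (((fun y : 'rV[R]_n => k (y 0 i)) \o shift y)
      (h *: delta_mx 0 j) - k (y 0 i))) =
      (fun h : R => h^-1 *: ((k \o shift (y 0 i)) (h *: (1 : R)) - k (y 0 i))).
    by apply/funext => h /=; rewrite !mxE ij !eqxx.
  by apply: DeriveDef; [rewrite /derivable E|rewrite /derive E mul1r].
have E : (fun h : R => h^-1 *: (((fun y : 'rV[R]_n => k (y 0 i)) \o shift y)
      (h *: delta_mx 0 j) - k (y 0 i))) = (fun=> 0).
  apply/funext => h /=.
  by rewrite !mxE (negbTE ij) andbF mulr0 add0r subrr scaler0.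
rewrite mul0r; apply: DeriveDef; first by rewrite /derivable E; exact: is_cvg_cst.
by rewrite /derive E; exact: lim_cst.
Qed.

Lemma smooth_flat_affine j (i : 'I_n) (s c : R) :
  smooth_on setT (fun y : 'rV[R]_n => flat j (s * y 0 i + c)).
Proof.
pose B : set ('rV[R]_n -> R) := [set f | exists j, f = fun y : 'rV[R]_n => flat j (s * y 0 i + c)].
apply: (@smooth_on_salg _ _ B); last by apply: salg_base; exists j.
move=> _ [m ->]; split.
  move=> y; apply: (@continuous_comp _ _ _ (fun y : 'rV[R]_n => s * y 0 i + c) (flat m)).
    apply: continuous_addf; last exact: cst_continuous.
    by apply: continuous_mulf; [exact: cst_continuous|exact: coord_continuous].
  exact: continuous_flat.
have H k (y : 'rV[R]_n) : is_derive y (delta_mx 0 k) (fun y : 'rV[R]_n => flat m (s * y 0 i + c))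
    ((i == k)%:R * ((- m%:R * flat m.+1 (s * y 0 i + c) + flat m.+2 (s * y 0 i + c)) * s)).
  apply: (@is_derive_coord (fun t => flat m (s * t + c))).
  have h1 : is_derive (y 0 i) 1 (fun t : R => s * t + c) s.
    have h := @is_deriveD _ _ _ _ _ _ _ _ _
       (@is_deriveZ _ _ _ id s (y 0 i) 1 1 (is_derive_id _ _)) (is_derive_cst c (y 0 i) (1:R)).
    by rewrite addr0 -[s *: 1]/(s * 1) mulr1 in h.
  exact: (@is_derive1_comp _ (flat m) (fun t => s * t + c) _ _ _ (is_derive_flat m _) h1).
move=> k; split=> [y|]; first by case: (H k y).
rewrite (_ : pderiv k _ = fun y : 'rV[R]_n => ((i == k)%:R * s) *
   ((- m%:R) * flat m.+1 (s * y 0 i + c) + flat m.+2 (s * y 0 i + c))).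
  apply: salg_mul; first exact: salg_cst.
  apply: salg_add; last by apply: salg_base; exists m.+2.
  by apply: salg_mul; [exact: salg_cst|apply: salg_base; exists m.+1].
apply/funext => y; rewrite /pderiv (@derive_val _ _ _ _ _ _ _ (H k y)).
by rewrite (mulrC _ s) mulrA.
Qed.

Definition box_bump (a b y : 'rV[R]_n) : R :=
  \prod_(i < n) (flat 0 (y 0 i - a 0 i) * flat 0 (b 0 i - y 0 i)).

Lemma flat0_gt0 (t : R) : (0 < flat 0 t) = (0 < t).
Proof.
by rewrite /flat; case: ifP => // t0; rewrite ?ltxx// expr0 mul1r expR_gt0.
Qed.

Lemma flat0_lt1 (t : R) : flat 0 t < 1.
Proof.
by rewrite /flat; case: ifP => // t0; rewrite expr0 mul1r expR_lt1 oppr_lt0 invr_gt0.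
Qed.

Lemma box_bump_ge0 a b y : 0 <= box_bump a b y.
Proof. by apply: prodr_ge0 => i _; rewrite mulr_ge0// flat_ge0. Qed.

Lemma box_bump_le1 a b y : box_bump a b y <= 1.
Proof.
apply: prodr_ile1 => i _.
rewrite mulr_ge0 ?flat_ge0//= -[leRHS]mulr1.
by rewrite ler_pM ?flat_ge0// ltW// flat0_lt1.
Qed.

Lemma box_bump_gt0P (a b y : 'rV[R]_n) : reflect (forall i, a 0 i < y 0 i < b 0 i) (0 < box_bump a b y).
Proof.
apply: (iffP idP) => [h i|h].
  move: h; rewrite /box_bump (bigD1 i)//=.
  by move=> h; apply/andP; split; rewrite -subr_gt0 -flat0_gt0 lt_neqAle flat_ge0 andbT eq_sym;
    apply: contraTneq h => ->; rewrite ?mulr0 !mul0r ltxx.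
by apply: prodr_gt0 => i _; have /andP[? ?] := h i; rewrite mulr_gt0 ?flat0_gt0 ?subr_gt0.
Qed.

Lemma smooth_box_bump a b : smooth_on setT (box_bump a b).
Proof.
apply: smooth_salg; rewrite /box_bump.
have : forall r : seq 'I_n, salg (smooth_on setT) (fun y : 'rV[R]_n =>
    \prod_(i <- r) (flat 0 (y 0 i - a 0 i) * flat 0 (b 0 i - y 0 i))).
  elim=> [|i r IH].
    rewrite (_ : (fun y => _) = fun=> 1); first exact: salg_cst.
    by apply/funext => y; rewrite big_nil.
  rewrite (_ : (fun y => _) = fun y : 'rV[R]_n => (flat 0 (y 0 i - a 0 i) * flat 0 (b 0 i - y 0 i)) *
    \prod_(i <- r) (flat 0 (y 0 i - a 0 i) * flat 0 (b 0 i - y 0 i))); last first.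
    by apply/funext => y; rewrite big_cons.
  apply: salg_mul IH; apply: salg_mul; apply: salg_base.
    have := @smooth_flat_affine 0 i 1 (- a 0 i).
    by under eq_fun do rewrite mul1r.
  have := @smooth_flat_affine 0 i (-1) (b 0 i).
  by under eq_fun do rewrite mulN1r addrC.
exact.
Qed.

Lemma box_bump_test_fun D a b : box a b `<=` D -> test_fun D (box_bump a b).
Proof.
move=> abD; have sub : closure [set y | box_bump a b y != 0] `<=` box a b.
  rewrite [X in _ `<=` X](closure_id _).1; last first.
    by apply: compact_closed; [exact: norm_hausdorff|exact: box_compact].
  apply: closureS => y /= h; apply/boxP => i.
  have /box_bump_gt0P/(_ i)/andP[/ltW-> /ltW->] // : 0 < box_bump a b y.
  by rewrite lt_neqAle eq_sym h box_bump_ge0.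
split; first exact: smooth_box_bump.
  apply: subclosed_compact (@box_compact _ _ a b) sub; exact: closed_closure.
exact: subset_trans abD.
Qed.

End bumps.

(** * The fundamental lemma of the calculus of variations *)

Section integral_tools.
Context d {T : measurableType d} {R : realType} (mu : {measure set T -> \bar R}).

Lemma integral_subset0 (A B : set T) (f : T -> \bar R) : A `<=` B ->
  (forall x, B x -> ~ A x -> f x = 0%E) ->
  (\int[mu]_(x in B) f x = \int[mu]_(x in A) f x)%E.
Proof.
move=> AB f0; rewrite integral_mkcond [RHS]integral_mkcond; apply: eq_integral => x _.
rewrite /patch; case: ifPn => xB; case: ifPn => xA //.
  by apply: f0; [exact: set_mem|move=> /mem_set; exact/negP].
by move: xB; rewrite (mem_set (AB _ (set_mem xA))).
Qed.

Lemma Rintegral_subset0 (A B : set T) (f : T -> R) : A `<=` B ->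
  (forall x, B x -> ~ A x -> f x = 0) ->
  \int[mu]_(x in B) f x = \int[mu]_(x in A) f x.
Proof.
by move=> AB f0; rewrite /Rintegral (integral_subset0 AB)// => x Bx Ax; rewrite f0.
Qed.

End integral_tools.

Section open_boxes.
Context {R : realType} {n : nat}.
Local Notation mu := (@lebesgue_rV R n).
Implicit Types (a b c d x y : 'rV[R]_n).

Lemma oboxI a b c d : obox a b `&` obox c d =
  obox (\row_i Num.max (a 0 i) (c 0 i)) (\row_i Num.min (b 0 i) (d 0 i)).
Proof.
apply/seteqP; split=> x.
  move=> [h1 h2] i; rewrite !mxE.
  by rewrite gt_max lt_min; move/andP: (h1 i) => [-> ->]; move/andP: (h2 i) => [-> ->].
by move=> h; split=> i; move: (h i); rewrite !mxE gt_max lt_min => /andP[/andP[? ?] /andP[? ?]];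
  apply/andP.
Qed.

Lemma box_sub_max_min a b c d :
  box (\row_i Num.max (a 0 i) (c 0 i)) (\row_i Num.min (b 0 i) (d 0 i)) `<=` box a b.
Proof.
move=> x /boxP h; apply/boxP => i; move: (h i); rewrite !mxE ge_max le_min.
by move=> /andP[/andP[-> _] /andP[-> _]].
Qed.

Definition oboxes : set (set 'rV[R]_n) := [set A | exists a b, A = obox a b].

(** A closed box is the intersection of the open boxes enlarged by 1/(k+1). *)
Lemma measurable_oboxesE : (@measurable _ 'rV[R]_n) = <<s oboxes >>.
Proof.
apply/seteqP; split; last first.
  apply: smallest_sub; first exact: sigma_algebra_measurable.
  by move=> _ [a [b ->]]; exact: measurable_obox.
rewrite measurable_boxesE; apply: smallest_sub; first exact: smallest_sigma_algebra.
move=> _ [a [b ->]].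
rewrite (_ : box a b = \bigcap_k obox (a - const_mx k.+1%:R^-1) (b + const_mx k.+1%:R^-1)).
  rewrite -[X in <<s oboxes >> X]setCK setC_bigcap; apply: sigma_algebraC.
  apply: sigma_algebra_bigcup => k; apply: sigma_algebraC; apply: sub_sigma_algebra.
  by exists (a - const_mx k.+1%:R^-1), (b + const_mx k.+1%:R^-1).
apply/seteqP; split=> x.
  move=> /boxP h k _ i; have /andP[h1 h2] := h i; rewrite !mxE.
  have : 0 < k.+1%:R^-1 :> R by rewrite invr_gt0.
  by move: (k.+1%:R^-1) => q q0; apply/andP; split; lra.
move=> h; apply/boxP => i; apply/andP; split.
  apply/ler_addgt0Pr => e e0; have [k _ /(_ _ (leqnn k))/= ke] := near_infty_natSinv_lt (PosNum e0).
  by have := h k I i; rewrite !mxE; move: (k.+1%:R^-1) ke => q ke /andP[h1 _]; lra.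
apply/ler_addgt0Pr => e e0; have [k _ /(_ _ (leqnn k))/= ke] := near_infty_natSinv_lt (PosNum e0).
by have := h k I i; rewrite !mxE; move: (k.+1%:R^-1) ke => q ke /andP[_ h1]; lra.
Qed.

(** The measurable sets [E] for which the integral over O [&] E vanishes form a Dynkin system
    containing the open boxes, which are stable under intersection; hence they are all the
    measurable sets. *)
Lemma ae_eq0_obox (G : 'rV[R]_n -> R) a b : mu.-integrable (obox a b) (EFin \o G) ->
  (forall c d, (\int[mu]_(y in obox a b `&` obox c d) (G y)%:E = 0)%E) ->
  {ae mu, forall y, obox a b y -> G y = 0}.
Proof.
move=> iG G0; set O := obox a b; have mO : measurable O by exact: measurable_obox.
have iGS E : measurable E -> mu.-integrable (O `&` E) (EFin \o G).
  by move=> mE; apply: integrableS iG => //; exact: measurableI.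
have ind E : measurable E -> (\int[mu]_(y in O `&` E) (G y)%:E = 0)%E.
  rewrite {1}measurable_oboxesE; move: E; apply: dynkin_induction.
  - exact: measurable_oboxesE.
  - by move=> _ _ [c [d ->]] [c' [d' ->]]; rewrite oboxI; eexists; eexists.
  - by rewrite setIT -(setIid O) G0.
  - by move=> _ [c [d ->]]; exact: G0.
  - move=> S mS S0.
    have : (\int[mu]_(y in (O `&` S) `|` (O `&` ~` S)) (G y)%:E = 0)%E.
      by rewrite -setIUr setUCr setIT -(setIid O) G0.
    rewrite integral_setU_EFin ?S0 ?add0e//.
    + exact: measurableI.
    + by apply: measurableI => //; exact: measurableC.
    + by rewrite -setIUr setUCr setIT; exact: integrable_measurable iG.
    + by apply/disj_set2P; rewrite setIACA setICr setI0.
  - move=> F mF tF F0; rewrite setI_bigcupr integral_bigcup.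
    + by apply: eseries0 => k _ _; exact: F0.
    + by apply: trivIset_setIl.
    + by move=> k; exact: measurableI.
    + rewrite -setI_bigcupr; apply: iGS; exact: bigcupT_measurable.
have : ae_eq mu O (EFin \o G) (cst 0%E).
  apply: integral_ae_eq => // E EO mE.
  by rewrite integral0 -(setIidr EO) ind.
by apply: filterS => y h Oy; have [] := h Oy.
Qed.

End open_boxes.

Section fundamental_lemma.
Context {R : realType} {n : nat}.
Local Notation mu := (@lebesgue_rV R n).
Implicit Types (a b : 'rV[R]_n) (D : set 'rV[R]_n).

(* Tends to the indicator function of the open box as k grows. *)
Definition bump_pow a b (k : nat) (y : 'rV[R]_n) : R := 1 - (1 - box_bump a b y) ^+ k.+1.

Lemma bump_pow_test_fun D a b k : box a b `<=` D -> test_fun D (bump_pow a b k).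
Proof.
move=> abD; apply: (test_fun_supp (box_bump_test_fun abD)).
  apply: smooth_salg; rewrite /bump_pow.
  have sb : salg (smooth_on setT) (fun y : 'rV[R]_n => 1 + (-1) * box_bump a b y).
    apply: salg_add; first exact: salg_cst.
    by apply: salg_mul; [exact: salg_cst|apply: salg_base; exact: smooth_box_bump].
  have sp m : salg (smooth_on setT) (fun y : 'rV[R]_n => (1 + (-1) * box_bump a b y) ^+ m).
    elim: m => [|m IH]; first by under eq_fun do rewrite expr0; exact: salg_cst.
    by under eq_fun do rewrite exprS; exact: salg_mul.
  have := salg_add (salg_cst _ 1) (salg_mul (salg_cst _ (-1)) (sp k.+1)).
  by under eq_fun do rewrite !mulN1r.
move=> y; apply: contraNN => /eqP h; rewrite /bump_pow h subr0 expr1n subrr.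
exact: eqxx.
Qed.

Lemma bump_pow_bound a b k y : 0 <= bump_pow a b k y <= 1.
Proof.
have h0 := box_bump_ge0 a b y; have h1 := box_bump_le1 a b y.
have : 0 <= 1 - box_bump a b y <= 1 by apply/andP; split; lra.
move=> /andP[g0 g1]; rewrite /bump_pow subr_ge0 exprn_ile1//=.
by rewrite lerBlDr lerDl exprn_ge0.
Qed.

Lemma bump_pow_out a b k y : ~ obox a b y -> bump_pow a b k y = 0.
Proof.
move=> h; rewrite /bump_pow (_ : box_bump a b y = 0) ?subr0 ?expr1n ?subrr//.
apply/eqP; apply/negPn/negP => h0; apply: h; apply/box_bump_gt0P.
by rewrite lt_neqAle eq_sym h0 box_bump_ge0.
Qed.

Lemma bump_pow_cvg a b y : obox a b y -> bump_pow a b k y @[k --> \oo] --> (1 : R).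
Proof.
move=> /box_bump_gt0P h; rewrite -[X in _ --> X]subr0.
apply: cvgB; first exact: cvg_cst.
rewrite (cvg_shiftS (fun k => (1 - box_bump a b y) ^+ k)).
apply: cvg_expr; rewrite ger0_norm; first by rewrite ltrBlDr ltrDl.
by rewrite subr_ge0 box_bump_le1.
Qed.

(** It suffices to work in each open box of a countable cover whose closed boxes lie in [D]. For a
    sub-box, the functions [bump_pow] are admissible and converge boundedly to its indicator, so
    dominated convergence makes the integral of [G] over the sub-box vanish. *)
Lemma fundamental_lemma D (G : 'rV[R]_n -> R) : open D -> loc_integrable D G ->
  (forall phi, test_fun D phi -> \int[mu]_(y in D) (G y * phi y) = 0) ->
  {ae mu, forall y, D y -> G y = 0}.
Proof.
move=> oD lG HG.
have [F [DE HF]] := open_bigcup_obox oD.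
have key k : {ae mu, forall y, F k y -> G y = 0}.
  have [->|[a [b [-> abD]]]] := HF k; first by apply: nearW => y.
  have iab : mu.-integrable (box a b) (EFin \o G) by apply: lG abD; exact: box_compact.
  apply: ae_eq0_obox.
    by apply: integrableS iab; [exact: measurable_box|exact: measurable_obox|exact: obox_sub_box].
  move=> c d; rewrite oboxI.
  set a' := \row_i _; set b' := \row_i _.
  have ab' : box a' b' `<=` box a b by exact: box_sub_max_min.
  have mO : measurable (obox a' b') by exact: measurable_obox.
  have OD : obox a' b' `<=` D.
    by apply: subset_trans (@obox_sub_box _ _ a' b') _; exact: subset_trans abD.
  have iO : mu.-integrable (obox a' b') (EFin \o G).
    apply: integrableS iab => //; first exact: measurable_box.
    exact: subset_trans (@obox_sub_box _ _ a' b') ab'.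
  have mG := integrable_measurable iO.
  have mb k' : measurable_fun setT (bump_pow a' b' k').
    apply: continuous_rV_measurable; apply: smooth_continuous.
    by case: (@bump_pow_test_fun setT a' b' k' (@subsetT _ _)).
  have z k' : (\int[mu]_(y in obox a' b') (G y * bump_pow a' b' k' y)%:E = 0)%E.
    have tf : test_fun D (bump_pow a' b' k').
      by apply: bump_pow_test_fun; exact: subset_trans abD.
    have e := HG _ tf.
    rewrite (Rintegral_subset0 _ OD) in e; last first.
      by move=> y _ /bump_pow_out ->; rewrite mulr0.
    rewrite -(@Rintegral_EFin _ _ _ (fun y => G y * bump_pow a' b' k' y)) ?e//.
    apply: (@le_integrableR _ _ _ _ _ _ _ (fun y => `|G y|)) => //.
    - by apply: measurable_funM => //; exact: measurable_funTS.
    - move=> y _; rewrite normrM ler_piMr//.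
      by have /andP[? ?] := bump_pow_bound a' b' k' y; rewrite ger0_norm.
    - exact: (integrable_abse iO).
  have := @dominated_cvg _ _ _ mu (obox a' b') mO
    (fun k' y => (G y * bump_pow a' b' k' y)%:E) (EFin \o G) (EFin \o (fun y => `|G y|)).
  under eq_cvg do rewrite z.
  move=> H; have /(cvg_lim (@ereal_hausdorff R)) <- : (fun=> 0%E) @ \oo -->
      (\int[mu]_(y in obox a' b') (EFin \o G) y)%E.
    apply: H.
    - move=> k'; apply/measurable_EFinP; apply: measurable_funM => //; exact: measurable_funTS.
    - move=> y Oy; apply: cvg_EFin; first exact: nearW.
      rewrite -[X in _ --> X]mulr1; apply: cvgM; first exact: cvg_cst.
      exact: bump_pow_cvg.
    - by [].
    - exact: (integrable_abse iO).
    - move=> k' y Oy; rewrite lee_fin normrM ler_piMr//.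
      by have /andP[? ?] := bump_pow_bound a' b' k' y; rewrite ger0_norm.
  exact: lim_cst.
have : {ae mu, forall y, forall k, F k y -> G y = 0} by apply/ae_foralln.
by apply: filterS => y h; rewrite DE => -[k _]; exact: h.
Qed.

End fundamental_lemma.

(** * Integration by parts *)

Section integration_by_parts.
Context {R : realType} {n : nat}.
Local Notation mu := (@lebesgue_rV R n).
Implicit Types (D : set 'rV[R]_n) (f g phi psi : 'rV[R]_n -> R) (y w : 'rV[R]_n).

Lemma test_fun_closure D f : test_fun D f -> test_fun (closure [set y | f y != 0]) f.
Proof. by move=> [? ? ?]; split. Qed.

Lemma test_funS D E f : D `<=` E -> test_fun D f -> test_fun E f.
Proof. by move=> DE [? ? fD]; split => //; exact: subset_trans DE. Qed.

Lemma test_fun_pderiv D f i : test_fun D f -> test_fun D (pderiv i f).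
Proof.
move=> tf; have [sf cf fD] := tf.
have sub : closure [set y | pderiv i f y != 0] `<=` closure [set y | f y != 0].
  rewrite [X in _ `<=` X](closure_id _).1; last exact: closed_closure.
  apply: closureS => y /= h; apply: contrapT => hy; move: h.
  have := test_fun_grad0 (test_fun_closure tf) hy.
  by move=> /rowP/(_ i); rewrite !mxE => ->; rewrite eqxx.
split; first exact: smooth_pderiv.
  by apply: subclosed_compact cf sub; exact: closed_closure.
exact: subset_trans fD.
Qed.

Lemma test_fun_bounded D f : test_fun D f -> exists2 M, 0 < M & forall y, `|f y| <= M.
Proof.
move=> tf; have [sf cf fD] := tf.
have [M M0 HM] := continuous_compact_bounded (smooth_continuous sf) cf.
exists M => // y; have [/HM//|hy] := pselect (closure [set y | f y != 0] y).
by rewrite (test_fun0 (test_fun_closure tf) hy) normr0 ltW.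
Qed.

Lemma test_fun_cube D f : test_fun D f -> exists k, forall y, ~ cube k y -> f y = 0.
Proof.
move=> tf; have [sf cf fD] := tf.
have [M [Mr HM]] := compact_bounded cf.
have {}HM := HM (`|M| + 1) (ltr_pwDr ltr01 (ler_norm M)).
exists (Num.truncn (`|M| + 1)).+1 => y hy.
apply: (test_fun0 (test_fun_closure tf)) => /HM hM; apply: hy.
apply/boxP => i; rewrite !mxE -ler_norml (le_trans (rV_coord_le _ _))// (le_trans hM)//.
exact/ltW/truncnS_gt.
Qed.

Lemma compact_supp_integrable f k M : measurable_fun setT f -> (forall y, `|f y| <= M) ->
  (forall y, ~ cube k y -> f y = 0) -> mu.-integrable setT (EFin \o f).
Proof.
move=> mf fM f0; apply/integrableP; split; first exact/measurable_EFinP.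
rewrite (@integral_subset0 _ _ _ mu (cube k) setT)//; last first.
  by move=> y _ /f0; rewrite /= => ->; rewrite normr0.
have : mu.-integrable (cube k) (EFin \o f).
  apply: (@bounded_integrable _ _ _ _ M) => //.
  - exact: measurable_box.
  - exact: box_lty.
  - exact: measurable_funTS.
by move=> /integrableP[].
Qed.

Lemma test_fun_measurable D E f : test_fun D f -> measurable_fun E f.
Proof.
move=> [sf _ _]; apply: measurable_funTS.
by apply: continuous_rV_measurable; exact: smooth_continuous.
Qed.

Lemma test_fun_integrable D f : test_fun D f -> mu.-integrable setT (EFin \o f).
Proof.
move=> tf; have [M _ HM] := test_fun_bounded tf; have [k Hk] := test_fun_cube tf.
exact: (compact_supp_integrable (test_fun_measurable tf) HM Hk).
Qed.

Lemma integral_rV_translate w (F : 'rV[R]_n -> \bar R) : measurable_fun setT F ->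
  (\int[mu]_y F (y + w)%R = \int[mu]_y F y)%E.
Proof.
move=> mF.
have pos (G : 'rV[R]_n -> \bar R) : measurable_fun setT G -> (forall y, 0 <= G y)%E ->
    (\int[mu]_y G (y + w)%R = \int[mu]_y G y)%E.
  move=> mG G0; have := @integral_rV_affine _ _ w 1 setT G ltr01 measurableT mG (fun y _ => G0 y).
  rewrite preimage_setT expr1n invr1 mul1e => <-.
  by apply: eq_integral => y _; rewrite scale1r addrC.
rewrite integralE [RHS]integralE; congr (_ - _)%E.
  rewrite -(pos (F^\+)%E) => [||y]; [|exact: measurable_funepos|exact: funepos_ge0].
  by apply: eq_integral => y _; rewrite !funeposE.
rewrite -(pos (F^\-)%E) => [||y]; [|exact: measurable_funeneg|exact: funeneg_ge0].
by apply: eq_integral => y _; rewrite !funenegE.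
Qed.

(** By translation invariance the integral of f(y + t e_i) does not depend on t; its derivative at t
    = 0 is the integral of the partial derivative. *)
Lemma integral_pderiv_test f i : test_fun setT f -> \int[mu]_y pderiv i f y = 0.
Proof.
move=> tf; have tdf := test_fun_pderiv i tf.
have [M M0 HM] := test_fun_bounded tf; have [M' M'0 HM'] := test_fun_bounded tdf.
have [k Hk] := test_fun_cube tf; have [k' Hk'] := test_fun_cube tdf.
have sf : smooth_on setT f by case: tf.
pose g (t : R) y := f (y + t *: delta_mx 0 i).
have Eg t : \int[mu]_y g t y = \int[mu]_y f y.
  rewrite /Rintegral (@integral_rV_translate _ (EFin \o f))//.
  by apply/measurable_EFinP; exact: test_fun_measurable tf.
have pg t y : partial1of2 g t y = pderiv i f (y + t *: delta_mx 0 i).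
  rewrite partial1of2E.
  have h : is_derive t 1 (g^~ y) (pderiv i f (y + t *: delta_mx 0 i)).
    by apply: is_derive_line; exact: smooth_derivable.
  exact: (@derive_val _ _ _ _ _ _ _ h).
have H : h^-1 *: (\int[mu]_y g (h + 0) y - \int[mu]_y g 0 y) @[h --> (0 : R)^'] -->
    \int[mu]_y partial1of2 g 0 y.
  (* For |t| < 1 the translated derivative vanishes outside the cube enlarged by 1, so a constant on
     that cube dominates. *)
  apply: (@cvg_differentiation_under_integral _ _ _ mu g setT measurableT 0 (-1) 1 _ _ _
    (fun y => M' * \1_(cube k'.+1) y)).
  - by rewrite /= in_itv/= ltrN10 ltr01.
  - move=> t _.
    have cg : continuous (g t).
      move=> y; apply: (@continuous_comp _ _ _ (fun y => y + t *: delta_mx 0 i) f).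
        apply: (@continuousD _ _ _ id (cst (t *: delta_mx 0 i))); first exact: cvg_id.
        exact: cst_continuous.
      exact: smooth_continuous.
    apply/integrableP; split; first by apply/measurable_EFinP; exact: continuous_rV_measurable.
    rewrite (@integral_rV_translate _ (fun y => `|(f y)%:E|%E)).
      by have /integrableP[] := test_fun_integrable tf.
    apply: measurableT_comp => //; apply/measurable_EFinP; exact: test_fun_measurable tf.
  - move=> t y _ _.
    have : is_derive t 1 (g^~ y) (pderiv i f (y + t *: delta_mx 0 i)).
      by apply: is_derive_line; exact: smooth_derivable.
    by case.
  - by move=> y; rewrite mulr_ge0 ?(ltW M'0).
  - apply: (@compact_supp_integrable _ k'.+1 M').
    + apply: measurable_funM => //; apply: measurable_indic; exact: measurable_box.
    + move=> y; rewrite indicE normrM (gtr0_norm M'0) ler_piMr ?(ltW M'0)//.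
      by case: (y \in _); rewrite ?normr1 ?normr0.
    + by move=> y hy; rewrite indicE memNset// mulr0.
  - move=> t y; rewrite /= in_itv/= => /andP[t1 t2] _; rewrite pg indicE.
    have [yc|yc] := pselect (cube k'.+1 y); first by rewrite mem_set// mulr1.
    rewrite memNset// mulr0 Hk' ?normr0// => /boxP h; apply: yc; apply/boxP => j.
    have := h j; rewrite !mxE -natr1 eqxx/=.
    case: (j == i) => /=; rewrite ?mulr1 ?mulr0 => /andP[? ?]; apply/andP; split; lra.
have E0 : (fun h : R => h^-1 *: (\int[mu]_y g (h + 0) y - \int[mu]_y g 0 y)) = cst 0.
  by apply/funext => h; rewrite !Eg subrr scaler0.
rewrite E0 in H.
have -> : \int[mu]_y pderiv i f y = \int[mu]_y partial1of2 g 0 y.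
  by apply: eq_Rintegral => y _; rewrite pg scale0r addr0.
rewrite -(cvg_lim (@Rhausdorff R) H); exact: lim_cst.
Qed.

Lemma integration_by_parts_test D phi psi i : open D -> test_fun D phi -> test_fun D psi ->
  \int[mu]_(y in D) (phi y * pderiv i psi y) =
  - \int[mu]_(y in D) (pderiv i phi y * psi y).
Proof.
move=> oD tphi tpsi; have mD := open_rV_measurable oD.
have sphi : smooth_on setT phi by case: tphi.
have spsi : smooth_on setT psi by case: tpsi.
have tF := test_funM tphi spsi.
have i1 : mu.-integrable D (EFin \o (fun y => phi y * pderiv i psi y)).
  apply: (integrableS measurableT) => //.
  exact: test_fun_integrable (test_funM tphi (smooth_pderiv i spsi)).
have i2 : mu.-integrable D (EFin \o (fun y => pderiv i phi y * psi y)).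
  apply: (integrableS measurableT) => //.
  exact: test_fun_integrable (test_funM (test_fun_pderiv i tphi) spsi).
have E y : pderiv i (fun y => phi y * psi y) y = phi y * pderiv i psi y + pderiv i phi y * psi y.
  rewrite {1}/pderiv; apply: (@derive_val _ _ _ _ _ _ _ (is_pderivM _ _)); exact: smooth_derivable.
have := integral_pderiv_test i (test_funS (@subsetT _ _) tF).
rewrite (@Rintegral_subset0 _ _ _ mu D)//; last first.
  by move=> y _ /(test_fun0 (test_fun_pderiv i tF)).
under eq_Rintegral do rewrite E.
by rewrite RintegralD// => /eqP; rewrite addr_eq0 => /eqP.
Qed.

End integration_by_parts.

(** * The p-energy *)

Section ge0_integral_bounds.
Local Open Scope ereal_scope.
Context d {T : measurableType d} {R : realType} (mu : {measure set T -> \bar R}).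
Variables (D : set T) (mD : measurable D).
Implicit Types (f g h : T -> R).

Lemma ge0_integral_leZ f g (k : R) : measurable_fun D f -> measurable_fun D g ->
  (0 <= k)%R -> (forall x, D x -> 0 <= f x)%R -> (forall x, D x -> 0 <= g x)%R ->
  (forall x, D x -> f x <= k * g x)%R ->
  \int[mu]_(x in D) (f x)%:E <= k%:E * \int[mu]_(x in D) (g x)%:E.
Proof.
move=> mf mg k0 f0 g0 fg; rewrite -ge0_integralZl//; last exact/measurable_EFinP.
apply: ge0_le_integral => //.
- exact/measurable_EFinP.
- by apply: emeasurable_funM => //; exact/measurable_EFinP.
Qed.

Lemma ge0_integral_leD f g h (k : R) :
  measurable_fun D f -> measurable_fun D g -> measurable_fun D h ->
  (0 <= k)%R -> (forall x, D x -> 0 <= f x)%R -> (forall x, D x -> 0 <= g x)%R ->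
  (forall x, D x -> 0 <= h x)%R ->
  (forall x, D x -> f x <= k * (g x + h x))%R ->
  \int[mu]_(x in D) (f x)%:E <=
  k%:E * (\int[mu]_(x in D) (g x)%:E + \int[mu]_(x in D) (h x)%:E).
Proof.
move=> mf mg mh k0 f0 g0 h0 fg.
rewrite -ge0_integralD//.
- by apply: ge0_integral_leZ => //; [exact: measurable_funD|move=> x Dx; rewrite addr_ge0 ?g0 ?h0].
- exact/measurable_EFinP.
- exact/measurable_EFinP.
Qed.

End ge0_integral_bounds.

(** Kept as a p-th power rather than a norm: pointwise bounds integrate directly, and a triangle
    inequality with factor 2^p replaces Minkowski's. *)
HB.lock Definition energy {R : realType} {n : nat} (D : set 'rV[R]_n) (p : R)
    (G : 'rV[R]_n -> 'rV[R]_n) : \bar R :=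
  (\int[@lebesgue_rV R n]_(y in D) (enorm (G y) `^ p)%:E)%E.

Section energy.
Context {R : realType} {n : nat}.
Local Notation mu := (@lebesgue_rV R n).
Implicit Types (D : set 'rV[R]_n) (f v : 'rV[R]_n -> R) (G H : 'rV[R]_n -> 'rV[R]_n) (p : R).

Lemma energyE D p G : energy D p G = (\int[mu]_(y in D) (enorm (G y) `^ p)%:E)%E.
Proof. by rewrite unlock. Qed.

Definition measurable_vec D G := forall i, measurable_fun D (fun y => G y 0 i).

Lemma measurable_vecD D G H : measurable_vec D G -> measurable_vec D H ->
  measurable_vec D (fun y => G y + H y).
Proof.
move=> mG mH i; rewrite (_ : (fun y => _) = (fun y => G y 0 i + H y 0 i)).
  exact: measurable_funD.
by apply/funext => y; rewrite mxE.
Qed.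

Lemma measurable_vecZ D f G : measurable_fun D f -> measurable_vec D G ->
  measurable_vec D (fun y => f y *: G y).
Proof.
move=> mf mG i; rewrite (_ : (fun y => _) = (fun y => f y * G y 0 i)).
  exact: measurable_funM.
by apply/funext => y; rewrite mxE.
Qed.

Lemma measurable_vecB D G H : measurable_vec D G -> measurable_vec D H ->
  measurable_vec D (fun y => G y - H y).
Proof.
move=> mG mH i; rewrite (_ : (fun y => _) = (fun y => G y 0 i - H y 0 i)).
  exact: measurable_funB.
by apply/funext => y; rewrite !mxE.
Qed.

Lemma measurable_vec_grad D E f : test_fun E f -> measurable_vec D (grad f).
Proof.
move=> tf i; rewrite (_ : (fun y => _) = pderiv i f).
  exact: test_fun_measurable (test_fun_pderiv i tf).
by apply/funext => y; rewrite mxE.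
Qed.

Lemma measurable_energy_fun D p G : measurable_vec D G ->
  measurable_fun D (fun y => enorm (G y) `^ p).
Proof.
move=> mG; apply: (measurableT_comp (measurable_powR p)); exact: measurable_enorm.
Qed.

Lemma energy_ge0 D p G : (0 <= energy D p G)%E.
Proof. by rewrite energyE; apply: integral_ge0 => y _; rewrite lee_fin powR_ge0. Qed.

Lemma energyD D p G H : measurable D -> 0 <= p -> measurable_vec D G -> measurable_vec D H ->
  (energy D p (fun y => G y + H y)%R <=
   (2 `^ p)%:E * (energy D p G + energy D p H))%E.
Proof.
rewrite !energyE.
move=> mD p0 mG mH.
have mG' := measurable_energy_fun p mG; have mH' := measurable_energy_fun p mH.
have mGH := measurable_energy_fun p (measurable_vecD mG mH).
apply: (ge0_integral_leD _ mD mGH mG' mH' (powR_ge0 _ _)); try by move=> y _; exact: powR_ge0.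
by move=> y _; exact: enorm_powR_le.
Qed.

Lemma energyZ D p M f G : measurable D -> 0 <= p -> 0 <= M -> measurable_fun D f ->
  measurable_vec D G -> (forall y, D y -> `|f y| <= M) ->
  (energy D p (fun y => f y *: G y) <= (M `^ p)%:E * energy D p G)%E.
Proof.
rewrite !energyE.
move=> mD p0 M0 mf mG fM.
apply: (ge0_integral_leZ _ mD (measurable_energy_fun p (measurable_vecZ mf mG))
  (measurable_energy_fun p mG) (powR_ge0 _ _)).
- by move=> y _; exact: powR_ge0.
- by move=> y _; exact: powR_ge0.
- move=> y Dy; rewrite enormZ powRM ?enorm_ge0// ler_wpM2r ?powR_ge0//.
  by apply: ge0_ler_powR; rewrite ?nnegrE//; exact: fM.
Qed.

Lemma energyN D p G : energy D p (fun y => - G y) = energy D p G.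
Proof. by rewrite !energyE; apply: eq_integral => y _; rewrite enormN. Qed.

Lemma energyS D E p G : measurable D -> measurable E -> E `<=` D -> measurable_vec D G ->
  (energy E p G <= energy D p G)%E.
Proof.
rewrite !energyE.
move=> mD mE ED mG; apply: ge0_subset_integral => //.
  by apply/measurable_EFinP; exact: measurable_energy_fun.
by move=> y _; rewrite lee_fin powR_ge0.
Qed.

Lemma energy_le_sub D p (e : R) G H : measurable D -> 0 <= p ->
  measurable_vec D G -> measurable_vec D H -> (energy D p H <= e%:E)%E ->
  (energy D p (fun y => H y - G y)%R <= e%:E)%E ->
  (energy D p G <= (2 `^ p * (e + e))%:E)%E.
Proof.
move=> mD p0 mG mH He HGe; have := energyD mD p0 mH (measurable_vecB mG mH).
rewrite (_ : (fun y => _) = G); last by apply/funext => y; rewrite addrC subrK.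
move=> /le_trans; apply; rewrite EFinM EFinD; apply: lee_wpmul2l; first by rewrite lee_fin powR_ge0.
apply: leeD => //; rewrite -energyN (_ : (fun y => _) = (fun y => H y - G y))//.
by apply/funext => y; rewrite opprB.
Qed.

Lemma ae_eq_energy D p G H : measurable D -> measurable_vec D G -> measurable_vec D H ->
  {ae mu, forall y, D y -> G y = H y} -> energy D p G = energy D p H.
Proof.
rewrite !energyE.
move=> mD mG mH GH; apply: ge0_ae_eq_integral => //.
- by apply/measurable_EFinP; exact: measurable_energy_fun.
- by apply/measurable_EFinP; exact: measurable_energy_fun.
- by move=> y _; rewrite lee_fin powR_ge0.
- by move=> y _; rewrite lee_fin powR_ge0.
- by apply: filterS GH => y h Dy; rewrite h.
Qed.

Lemma powR_dominated (M p : R) : 1 <= p -> 0 <= M -> M <= 1 + M `^ p.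
Proof.
move=> p1 M0; have [M1|M1] := leP M 1; first by rewrite (le_trans M1)// lerDl powR_ge0.
by rewrite (le_trans (le1r_powR (ltW M1) p1))// lerDr.
Qed.

Lemma energy_integrable D p G : measurable_vec D G -> (energy D p G < +oo)%E ->
  mu.-integrable D (EFin \o (fun y => enorm (G y) `^ p)).
Proof.
rewrite !energyE.
move=> mG E; apply/integrableP; split.
  by apply/measurable_EFinP; exact: measurable_energy_fun.
rewrite (le_lt_trans _ E)// le_eqVlt; apply/orP; left; apply/eqP.
by apply: eq_integral => y _; rewrite /= ger0_norm ?powR_ge0.
Qed.

Lemma cst_integrable D (k : R) : measurable D -> (mu D < +oo)%E ->
  mu.-integrable D (EFin \o (fun=> k)).
Proof. by move=> mD D8; apply: (@bounded_integrable _ _ _ _ `|k|). Qed.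

Lemma energy_coord_integrable D p G i : measurable D -> (mu D < +oo)%E -> 1 <= p ->
  measurable_vec D G -> (energy D p G < +oo)%E ->
  mu.-integrable D (EFin \o (fun y => G y 0 i)).
Proof.
move=> mD D8 p1 mG E.
apply: (@le_integrableR _ _ _ _ _ mD _ (fun y => 1 + enorm (G y) `^ p)) => //.
  move=> y _; apply: le_trans (coord_le_enorm _ i) _.
  by apply: powR_dominated => //; exact: enorm_ge0.
apply: integrableRD => //; first exact: cst_integrable.
exact: energy_integrable.
Qed.

Lemma test_grad_energy_lty D E p f : measurable D -> (mu D < +oo)%E -> 0 <= p ->
  test_fun E f -> (energy D p (grad f) < +oo)%E.
Proof.
rewrite !energyE.
move=> mD D8 p0 tf.
have : {ae mu, forall y, True} by apply: nearW.
have [B HB] : exists B, forall y i, `|grad f y 0 i| <= B.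
  have H i : {M | forall y, `|pderiv i f y| <= M}.
    by apply: cid; have [M _ HM] := test_fun_bounded (test_fun_pderiv i tf); exists M.
  exists (\sum_(i < n) `|sval (H i)|) => y i; rewrite mxE.
  rewrite (bigD1 i)//= -[leLHS]addr0 lerD ?sumr_ge0//.
  by case: (H i) => M /= HM; exact: le_trans (HM y) (ler_norm _).
move=> _; have : mu.-integrable D (EFin \o (fun y => enorm (grad f y) `^ p)).
  apply: (@bounded_integrable _ _ _ _ ((n%:R * `|B|) `^ p)) => //.
    exact: measurable_energy_fun (measurable_vec_grad tf).
  move=> y _; rewrite ger0_norm ?powR_ge0//.
  apply: ge0_ler_powR; rewrite ?nnegrE ?enorm_ge0 ?mulr_ge0//.
  apply: le_trans (enorm_le_sum _) _.
  rewrite mulr_natl -[X in _ *+ X]card_ord -sumr_const; apply: ler_sum => i _.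
  by rewrite (le_trans (HB y i))// ler_norm.
move=> /integrableP[_]; apply: le_lt_trans; rewrite le_eqVlt; apply/orP; left; apply/eqP.
by apply: eq_integral => y _; rewrite /= ger0_norm ?powR_ge0.
Qed.

Lemma LqnormE_pow D p f : p != 0 ->
  LqnormE D p%:E f = ((\int[mu]_(y in D) (`|f y| `^ p)%:E) `^ p^-1)%E.
Proof.
move=> p0; rewrite /LqnormE unlock.
apply: (congr1 (fun a => poweR a p^-1)).
rewrite [RHS]integral_mkcond; apply: eq_integral => y _ /=.
rewrite !patchE; case: ifPn => // yD.
by rewrite normr0 powR0.
Qed.

Lemma LqnormE_enorm D p G : p != 0 ->
  LqnormE D p%:E (fun y => enorm (G y)) = (energy D p G `^ p^-1)%E.
Proof.
move=> p0; rewrite energyE (LqnormE_pow _ _ p0); apply: (congr1 (fun a => poweR a p^-1)).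
apply: eq_integral => y _; by rewrite ger0_norm ?enorm_ge0.
Qed.

Lemma poweR_lt_fin p (e : R) (a : \bar R) : 0 < p -> 0 < e -> (0 <= a)%E ->
  (a `^ p^-1 < e%:E)%E <-> (a < (e `^ p)%:E)%E.
Proof.
move=> p0 e0; case: a => [a| |] //; last first.
  by move=> _; rewrite poweRyr ?gt_eqF ?invr_gt0.
rewrite lee_fin => a0; rewrite poweR_EFin !lte_fin.
have E : a = (a `^ p^-1) `^ p by rewrite powRVK ?gt_eqF.
split=> h.
  by rewrite E; apply: gt0_ltr_powR; rewrite ?nnegrE ?powR_ge0// ltW.
rewrite ltNge; apply/negP => h2; move: h; rewrite E ltNge => /negP; apply.
by apply: ge0_ler_powR; rewrite ?nnegrE ?powR_ge0 ?(ltW e0) ?(ltW p0).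
Qed.

Lemma poweR_lty_iff p (a : \bar R) : 0 < p -> (0 <= a)%E ->
  (a `^ p^-1 < +oo)%E <-> (a < +oo)%E.
Proof.
move=> p0; case: a => [a| |] //; first by move=> _; rewrite poweR_EFin !ltry.
by move=> _; rewrite poweRyr ?gt_eqF ?invr_gt0.
Qed.

End energy.

(** * Weak gradients, the p-Laplacian and powers *)

Section topology_facts.
Context {R : realType} {n : nat}.
Local Notation mu := (@lebesgue_rV R n).
Implicit Types (D : set 'rV[R]_n).

Lemma bounded_sub_cube D : bounded_set D -> exists k, closure D `<=` cube k.
Proof.
move=> [M [Mr HM]]; have {}HM := HM (`|M| + 1) (ltr_pwDr ltr01 (ler_norm M)).
exists (Num.truncn (`|M| + 1)).+1.
rewrite [X in _ `<=` X](closure_id _).1; last first.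
  by apply: compact_closed; [exact: norm_hausdorff|exact: box_compact].
apply: closureS => y /HM hM; apply/boxP => i; rewrite !mxE -ler_norml.
rewrite (le_trans (rV_coord_le _ _))// (le_trans hM)//.
exact/ltW/truncnS_gt.
Qed.

Lemma compact_rV_measurable (K : set 'rV[R]_n) : compact K -> measurable K.
Proof.
move=> cK; rewrite -[K]setCK; apply: measurableC; apply: open_rV_measurable.
by rewrite openC; apply: compact_closed => //; exact: norm_hausdorff.
Qed.

Lemma open_measure_gt0 (U : set 'rV[R]_n) y : open U -> U y -> (0 < mu U)%E.
Proof.
move=> oU Uy; have [r r0 abU] := nbhs_box (open_nbhs_nbhs (conj oU Uy)).
set a := y - _ in abU; set b := y + _ in abU.
apply: (@lt_le_trans _ _ (mu (box a b))); last first.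
  by apply: le_measure => //; rewrite inE; [exact: measurable_box|exact: open_rV_measurable].
rewrite lebesgue_rV_box; last by move=> i; rewrite !mxE; lra.
by rewrite lte_fin; apply: prodr_gt0 => i _; rewrite !mxE; lra.
Qed.

End topology_facts.

Section abs_bound.
Context d {T : measurableType d} {R : realType} (mu : {measure set T -> \bar R}).

Lemma abs_Rintegral_le (D : set T) (f g : T -> R) : measurable D -> measurable_fun D f ->
  mu.-integrable D (EFin \o g) -> (forall x, D x -> `|f x| <= g x) ->
  `|\int[mu]_(x in D) f x| <= \int[mu]_(x in D) g x.
Proof.
move=> mD mf ig fg; have fi := le_integrableR mD mf fg ig.
apply: (le_trans (le_normr_Rintegral mD fi)); apply: le_Rintegral => //.
apply: (le_integrableR mD _ _ ig); first exact: measurableT_comp.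
by move=> x Dx; rewrite normr_id fg.
Qed.

End abs_bound.

Lemma integral_cst_fin d (T : measurableType d) (R : realType) (mu : {measure set T -> \bar R})
  (D : set T) (c m : R) : measurable D -> mu D = m%:E ->
  (\int[mu]_(x in D) c%:E)%E = (c * m)%:E.
Proof. by move=> mD muD; rewrite integral_cst// muD. Qed.

Section weak_gradient.
Context {R : realType} {n : nat}.
Local Notation mu := (@lebesgue_rV R n).
Implicit Types (D : set 'rV[R]_n) (f v phi psi : 'rV[R]_n -> R) (G H : 'rV[R]_n -> 'rV[R]_n).

(** Integrability on compact sets gives measurability on each box of a countable cover of [D]. *)
Lemma loc_integrable_measurable D f : open D -> loc_integrable D f -> measurable_fun D f.
Proof.
move=> oD lf; have [F [DE HF]] := open_bigcup_obox oD.
rewrite DE; apply/measurable_fun_bigcup => [k|k].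
  by have [->|[a [b [-> _]]]] := HF k; [exact: measurable0|exact: measurable_obox].
have [->|[a [b [-> abD]]]] := HF k; first exact: measurable_fun_set0.
apply: measurable_funS (@obox_sub_box _ _ a b) _; first exact: measurable_box.
by apply: integrable_measurable; apply: lf => //; exact: box_compact.
Qed.

Lemma loc_integrable_test D f phi : loc_integrable D f -> test_fun D phi ->
  let K := closure [set y | phi y != 0] in
  mu.-integrable K (EFin \o (fun y => f y * phi y)) /\
  \int[mu]_(y in D) (f y * phi y) = \int[mu]_(y in K) (f y * phi y).
Proof.
move=> lf tphi K; have [sphi cK KD] := tphi.
have fi := lf _ cK KD; have mK := compact_rV_measurable cK.
have [M M0 HM] := test_fun_bounded tphi; split.
  apply: (@le_integrableR _ _ _ _ _ mK _ (fun y => M * `|f y|)).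
  - apply: measurable_funM; first exact: integrable_measurable fi.
    exact: test_fun_measurable tphi.
  - by move=> y Ky; rewrite normrM mulrC ler_wpM2r.
  - by apply: integrableRZ => //; exact: (integrable_abse fi).
apply: Rintegral_subset0 => // y _ nKy.
by rewrite (test_fun0 (test_fun_closure tphi) nKy) mulr0.
Qed.

Lemma is_wgrad_unique D v G H : open D -> is_wgrad D v G -> is_wgrad D v H ->
  {ae mu, forall y, D y -> G y = H y}.
Proof.
move=> oD [lv lG hG] [_ lH hH].
have key i : {ae mu, forall y, D y -> G y 0 i - H y 0 i = 0}.
  apply: fundamental_lemma => //.
    move=> K cK KD; have mK := compact_rV_measurable cK.
    by apply: integrableRB => //; [exact: lG|exact: lH].
  move=> phi tphi; have [sphi cK KD] := tphi; have mK := compact_rV_measurable cK.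
  have [i1 e1] := loc_integrable_test (lG i) tphi.
  have [i2 e2] := loc_integrable_test (lH i) tphi.
  rewrite (@Rintegral_subset0 _ _ _ mu (closure [set y | phi y != 0]) D)//; last first.
    by move=> y _ nKy; rewrite (test_fun0 (test_fun_closure tphi) nKy) mulr0.
  under eq_Rintegral do rewrite mulrBl.
  rewrite RintegralB// -e1 -e2; apply/eqP; rewrite subr_eq0; apply/eqP/oppr_inj.
  by rewrite -hG// -hH.
have : {ae mu, forall y, forall i, D y -> G y 0 i - H y 0 i = 0} by apply: filter_forall.
apply: filterS => y h Dy; apply/rowP => i; apply/eqP; rewrite -subr_eq0.
by rewrite h.
Qed.

Lemma is_wgrad_wgrad D v : (exists G, is_wgrad D v G) -> is_wgrad D v (wgrad D v).
Proof. by move=> [G hG]; exact: (xgetPex (fun=> 0) (ex_intro _ G hG)). Qed.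

End weak_gradient.

(** * The p-Laplacian integrand and its sharp inequalities *)

Section plaplacian.
Context {R : realType} {n : nat}.
Implicit Types (g k h : 'rV[R]_n) (p : R).

Definition plap p g k : R := enorm g `^ (p - 2) * dotrV g k.

Lemma dotrVNl g k : dotrV (- g) k = - dotrV g k.
Proof. by rewrite -(scaleN1r g) dotrVZl mulN1r. Qed.

Lemma dotrVNr g k : dotrV g (- k) = - dotrV g k.
Proof. by rewrite dotrVC dotrVNl dotrVC. Qed.

Lemma normr_dotrV_le g k : `|dotrV g k| <= enorm g * enorm k.
Proof.
rewrite ler_norml dotrV_le_enorm andbT lerNl.
by rewrite -dotrVNr -(enormN k) dotrV_le_enorm.
Qed.

Lemma plapE0 p g k : enorm g = 0 -> plap p g k = 0.
Proof. by move=> /enorm_eq0 ->; rewrite /plap -(scale0r g) dotrVZl mul0r mulr0. Qed.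

Lemma powRB1M (a p : R) : 0 < a -> a `^ (p - 1) * a = a `^ p.
Proof.
move=> a0; rewrite -{2}(powRr1 (ltW a0)) -powRD ?subrK//.
by rewrite (gt_eqF a0) implybT.
Qed.

Lemma powRB2M (a p : R) : 0 < a -> a `^ (p - 2) * a = a `^ (p - 1).
Proof.
move=> a0; rewrite -(powRB1M (p - 1) a0); congr (_ * _).
by congr (powR _ _); rewrite -addrA -opprD.
Qed.

(** Used with s = s_p(x), [a] the gradient norm of the solution and t its value at x. The first two
    relations give (s a)^p <= s a, hence (s a)^(p-1) <= 1; the last one gives the reverse
    inequality. *)
Lemma extremal_scale (s a p t : R) : 1 < p -> 0 < s -> 0 < a ->
  a `^ p = s `^ (- p) * t -> t <= s * a -> s <= s `^ p * a `^ (p - 1) -> s * a = 1.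
Proof.
move=> p1 s0 a0 at_ ts ss.
have sa0 : 0 < s * a by rewrite mulr_gt0.
have p10 : 0 < p - 1 by rewrite subr_gt0.
have sp : s `^ p != 0 by rewrite gt_eqF// powR_gt0.
have h1 : (s * a) `^ (p - 1) <= 1.
  rewrite -(ler_pM2r sa0) (powRB1M _ sa0) mul1r powRM ?(ltW s0) ?(ltW a0)//.
  by rewrite at_ powRN mulrA divff// mul1r.
have h2 : 1 <= (s * a) `^ (p - 1).
  rewrite powRM ?(ltW s0) ?(ltW a0)// -(ler_pM2r s0) mul1r.
  by rewrite mulrAC (powRB1M _ s0).
have : (s * a) `^ (p - 1) == 1 by rewrite eq_le h1.
rewrite powR_eq1 (gt_eqF p10) orbF => /orP[/eqP//|].
by rewrite ltNge (ltW sa0).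
Qed.

(** Optimal scaling: a function of gradient norm [g] multiplied by a / g has the gradient norm [a]
    of the solution. Young's bound is then a^p, and undoing the scaling turns it into a Hoelder
    bound. *)
Lemma holder_scale (m a g t p : R) : 0 < a -> 0 < g ->
  m * (a / g * t) <= a `^ p -> m * t <= a `^ (p - 1) * g.
Proof.
move=> a0 g0; rewrite -(powRB1M _ a0).
have -> : m * (a / g * t) = (m * t / g) * a by ring.
by rewrite ler_pM2r// ler_pdivrMr.
Qed.

Lemma young_weightE (a p : R) : (1 - p^-1) * a + a / p = a.
Proof. by rewrite mulrBl mul1r (mulrC p^-1) subrK. Qed.

Lemma plap_norm_le p g k : `|plap p g k| <= enorm g `^ (p - 1) * enorm k.
Proof.
have [g0|g0] := eqVneq (enorm g) 0.
  by rewrite plapE0// normr0 mulr_ge0 ?powR_ge0 ?enorm_ge0.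
have gp : 0 < enorm g by rewrite lt0r g0 enorm_ge0.
rewrite normrM (ger0_norm (powR_ge0 _ _)) -(powRB2M _ gp) -mulrA.
by rewrite ler_wpM2l ?powR_ge0// normr_dotrV_le.
Qed.

Lemma plap_self p g : 0 < p -> plap p g g = enorm g `^ p.
Proof.
move=> p0; have [g0|g0] := eqVneq (enorm g) 0.
  by rewrite plapE0// g0 powR0// gt_eqF.
have gp : 0 < enorm g by rewrite lt0r g0 enorm_ge0.
by rewrite /plap -enorm_sqr expr2 mulrA (powRB2M _ gp) (powRB1M _ gp).
Qed.

Lemma plapDr p g k h : plap p g (k + h) = plap p g k + plap p g h.
Proof. by rewrite /plap dotrVDr mulrDr. Qed.

Lemma plapZr p g k (a : R) : plap p g (a *: k) = a * plap p g k.
Proof. by rewrite /plap dotrVZr mulrCA. Qed.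

Lemma plap_young p g k : 1 < p ->
  `|plap p g k| <= (1 - p^-1) * enorm g `^ p + enorm k `^ p / p.
Proof.
move=> p1; apply: le_trans (plap_norm_le p g k) _.
by apply: young_powRB1; rewrite ?enorm_ge0.
Qed.

(** Equality must hold in Young's inequality, so the lengths agree, and in Cauchy-Schwarz, so the
    scalar product is the squared length; then |k - g|^2 = 0. *)
Lemma plap_young_eq p g k : 1 < p ->
  plap p g k = (1 - p^-1) * enorm g `^ p + enorm k `^ p / p -> k = g.
Proof.
move=> p1 gk.
have E : enorm g = enorm k.
  apply: (young_powRB1_eq p1); rewrite ?enorm_ge0//; apply/eqP.
  rewrite eq_le young_powRB1 ?enorm_ge0//= -gk.
  exact: le_trans (ler_norm _) (plap_norm_le p g k).
have [g0|g0] := eqVneq (enorm g) 0.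
  by rewrite (enorm_eq0 g0); apply: enorm_eq0; rewrite -E.
have gp : 0 < enorm g by rewrite lt0r g0 enorm_ge0.
have D : dotrV g k = enorm g ^+ 2.
  have : enorm g `^ (p - 2) * dotrV g k = enorm g `^ (p - 2) * enorm g ^+ 2.
    rewrite -/(plap p g k) gk -E expr2 mulrA (powRB2M _ gp) (powRB1M _ gp).
    by rewrite young_weightE.
  by apply: mulfI; rewrite gt_eqF// powR_gt0.
apply/eqP; rewrite -subr_eq0; apply/eqP/enorm_eq0/eqP.
rewrite -sqrf_eq0 enorm_sqr dotrVDl !dotrVDr.
rewrite !dotrVNl !dotrVNr (dotrVC k g) D -!enorm_sqr -E.
by rewrite opprK addNr addr0 subrr.
Qed.

Lemma measurable_plap (D : set 'rV[R]_n) p (G K : 'rV[R]_n -> 'rV[R]_n) :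
  measurable_vec D G -> measurable_vec D K -> measurable_fun D (fun y => plap p (G y) (K y)).
Proof.
move=> mG mK; apply: measurable_funM.
  by apply: (measurableT_comp (measurable_powR (p - 2))); exact: measurable_enorm.
rewrite /dotrV; apply: (@measurable_sum _ _ _ D _ (index_enum 'I_n)
  (fun (i : 'I_n) (y : 'rV[R]_n) => G y 0 i * K y 0 i)) => i.
by apply: measurable_funM; [exact: mG|exact: mK].
Qed.

End plaplacian.

(** * Powers that grow at most linearly in the exponent *)

Section growth.
Context {R : realType}.

Lemma bernoulli_le (d : R) j : 0 <= d -> 1 + j%:R * d <= (1 + d) ^+ j.
Proof.
move=> d0; elim: j => [|j IH]; first by rewrite mul0r addr0 expr0.
rewrite exprSr; apply: le_trans (ler_wpM2r (addr_ge0 ler01 d0) IH).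
rewrite -natr1; have : 0 <= j%:R * d * d :> R by rewrite !mulr_ge0.
by move: (j%:R) => a; nra.
Qed.

(** If |t| = 1 + d with d > 0, squaring Bernoulli's inequality gives |t|^(2j) >= (j d)^2, and
    quadratic growth in [j] defeats the linear bound. *)
Lemma linear_powers_le1 (t B : R) : 0 <= B ->
  (forall j, `|t ^+ (2 * j).+1 + 1| <= 2 * (2 * j).+1%:R * B) -> `|t| <= 1.
Proof.
move=> B0 h; rewrite leNgt; apply/negP => t1.
pose d := `|t| - 1; have d0 : 0 < d by rewrite subr_gt0.
have td : `|t| = 1 + d by rewrite /d addrC subrK.
(* For j >= 1 the bound 2 (2j+1) B + 1 is at most j (6B + 1), so j d^2 > 6B + 1 makes (j d)^2 exceed
   it. *)
pose j := (Num.truncn ((6 * B + 1) / d ^+ 2)).+1.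
have hj : 6 * B + 1 < j%:R * d ^+ 2.
  by rewrite -ltr_pdivrMr ?exprn_gt0// truncnS_gt.
have j1 : 1 <= j%:R :> R by rewrite ler1n.
have h1 : `|t| ^+ (2 * j).+1 <= 2 * (2 * j).+1%:R * B + 1.
  rewrite -normrX -[X in `|X|](addrK 1) (le_trans (ler_normB _ _))// normr1.
  by rewrite lerD2r h.
have h2 : (j%:R * d) ^+ 2 <= `|t| ^+ (2 * j).+1.
  apply: (@le_trans _ _ (`|t| ^+ (2 * j))); last by rewrite ler_weXn2l// ltW.
  rewrite mulnC exprM lerXn2r ?nnegrE ?exprn_ge0// ?mulr_ge0 ?(ltW d0)//.
  rewrite td; apply: le_trans (bernoulli_le j (ltW d0)); lra.
have h3 := le_trans h2 h1; move: h3; rewrite -(natr1 (2 * j)) natrM.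
move: hj j1; move: (j%:R : R) => a; rewrite exprMn; move: (d ^+ 2) => q; nra.
Qed.

End growth.

Section smooth_power.
Context {R : realType} {n : nat}.
Implicit Types (f : 'rV[R]_n -> R) (D : set 'rV[R]_n) (y v : 'rV[R]_n).

Lemma is_derive_comp1 f (k : R -> R) y v (dk : R) : derivable f y v ->
  is_derive (f y) 1 k dk -> is_derive y v (fun y => k (f y)) (dk * 'D_v f y).
Proof.
move=> df dkf.
have df' : derivable f (y + 0 *: v) v by rewrite scale0r addr0.
have h := is_derive_line df'; rewrite scale0r addr0 in h.
have dkf' : is_derive (f (y + 0 *: v)) 1 k dk by rewrite scale0r addr0.
have [h1 h2] := @is_derive1_comp _ k (fun s : R => f (y + s *: v)) _ _ _ dkf' h.
have E : (fun h : R => h^-1 *: (((fun y => k (f y)) \o shift y) (h *: v) - k (f y))) =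
    (fun s : R => s^-1 *: (((k \o (fun s => f (y + s *: v))) \o shift 0) (s *: (1 : R)) -
      (k \o (fun s => f (y + s *: v))) 0)).
  apply/funext => s /=; congr (_ *: (k (f _) - k (f _))).
    by rewrite scaler1 addr0 addrC.
  by rewrite scale0r addr0.
by apply: DeriveDef; [rewrite /derivable E|rewrite /derive E].
Qed.

Lemma is_pderiv_powR f (c b : R) y i : derivable f y (delta_mx 0 i) -> 0 < f y + c ->
  is_derive y (delta_mx 0 i) (fun y => (f y + c) `^ b)
    (b * (f y + c) `^ (b - 1) * pderiv i f y).
Proof.
move=> df fc; apply: (@is_derive_comp1 f (fun t => (t + c) `^ b)) => //.
have h1 : is_derive (f y) 1 (fun t : R => t + c) 1.
  by have := @is_deriveD _ _ _ _ _ _ _ _ _ (is_derive_id (f y) (1 : R)) (is_derive_cst c (f y) (1:R));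
    rewrite addr0.
have := @is_derive1_comp _ (fun t => t `^ b) (fun t => t + c) _ _ _ (is_derive1_powR b fc) h1.
by rewrite mulr1.
Qed.

Lemma smooth_powR f (c b : R) : smooth_on setT f -> (forall y, 0 < f y + c) ->
  smooth_on setT (fun y => (f y + c) `^ b).
Proof.
move=> sf fc.
pose B : set ('rV[R]_n -> R) := [set g | smooth_on setT g \/ exists b, g = fun y => (f y + c) `^ b].
apply: (@smooth_on_salg _ _ B); last by apply: salg_base; right; exists b.
move=> g [sg|[b' ->{g}]].
  split; first exact: smooth_continuous.
  move=> i; split=> [y|]; first exact: smooth_derivable.
  by apply: salg_base; left; exact: smooth_pderiv.
split.
  move=> y; apply: (@continuous_comp _ _ _ (fun y => f y + c) (fun t => t `^ b')).
    apply: continuous_addf; last exact: cst_continuous.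
    exact: smooth_continuous.
  apply/differentiable_continuous/derivable1_diffP.
  by case: (is_derive1_powR b' (fc y)).
move=> i; have H y := is_pderiv_powR b' (@smooth_derivable _ _ _ i y sf) (fc y).
split=> [y|]; first by case: (H y).
rewrite (_ : pderiv i _ = fun y => b' * (f y + c) `^ (b' - 1) * pderiv i f y).
  apply: salg_mul; last by apply: salg_base; left; exact: smooth_pderiv.
  by apply: salg_mul; [exact: salg_cst|apply: salg_base; right; exists (b' - 1)].
by apply/funext => y; rewrite /pderiv (@derive_val _ _ _ _ _ _ _ (H y)).
Qed.

(** Subtracting c^b makes the function vanish wherever [f] does, so that compact support is kept. *)
Lemma test_fun_powRB D f (c b : R) : test_fun D f -> (forall y, 0 < f y + c) ->
  test_fun D (fun y => (f y + c) `^ b - c `^ b).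
Proof.
move=> tf fc; have [sf _ _] := tf.
apply: (test_fun_supp tf); first exact: smooth_add (smooth_powR b sf fc) (smooth_cst _).
by move=> y; apply: contra => /eqP ->; rewrite add0r subrr.
Qed.

Lemma grad_powRB f (c b : R) y : smooth_on setT f -> (forall y, 0 < f y + c) ->
  grad (fun y => (f y + c) `^ b - c `^ b) y = (b * (f y + c) `^ (b - 1)) *: grad f y.
Proof.
move=> sf fc; rewrite gradD; [|exact/smooth_C1/smooth_powR|exact/smooth_C1/smooth_cst].
rewrite grad_cst addr0; apply/rowP => i; rewrite !mxE.
by rewrite {1}/pderiv (@derive_val _ _ _ _ _ _ _ (is_pderiv_powR b (@smooth_derivable _ _ _ i y sf) (fc y))).
Qed.

End smooth_power.

Section powR_lipschitz.
Context {R : realType}.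

Lemma powR_between (lo hi t a : R) : 0 < lo -> lo <= t <= hi -> t `^ a <= lo `^ a + hi `^ a.
Proof.
move=> lo0 /andP[lt th]; have t0 : 0 < t by exact: lt_le_trans lt.
have [a0|a0] := leP 0 a.
  apply: (@le_trans _ _ (hi `^ a)); last by rewrite lerDr powR_ge0.
  by apply: ge0_ler_powR => //; rewrite nnegrE ltW// (lt_le_trans t0).
apply: (@le_trans _ _ (lo `^ a)); last by rewrite lerDl powR_ge0.
rewrite -(opprK a) !(powRN _ (- a)) lef_pV2 ?posrE ?powR_gt0//.
by apply: ge0_ler_powR; rewrite ?nnegrE ?oppr_ge0 ?(ltW a0) ?(ltW lo0) ?(ltW t0).
Qed.

Lemma powR_lipschitz (lo hi a : R) : 0 < lo -> exists2 L : R, 0 <= L &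
  forall s t, lo <= s <= hi -> lo <= t <= hi -> `|s `^ a - t `^ a| <= L * `|s - t|.
Proof.
move=> lo0; exists (`|a| * (lo `^ (a - 1) + hi `^ (a - 1))).
  by rewrite mulr_ge0// addr_ge0// powR_ge0.
move=> s t; wlog st : s t / t <= s => [wl|] hs ht.
  have [ts|/ltW ts] := leP t s; first exact: wl.
  by rewrite distrC (distrC s); exact: wl.
move: hs ht => /andP[ls sh] /andP[lt th].
have pos z : z \in `[t, s] -> 0 < z.
  by rewrite in_itv/= => /andP[tz _]; exact: lt_le_trans (le_trans lt tz).
have d (z : R) : z \in `]t, s[ -> is_derive z 1 (fun z => z `^ a) (a * z `^ (a - 1)).
  move=> zI; apply: is_derive1_powR; apply: pos; exact: subset_itv_oo_cc.
have [|z + ->] := @MVT_segment _ (fun z => z `^ a) _ t s st d.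
  apply: continuous_in_subspaceT => z /set_mem zI.
  apply/differentiable_continuous/derivable1_diffP.
  by case: (is_derive1_powR a (pos _ zI)).
rewrite in_itv/= => /andP[tz zs]; rewrite normrM ler_wpM2r// normrM ler_wpM2l//.
rewrite ger0_norm ?powR_ge0// powR_between// (le_trans lt tz)/=.
exact: le_trans zs sh.
Qed.

End powR_lipschitz.

Section real_inequalities.
Context {R : realType}.

(** Young's inequality for e^(q/p) g / t and q k. Since 0 <= e <= 1 and q >= p, the factor e^(q-1)
    is at most e^(q(p-1)/p), which is what the power [q] of the cutoff is for. Here [e] stands for
    the value of the cutoff, [t] for that of tau, and [g], [k] for the lengths of the gradients of
    the solution and of the cutoff. *)
Lemma caccioppoli_young (p e t g k : R) (q : nat) : 1 < p -> p <= q%:R ->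
  0 <= e <= 1 -> 0 < t -> 0 <= g -> 0 <= k ->
  t `^ (1 - p) * (g `^ (p - 1) * (q%:R * e ^+ q.-1 * k)) <=
  (1 - p^-1) * (e ^+ q * t `^ (- p) * g `^ p) + (q%:R * k) `^ p / p.
Proof.
move=> p1 pq /andP[e0 e1] t0 g0 k0; have p0 : 0 < p by exact: lt_trans p1.
have q1 : (1 < q)%N by rewrite -(ltr_nat R) (lt_le_trans p1).
have qk : 0 <= q%:R * k by rewrite mulr_ge0.
pose a := e `^ (q%:R / p) * (t^-1 * g).
have ti : 0 <= t^-1 by rewrite invr_ge0 ltW.
have tg : 0 <= t^-1 * g by rewrite mulr_ge0.
have a0 : 0 <= a by rewrite mulr_ge0 ?powR_ge0.
have ap : a `^ p = e ^+ q * t `^ (- p) * g `^ p.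
  rewrite powRM ?powR_ge0// powRM// -powRrM divfK ?gt_eqF// powR_mulrn// mulrA.
  by rewrite powR_inv ?(ltW t0)// powRN.
have ap1 : a `^ (p - 1) = e `^ (q%:R / p * (p - 1)) * (t `^ (1 - p) * g `^ (p - 1)).
  rewrite powRM ?powR_ge0// powRM// -powRrM powR_inv ?(ltW t0)//.
  by rewrite -powRN opprB.
rewrite -ap; apply: le_trans (young_powRB1 p1 a0 qk); rewrite ap1.
have -> : t `^ (1 - p) * (g `^ (p - 1) * (q%:R * e ^+ q.-1 * k)) =
  e ^+ q.-1 * (t `^ (1 - p) * g `^ (p - 1)) * (q%:R * k) by ring.
rewrite ler_wpM2r// ler_wpM2r ?mulr_ge0 ?powR_ge0//.
have [->|en0] := eqVneq e 0.
  by rewrite expr0n -subn1 subn_eq0 leqNgt q1 powR_ge0.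
rewrite -powR_mulrn//; apply: ger_powR; first by rewrite lt0r en0 e0.
rewrite mulrBr mulr1 divfK ?gt_eqF// -subn1 natrB ?(ltnW q1)// lerD2l lerN2.
by rewrite ler_pdivlMr// mul1r.
Qed.

(** Converts an oscillation bound for the power -b into a Harnack bound whose constant 2^(1/b) does
    not depend on [e]. *)
Lemma powR_half_le (b t e : R) : 0 < b -> 0 < t -> 0 < e ->
  `|e `^ (- b) - t `^ (- b)| <= e `^ (- b) / 2 -> t <= 2 `^ b^-1 * e.
Proof.
move=> b0 t0 e0; rewrite !powRN ler_norml => /andP[_].
have eb : 0 < e `^ b by exact: powR_gt0.
have tb : 0 < t `^ b by exact: powR_gt0.
have ei : 0 < (e `^ b)^-1 by rewrite invr_gt0.
move=> h; have {}h : (2 * e `^ b)^-1 <= (t `^ b)^-1 by rewrite invfM; lra.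
rewrite lef_pV2 ?posrE ?mulr_gt0// in h.
have tE : t = (t `^ b) `^ b^-1 by rewrite powRK ?gt_eqF ?(ltW t0).
have eE : e = (e `^ b) `^ b^-1 by rewrite powRK ?gt_eqF ?(ltW e0).
rewrite tE [X in _ * X]eE -powRM ?(ltW eb)//.
by apply: ge0_ler_powR => //; rewrite ?nnegrE ?invr_ge0 ?mulr_ge0 ?(ltW b0) ?(ltW tb) ?(ltW eb).
Qed.

End real_inequalities.

(** * W_0^{1,p} as limits of test functions *)

Section sobolev.
Context {R : realType} {n : nat}.
Local Notation mu := (@lebesgue_rV R n).
Implicit Types (f v w phi psi : 'rV[R]_n -> R) (G H K : 'rV[R]_n -> 'rV[R]_n) (P : {poly R}).
Variables (D : set 'rV[R]_n) (p : R).
Hypotheses (n0 : (0 < n)%N) (np : n%:R < p) (oD : open D) (bD : bounded_set D).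

Let p1 : 1 < p. Proof. by rewrite (le_lt_trans _ np)// ler1n. Qed.
Let p0 : 0 < p. Proof. exact: lt_trans p1. Qed.
Let mD : measurable D. Proof. exact: open_rV_measurable. Qed.

Let D8 : (mu D < +oo)%E.
Proof.
have [k Dk] := bounded_sub_cube bD.
apply: (@le_lt_trans _ _ (mu (cube k))); last exact: box_lty.
apply: le_measure; rewrite ?inE//; first exact: measurable_box.
exact: subset_trans (@subset_closure _ _) Dk.
Qed.

Definition holder_cst : R := 2 * n%:R / (1 - n%:R / p).

Lemma holder_exponent_gt0 : 0 < 1 - n%:R / p.
Proof. by rewrite subr_gt0 ltr_pdivrMr// mul1r. Qed.

Lemma holder_cst_gt0 : 0 < holder_cst.
Proof. by rewrite divr_gt0 ?holder_exponent_gt0// mulr_gt0// ltr0n. Qed.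

(** The gradient of a test function vanishes outside [D], so the cube may stick out of [D] while
    only the energy inside is counted. *)
Lemma test_morrey phi c (r e : R) y z (Q := box c (c + const_mx r)) : test_fun D phi ->
  0 < r -> 0 < e -> (energy (Q `&` D) p (grad phi) <= e%:E)%E -> Q y -> Q z ->
  `|phi y - phi z| <= holder_cst * r `^ (1 - n%:R / p) * e `^ p^-1.
Proof.
move=> tphi r0 e0 E Qy Qz.
have C1 : C1fun phi by apply: smooth_C1; case: tphi.
apply: (morrey_cube n0 np r0 e0 C1 _ Qy Qz).
apply: le_trans E; rewrite energyE (@integral_subset0 _ _ _ mu (Q `&` D) Q) => //.
move=> x Qx nD; rewrite (test_fun_grad0 tphi) ?enorm0 ?powR0 ?gt_eqF//.
by move=> Dx; apply: nD.
Qed.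

(** Morrey's inequality in one cube that contains [D] and has its corner [c] outside [D], where
    every test function vanishes. *)
Lemma test_sup_bound : exists2 C, 0 < C & forall phi (e : R) y, test_fun D phi -> 0 < e ->
  (energy D p (grad phi) <= e%:E)%E -> `|phi y| <= C * e `^ p^-1.
Proof.
have [k Dk] := bounded_sub_cube bD.
pose r : R := 2 * k.+1%:R; have r0 : 0 < r by rewrite mulr_gt0// ltr0n.
pose c : 'rV[R]_n := const_mx (- k.+1%:R).
exists (holder_cst * r `^ (1 - n%:R / p)).
  by rewrite mulr_gt0 ?powR_gt0 ?holder_cst_gt0.
move=> phi e y tphi e0 E.
have CQ x : cube k x -> box c (c + const_mx r) x.
  move=> /boxP h; apply/boxP => i; have := h i; rewrite !mxE /r -!natr1; lra.
have ck : ~ D c.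
  move=> /(@subset_closure _ _)/Dk/boxP/(_ (Ordinal n0)); rewrite !mxE -natr1; lra.
have Qc : box c (c + const_mx r) c.
  by apply/boxP => i; rewrite !mxE lexx/= lerDl ltW.
have [Dy|Dy] := pselect (D y); last first.
  rewrite (test_fun0 tphi Dy) normr0 !mulr_ge0 ?powR_ge0//.
  by apply: ltW; rewrite invr_gt0; exact: holder_exponent_gt0.
have := test_morrey tphi r0 e0 _ (CQ _ (Dk _ (subset_closure Dy))) Qc.
rewrite (test_fun0 tphi ck) subr0; apply.
apply: le_trans E; apply: energyS => //.
  by apply: measurableI => //; exact: measurable_box.
exact: measurable_vec_grad tphi.
Qed.

(** [H] is a variable of its own, so that sum, product and chain rules are exact pointwise formulas
    instead of statements up to null sets. Uniform closeness is required on the closure of [D],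
    which makes products and compositions pass to the limit. *)
Definition W0lim v H := measurable_vec D H /\ forall e : R, 0 < e -> exists phi,
  [/\ test_fun D phi, (forall y, closure D y -> `|v y - phi y| <= e) &
      (energy D p (fun y => H y - grad phi y)%R <= e%:E)%E].

(** The calculus rules lose a constant factor and rely on e <= 1, through e^p <= e and through
    bounds on the approximants that do not depend on e. *)
Lemma W0lim_intro (C : R) v H : measurable_vec D H -> (forall e : R, 0 < e <= 1 -> exists phi,
  [/\ test_fun D phi, (forall y, closure D y -> `|v y - phi y| <= C * e) &
      (energy D p (fun y => H y - grad phi y)%R <= (C * e)%:E)%E]) -> W0lim v H.
Proof.
move=> mH h; split=> // e e0.
pose e' := Num.min 1 (e / (`|C| + 1)).
have C1 : 0 < `|C| + 1 by rewrite ltr_wpDl.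
have e'0 : 0 < e' by rewrite lt_min ltr01 divr_gt0.
have [|phi [tphi h1 h2]] := h e'; first by rewrite e'0 ge_min lexx.
have Ce : C * e' <= e.
  apply: (@le_trans _ _ ((`|C| + 1) * e')).
    by rewrite ler_wpM2r ?(ltW e'0)// (le_trans (ler_norm C))// lerDl.
  by rewrite mulrC -ler_pdivlMr// ge_min lexx orbT.
exists phi; split=> //.
  by move=> y Dy; apply: le_trans Ce; exact: h1.
by apply: (le_trans h2); rewrite lee_fin.
Qed.

Lemma W0lim_test phi : test_fun D phi -> W0lim phi (grad phi).
Proof.
move=> tphi; split; first exact: measurable_vec_grad tphi.
move=> e e0; exists phi; split=> //.
  by move=> y _; rewrite subrr normr0 ltW.
rewrite energyE (_ : (fun y => _) = fun=> 0%E); first by rewrite integral0 lee_fin ltW.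
by apply/funext => y; rewrite subrr enorm0 powR0// gt_eqF.
Qed.

Lemma W0lim_energy_lty v H : W0lim v H -> (energy D p H < +oo)%E.
Proof.
move=> [mH /(_ 1 ltr01)[phi [tphi _ E]]].
have mg := measurable_vec_grad (D := D) tphi.
have := energyD mD (ltW p0) (measurable_vecB mH mg) mg.
rewrite (_ : (fun y => _) = H); last by apply/funext => y; rewrite subrK.
move=> /le_lt_trans; apply; apply: lte_mul_pinfty; rewrite ?lee_fin ?powR_ge0//.
apply: lte_add_pinfty; first by apply: (le_lt_trans E); rewrite ltry.
exact: test_grad_energy_lty (ltW p0) tphi.
Qed.

Lemma W0lim_bounded v H : W0lim v H ->
  exists2 M, 0 < M & forall y, closure D y -> `|v y| <= M.
Proof.
move=> [_ /(_ 1 ltr01)[phi [tphi h _]]]; have [M M0 HM] := test_fun_bounded tphi.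
exists (1 + M); first by rewrite ltr_wpDl.
move=> y Dy; rewrite -(subrK (phi y) (v y)) (le_trans (ler_normD _ _))//.
by rewrite lerD// h.
Qed.

Lemma W0lim_near v H y (e : R) : W0lim v H -> closure D y -> 0 < e ->
  \forall x \near y, closure D x -> `|v y - v x| < e.
Proof.
move=> [_ h] Dy e0; have e3 : 0 < e / 4 by rewrite divr_gt0.
have [phi [[sphi _ _] h1 _]] := h _ e3.
have /cvgrPdist_lt/(_ _ e3) : phi x @[x --> y] --> phi y by exact: smooth_continuous.
apply: filterS => x hx Dx.
have := h1 _ Dx; have := h1 _ Dy; move: hx; rewrite ltr_norml !ler_norml => /andP[? ?] /andP[? ?] /andP[? ?].
by rewrite ltr_norml; apply/andP; split; lra.
Qed.

Lemma W0lim_within_continuous v H : W0lim v H -> {within closure D, continuous v}.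
Proof.
move=> vH; apply/subspace_continuousP => y Dy; apply/cvgrPdist_lt => e e0.
by have := W0lim_near vH Dy e0; rewrite near_withinE.
Qed.

Lemma W0lim_measurable v H : W0lim v H -> measurable_fun D v.
Proof.
move=> vH; apply: open_continuous_measurable => // y /set_mem Dy.
apply/(@cvgrPdist_lt _ _ _ (nbhs y)) => e e0.
have := @filterI _ _ (nbhs_filter y) _ _ (open_nbhs_nbhs (conj oD Dy))
  (W0lim_near vH (subset_closure Dy) e0).
by apply: filterS => x [Dx h]; apply: h; exact: subset_closure.
Qed.

Lemma W0lim_boundary v H y : W0lim v H -> (closure D `\` D) y -> v y = 0.
Proof.
move=> [_ h] [Dy nDy]; apply/eqP; rewrite -normr_le0; apply/ler_addgt0Pr => e e0.
have [phi [tphi h1 _]] := h _ e0.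
by have := h1 _ Dy; rewrite (test_fun0 tphi nDy) subr0 add0r.
Qed.

Lemma W0lim_ext v w H : W0lim v H -> (forall y, closure D y -> w y = v y) -> W0lim w H.
Proof.
move=> [mH h] wv; split=> // e e0; have [phi [tphi h1 h2]] := h _ e0.
by exists phi; split=> // y Dy; rewrite wv// h1.
Qed.

Lemma W0limD v w H K : W0lim v H -> W0lim w K ->
  W0lim (fun y => v y + w y) (fun y => H y + K y).
Proof.
move=> [mH hv] [mK hw].
apply: (@W0lim_intro (2 + 2 `^ p * 2)); first exact: measurable_vecD.
move=> e /andP[e0 e1]; have [phi [tphi h1 h2]] := hv _ e0; have [psi [tpsi h3 h4]] := hw _ e0.
have ph : 0 <= 2 `^ p :> R by exact: powR_ge0.
exists (fun y => phi y + psi y); split; first exact: test_funD.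
  move=> y Dy; rewrite opprD addrACA (le_trans (ler_normD _ _))//.
  apply: (@le_trans _ _ (e + e)); first by rewrite lerD ?h1 ?h3.
  by rewrite mulrDl -mulr2n mulr_natl lerDl mulr_ge0 ?mulr_ge0// ltW.
have [Cphi Cpsi] : C1fun phi /\ C1fun psi.
  by split; apply: smooth_C1; [case: tphi|case: tpsi].
rewrite (_ : (fun y => _) = (fun y => (H y - grad phi y) + (K y - grad psi y))); last first.
  by apply/funext => y; rewrite gradD// opprD addrACA.
apply: le_trans (energyD mD (ltW p0) (measurable_vecB mH _) (measurable_vecB mK _)) _.
- exact: measurable_vec_grad tphi.
- exact: measurable_vec_grad tpsi.
apply: (@le_trans _ _ ((2 `^ p)%:E * (e%:E + e%:E))%E).
  by apply: lee_wpmul2l; [rewrite lee_fin|exact: leeD].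
rewrite -EFinD -EFinM lee_fin.
have -> : (2 + 2 `^ p * 2) * e = 2 * e + 2 `^ p * (e + e) by ring.
by rewrite lerDr mulr_ge0// ltW.
Qed.

Lemma W0lim_mul v w H K : W0lim v H -> W0lim w K ->
  W0lim (fun y => v y * w y) (fun y => v y *: K y + w y *: H y).
Proof.
move=> vH wK; have [mH hv] := vH; have [mK hw] := wK.
have mv := W0lim_measurable vH; have mw := W0lim_measurable wK.
have [M M0 HM] := W0lim_bounded vH; have [M' M'0 HM'] := W0lim_bounded wK.
have EH := W0lim_energy_lty vH; have EK := W0lim_energy_lty wK.
have ph : 0 <= 2 `^ p :> R by exact: powR_ge0.
pose EHr := fine (energy D p H); pose EKr := fine (energy D p K).
have EHE : energy D p H = EHr%:E by rewrite fineK// ge0_fin_numE// energy_ge0.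
have EKE : energy D p K = EKr%:E by rewrite fineK// ge0_fin_numE// energy_ge0.
have EH0 : 0 <= EHr by rewrite fine_ge0// energy_ge0.
have EK0 : 0 <= EKr by rewrite fine_ge0// energy_ge0.
pose C1 := (M + 1) `^ p; pose C2 := (M' + 1) `^ p.
have C10 : 0 <= C1 by exact: powR_ge0.
have C20 : 0 <= C2 by exact: powR_ge0.
pose E := 2 `^ p * (2 `^ p * (C1 + EKr) + 2 `^ p * (C2 + EHr)).
have E0 : 0 <= E by apply: mulr_ge0 => //; apply: addr_ge0; apply: mulr_ge0 => //; exact: addr_ge0.
apply: (@W0lim_intro ((M + 1 + M') + E)).
  by apply: measurable_vecD; exact: measurable_vecZ.
move=> e /andP[e0 e1]; have [phi [tphi h1 h2]] := hv _ e0; have [psi [tpsi h3 h4]] := hw _ e0.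
have sphi : smooth_on setT phi by case: tphi.
have spsi : smooth_on setT psi by case: tpsi.
have bphi y : closure D y -> `|phi y| <= M + 1.
  move=> Dy; rewrite -(subKr (v y) (phi y)) (le_trans (ler_normB _ _))//.
  by rewrite lerD ?HM// (le_trans (h1 _ Dy)).
have bpsi y : closure D y -> `|psi y| <= M' + 1.
  move=> Dy; rewrite -(subKr (w y) (psi y)) (le_trans (ler_normB _ _))//.
  by rewrite lerD ?HM'// (le_trans (h3 _ Dy)).
exists (fun y => phi y * psi y); split; first exact: test_funM.
  move=> y Dy.
  have -> : v y * w y - phi y * psi y = (v y - phi y) * w y + phi y * (w y - psi y) by ring.
  rewrite (le_trans (ler_normD _ _))// !normrM.
  apply: (@le_trans _ _ (e * M' + (M + 1) * e)).
    by rewrite lerD// ler_pM ?h1 ?h3 ?HM' ?bphi.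
  have -> : (M + 1 + M' + E) * e = e * M' + (M + 1) * e + E * e by ring.
  by rewrite lerDl mulr_ge0// ltW.
have mphi : measurable_fun D phi := test_fun_measurable tphi.
have mpsi : measurable_fun D psi := test_fun_measurable tpsi.
have mgphi := measurable_vec_grad (D := D) tphi.
have mgpsi := measurable_vec_grad (D := D) tpsi.
(* The error is split into bounded factors times small fields and uniformly small factors times
   fields of finite energy. *)
have eqn : (fun y => v y *: K y + w y *: H y - grad (fun y => phi y * psi y) y) =
   (fun y => (phi y *: (K y - grad psi y) + (v y - phi y) *: K y) +
     (psi y *: (H y - grad phi y) + (w y - psi y) *: H y)).
  apply/funext => y; rewrite gradM; [|exact: smooth_C1|exact: smooth_C1].
  by apply/rowP => i; rewrite !mxE; ring.
rewrite eqn.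
have m1 := measurable_vecZ mphi (measurable_vecB mK mgpsi).
have m2 := measurable_vecZ (measurable_funB mv mphi) mK.
have m3 := measurable_vecZ mpsi (measurable_vecB mH mgphi).
have m4 := measurable_vecZ (measurable_funB mw mpsi) mH.
have ep : e `^ p <= e by apply: ge1r_powR; [rewrite e0|exact: ltW].
have t1 : (energy D p (fun y => phi y *: (K y - grad psi y))%R <= (C1 * e)%:E)%E.
  apply: (le_trans (energyZ mD (ltW p0) _ mphi (measurable_vecB mK mgpsi)
    (fun y Dy => bphi y (subset_closure Dy)))); first by rewrite addr_ge0// ltW.
  by rewrite EFinM; apply: lee_wpmul2l; rewrite ?lee_fin.
have t2 : (energy D p (fun y => (v y - phi y) *: K y)%R <= (EKr * e)%:E)%E.
  apply: (le_trans (energyZ mD (ltW p0) (ltW e0) (measurable_funB mv mphi) mK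
    (fun y Dy => h1 y (subset_closure Dy)))).
  by rewrite EKE -EFinM lee_fin mulrC ler_wpM2l.
have t3 : (energy D p (fun y => psi y *: (H y - grad phi y))%R <= (C2 * e)%:E)%E.
  apply: (le_trans (energyZ mD (ltW p0) _ mpsi (measurable_vecB mH mgphi)
    (fun y Dy => bpsi y (subset_closure Dy)))); first by rewrite addr_ge0// ltW.
  by rewrite EFinM; apply: lee_wpmul2l; rewrite ?lee_fin.
have t4 : (energy D p (fun y => (w y - psi y) *: H y)%R <= (EHr * e)%:E)%E.
  apply: (le_trans (energyZ mD (ltW p0) (ltW e0) (measurable_funB mw mpsi) mH
    (fun y Dy => h3 y (subset_closure Dy)))).
  by rewrite EHE -EFinM lee_fin mulrC ler_wpM2l.
apply: (le_trans (energyD mD (ltW p0) (measurable_vecD m1 m2) (measurable_vecD m3 m4))).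
apply: (@le_trans _ _ (2 `^ p * (2 `^ p * (C1 * e + EKr * e) + 2 `^ p * (C2 * e + EHr * e)))%:E).
  rewrite EFinM; apply: lee_wpmul2l; first by rewrite lee_fin.
  rewrite EFinD; apply: leeD.
    apply: (le_trans (energyD mD (ltW p0) m1 m2)).
    by rewrite EFinM; apply: lee_wpmul2l; [rewrite lee_fin|rewrite EFinD; exact: leeD].
  apply: (le_trans (energyD mD (ltW p0) m3 m4)).
  by rewrite EFinM; apply: lee_wpmul2l; [rewrite lee_fin|rewrite EFinD; exact: leeD].
rewrite lee_fin.
have -> : 2 `^ p * (2 `^ p * (C1 * e + EKr * e) + 2 `^ p * (C2 * e + EHr * e)) = E * e.
  by rewrite /E; ring.
by rewrite mulrDl lerDr mulr_ge0 ?(ltW e0)// !addr_ge0// ltW.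
Qed.

Lemma W0limZ (k : R) v H : W0lim v H -> W0lim (fun y => k * v y) (fun y => k *: H y).
Proof.
move=> [mH hv].
apply: (@W0lim_intro (`|k| + `|k| `^ p)); first exact: measurable_vecZ.
move=> e /andP[e0 e1]; have [phi [tphi h1 h2]] := hv _ e0.
exists (fun y => k * phi y); split; first exact: test_funZ.
  move=> y Dy; rewrite -mulrBr normrM.
  apply: (@le_trans _ _ (`|k| * e)); first by rewrite ler_wpM2l// h1.
  by rewrite mulrDl lerDl mulr_ge0 ?powR_ge0// ltW.
rewrite (_ : (fun y => _) = (fun y => k *: (H y - grad phi y))); last first.
  by apply/funext => y; rewrite gradZ ?scalerBr//; apply: smooth_C1; case: tphi.
apply: (le_trans (energyZ mD (ltW p0) (normr_ge0 k) (@measurable_cst _ _ _ _ _ k)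
  (measurable_vecB mH (measurable_vec_grad tphi)) (fun _ _ => lexx _))).
apply: (@le_trans _ _ (`|k| `^ p * e)%:E).
  by rewrite EFinM; apply: lee_wpmul2l; rewrite ?lee_fin ?powR_ge0.
by rewrite lee_fin mulrDl lerDr mulr_ge0// ltW.
Qed.

Lemma W0lim_morrey v H c (r e : R) y z (Q := box c (c + const_mx r)) : W0lim v H ->
  0 < r -> 0 < e -> (energy (Q `&` D) p H <= e%:E)%E ->
  Q y -> Q z -> closure D y -> closure D z ->
  `|v y - v z| <= holder_cst * r `^ (1 - n%:R / p) * (2 `^ p * (e + e)) `^ p^-1.
Proof.
move=> [mH hv] r0 e0 E Qy Qz Dy Dz; apply/ler_addgt0Pr => d d0.
pose e' := Num.min e (d / 2).
have e'0 : 0 < e' by rewrite lt_min e0 divr_gt0.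
have e'e : e' <= e by rewrite ge_min lexx.
have e'd : e' <= d / 2 by rewrite ge_min lexx orbT.
have [phi [tphi h1 h2]] := hv _ e'0.
have mg := measurable_vec_grad (D := D) tphi.
have mQD : measurable (Q `&` D) by apply: measurableI => //; exact: measurable_box.
have QDD : Q `&` D `<=` D by exact: subIsetr.
have mS G : measurable_vec D G -> measurable_vec (Q `&` D) G.
  by move=> mG i; apply: measurable_funS (mG i).
have E' : (energy (Q `&` D) p (grad phi) <= (2 `^ p * (e + e))%:E)%E.
  apply: (energy_le_sub mQD (ltW p0) (mS _ mg) (mS _ mH) E).
  apply: (le_trans (energyS p mD mQD QDD (measurable_vecB mH mg))).
  by apply: (le_trans h2); rewrite lee_fin.
have e2 : 0 < 2 `^ p * (e + e) by rewrite mulr_gt0 ?powR_gt0 ?addr_gt0.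
have := test_morrey tphi r0 e2 E' Qy Qz.
have := h1 _ Dy; have := h1 _ Dz.
rewrite !ler_norml => /andP[? ?] /andP[? ?] /andP[? ?]; apply/andP; split; lra.
Qed.

(** Turns small energy into smallness in L^1: integrated over [D], an energy at most d^p gives an
    integral at most d (|D| + 1). *)
Lemma le_young_scaled (d x : R) : 0 < d -> 0 <= x -> x <= d + d / d `^ p * x `^ p.
Proof.
move=> d0 x0; have dp : 0 < d `^ p by exact: powR_gt0.
have := powR_dominated (ltW p1) (divr_ge0 x0 (ltW d0)).
rewrite powRM ?invr_ge0 ?(ltW d0)// powR_inv ?(ltW d0)//.
rewrite -(ler_pM2l d0) mulrCA divff ?gt_eqF// mulr1 => h.
by apply: (le_trans h); rewrite mulrDr mulr1 lerD2l mulrCA (mulrC (x `^ p)).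
Qed.

(** Integration by parts for the approximating test functions passes to the limit: the defect
    [A + B] is the sum of two integrals, controlled by v - phi and by H - grad phi. *)
Lemma W0lim_is_wgrad v H : W0lim v H -> is_wgrad D v H.
Proof.
move=> vH; have [mH hv] := vH.
have mv : measurable_fun D v := W0lim_measurable vH.
have [M M0 HM] := W0lim_bounded vH.
have EH := W0lim_energy_lty vH.
have iv : mu.-integrable D (EFin \o v).
  by apply: (bounded_integrable mD D8 mv) => y Dy; apply: HM; exact: subset_closure.
have iH i : mu.-integrable D (EFin \o (fun y => H y 0 i)).
  exact: energy_coord_integrable mD D8 (ltW p1) mH EH.
have lv : loc_integrable D v.
  by move=> K cK KD; apply: (integrableS mD) iv => //; exact: compact_rV_measurable.
have lH i : loc_integrable D (fun y => H y 0 i).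
  by move=> K cK KD; apply: (integrableS mD) (iH i) => //; exact: compact_rV_measurable.
split=> // psi i tpsi.
have tdpsi := test_fun_pderiv i tpsi.
have [M1 M10 HM1] := test_fun_bounded tdpsi; have [M2 M20 HM2] := test_fun_bounded tpsi.
have mpsi : measurable_fun D psi := test_fun_measurable tpsi.
have mdpsi : measurable_fun D (pderiv i psi).
  exact: test_fun_measurable tdpsi.
have iM (f g : 'rV[R]_n -> R) (B : R) : mu.-integrable D (EFin \o f) -> measurable_fun D g -> (forall y, `|g y| <= B) ->
    mu.-integrable D (EFin \o (fun y => f y * g y)).
  move=> fi mg gB; apply: (@le_integrableR _ _ _ _ _ mD _ (fun y => B * `|f y|)).
  - by apply: measurable_funM => //; exact: integrable_measurable fi.
  - by move=> y _; rewrite normrM mulrC ler_wpM2r.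
  - by apply: integrableRZ => //; exact: (integrable_abse fi).
set A := \int[mu]_(y in D) _; set B := \int[mu]_(y in D) _.
pose m := fine (mu D).
have m0 : 0 <= m by exact: fine_ge0.
have key (d : R) : 0 < d <= 1 -> `|A + B| <= d * (M1 * m + M2 * (m + 1)).
  move=> /andP[d0 d1]; have dp : 0 < d `^ p by exact: powR_gt0.
  (* [d] for the uniform distance, d^p for the energy, as the scaled Young inequality requires. *)
  pose e := Num.min d (d `^ p).
  have e0 : 0 < e by rewrite lt_min d0.
  have [phi [tphi h1 h2]] := hv _ e0.
  have tdphi := test_fun_pderiv i tphi.
  have mphi : measurable_fun D phi := test_fun_measurable tphi.
  have iphi : mu.-integrable D (EFin \o phi).
    by apply: (integrableS measurableT) (test_fun_integrable tphi).
  have idphi : mu.-integrable D (EFin \o pderiv i phi).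
    by apply: (integrableS measurableT) (test_fun_integrable tdphi).
  have ibp := integration_by_parts_test i oD tphi tpsi.
  have E : A + B = \int[mu]_(y in D) ((v y - phi y) * pderiv i psi y) +
                   \int[mu]_(y in D) ((H y 0 i - pderiv i phi y) * psi y).
    under [X in _ = X + _]eq_Rintegral do rewrite mulrBl.
    under [X in _ = _ + X]eq_Rintegral do rewrite mulrBl.
    rewrite RintegralB//; [|exact: iM HM1|exact: iM HM1].
    rewrite RintegralB//; [|exact: iM HM2|exact: iM HM2].
    by rewrite ibp opprK -/A -/B; ring.
  have b1 : `|\int[mu]_(y in D) ((v y - phi y) * pderiv i psi y)| <= d * (M1 * m).
    apply: (@le_trans _ _ (\int[mu]_(y in D) (d * M1))).
      apply: abs_Rintegral_le => //.
      - by apply: measurable_funM => //; exact: measurable_funB.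
      - exact: cst_integrable.
      - move=> y Dy; rewrite normrM ler_pM//.
        by apply: (le_trans (h1 _ (subset_closure Dy))); rewrite ge_min lexx.
    by rewrite Rintegral_cst// mulrA.
  have mHg := measurable_vecB mH (measurable_vec_grad (D := D) tphi).
  have Elty : (energy D p (fun y => H y - grad phi y)%R < +oo)%E by apply: (le_lt_trans h2); rewrite ltry.
  have iE := energy_integrable mHg Elty.
  have b2 : `|\int[mu]_(y in D) ((H y 0 i - pderiv i phi y) * psi y)| <= d * (M2 * (m + 1)).
    apply: (@le_trans _ _ (\int[mu]_(y in D)
       (M2 * (d + d / d `^ p * enorm (H y - grad phi y) `^ p)))).
      apply: abs_Rintegral_le => //.
      - apply: measurable_funM => //; apply: measurable_funB => //.
        exact: integrable_measurable idphi.
      - apply: integrableRZ => //; apply: integrableRD => //; first exact: cst_integrable.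
        exact: integrableRZ.
      - move=> y Dy; rewrite normrM mulrC ler_pM//.
        apply: le_trans (le_young_scaled d0 (enorm_ge0 _)).
        by apply: le_trans (coord_le_enorm _ i); rewrite !mxE.
    rewrite RintegralZl//; last first.
      by apply: integrableRD => //; [exact: cst_integrable|exact: integrableRZ].
    rewrite mulrCA ler_pM2l// RintegralD//; [|exact: cst_integrable|exact: integrableRZ].
    rewrite Rintegral_cst// RintegralZl// mulrDr lerD2l mulr1 -mulrA ler_piMr ?(ltW d0)//.
    rewrite mulrC ler_pdivrMr// mul1r -lee_fin Rintegral_EFin//.
    rewrite energyE in h2; apply: (le_trans h2).
    by rewrite lee_fin ge_min lexx orbT.
  rewrite E (le_trans (ler_normD _ _))//.
  by rewrite mulrDr; exact: lerD.
have : `|A + B| <= 0.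
  apply/ler_addgt0Pr => e e0; rewrite add0r.
  pose C := M1 * m + M2 * (m + 1).
  have C0 : 0 <= C by rewrite addr_ge0// mulr_ge0 ?addr_ge0// ltW.
  have C1 : 0 < C + 1 by rewrite ltr_wpDl.
  apply: (le_trans (key (Num.min 1 (e / (C + 1))) _)).
    by rewrite lt_min ltr01 divr_gt0//= ge_min lexx.
  apply: (@le_trans _ _ (e / (C + 1) * C)).
    by rewrite ler_wpM2r// ge_min lexx orbT.
  by rewrite mulrAC ler_pdivrMr// ler_wpM2l ?(ltW e0)// lerDl.
by rewrite normr_le0 addr_eq0 => /eqP.
Qed.

Lemma W0lim_wgrad_ae v H : W0lim v H -> {ae mu, forall y, D y -> wgrad D v y = H y}.
Proof.
move=> vH; have wH := W0lim_is_wgrad vH.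
exact: (is_wgrad_unique oD (is_wgrad_wgrad (ex_intro _ H wH)) wH).
Qed.

Lemma wgrad_measurable v : (exists G, is_wgrad D v G) -> measurable_vec D (wgrad D v).
Proof.
move=> /is_wgrad_wgrad[_ lG _] i; exact: loc_integrable_measurable.
Qed.

Lemma W0lim_W01p v H : W0lim v H -> W01p D p v.
Proof.
move=> vH; have [mH hv] := vH; have p0' : p != 0 by rewrite gt_eqF.
have wH := W0lim_is_wgrad vH.
have mw : measurable_vec D (wgrad D v) by apply: wgrad_measurable; exists H.
have ae := W0lim_wgrad_ae vH.
have mv : measurable_fun D v := W0lim_measurable vH.
have [M M0 HM] := W0lim_bounded vH.
split.
- exact: W0lim_within_continuous vH.
- split.
  + split=> //; rewrite LqnormE_pow//; apply/poweR_lty_iff => //.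
      by apply: integral_ge0 => y _; rewrite lee_fin powR_ge0.
    have : mu.-integrable D (EFin \o (fun y => `|v y| `^ p)).
      apply: (@bounded_integrable _ _ _ _ (M `^ p)) => //.
        by apply: (measurableT_comp (measurable_powR p)); exact: measurableT_comp.
      move=> y Dy; rewrite ger0_norm ?powR_ge0//; apply: ge0_ler_powR; rewrite ?nnegrE ?(ltW p0) ?(ltW M0)//.
      by apply: HM; exact: subset_closure.
    move=> /integrable_lty; exact.
  + by exists H.
  + move=> i; split; first exact: mw.
    rewrite LqnormE_pow//; apply/poweR_lty_iff => //.
      by apply: integral_ge0 => y _; rewrite lee_fin powR_ge0.
    apply: (@le_lt_trans _ _ (energy D p (wgrad D v))); last first.
      by rewrite (ae_eq_energy p mD mw mH ae); exact: W0lim_energy_lty vH.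
    rewrite energyE; apply: ge0_le_integral => //.
    * apply/measurable_EFinP; apply: (measurableT_comp (measurable_powR p)); exact: measurableT_comp.
    * by apply/measurable_EFinP; exact: measurable_energy_fun.
    * move=> y Dy; rewrite lee_fin; apply: ge0_ler_powR; rewrite ?nnegrE ?enorm_ge0 ?(ltW p0)//.
      exact: coord_le_enorm.
- move=> e e0; have ep : 0 < e `^ p by exact: powR_gt0.
  pose m := fine (mu D).
  have m0 : 0 <= m by exact: fine_ge0.
  (* The first entry brings the energy strictly below e^p, the second makes e1 |D|^(1/p) smaller
     than e. *)
  pose e1 := Num.min (e `^ p / 2) (e / (2 * (1 + m `^ p^-1))).
  have mp : 0 < 1 + m `^ p^-1 by rewrite ltr_pwDl// powR_ge0.
  have e10 : 0 < e1 by rewrite lt_min !divr_gt0// mulr_gt0.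
  have [phi [tphi h1 h2]] := hv _ e10; exists phi; split=> //.
    rewrite LqnormE_pow//; apply/poweR_lt_fin => //.
      by apply: integral_ge0 => y _; rewrite lee_fin powR_ge0.
    apply: (@le_lt_trans _ _ (\int[mu]_(y in D) (e1 `^ p)%:E)%E).
      apply: ge0_le_integral => //.
      * apply/measurable_EFinP; apply: (measurableT_comp (measurable_powR p)).
        apply: measurableT_comp => //; apply: measurable_funB => //.
        exact: test_fun_measurable tphi.
      * move=> y Dy; rewrite lee_fin; apply: ge0_ler_powR; rewrite ?nnegrE ?(ltW p0) ?(ltW e10)//.
        by apply: h1; exact: subset_closure.
    have muE : mu D = m%:E by rewrite fineK// ge0_fin_numE.
    rewrite (integral_cst_fin _ mD muE) lte_fin.
    rewrite -[in ltLHS](powRVK p0' m0).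
    rewrite -powRM ?powR_ge0 ?(ltW e10)//; apply: gt0_ltr_powR; rewrite ?nnegrE ?mulr_ge0 ?powR_ge0 ?(ltW e10) ?(ltW e0)//.
    apply: (@le_lt_trans _ _ (e / (2 * (1 + m `^ p^-1)) * m `^ p^-1)).
      by rewrite ler_wpM2r ?powR_ge0// ge_min lexx orbT.
    rewrite mulrAC ltr_pdivrMr ?mulr_gt0// ltr_pM2l//.
    have := powR_ge0 m p^-1; lra.
  rewrite (LqnormE_enorm _ (fun y => wgrad D v y - grad phi y))//; apply/poweR_lt_fin => //.
    exact: energy_ge0.
  have mg := measurable_vec_grad (D := D) tphi.
  rewrite (ae_eq_energy p mD (measurable_vecB mw mg) (measurable_vecB mH mg)); last first.
    by apply: filterS ae => y h Dy; rewrite h.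
  apply: (le_lt_trans h2); rewrite lte_fin.
  apply: (@le_lt_trans _ _ (e `^ p / 2)); first by rewrite ge_min lexx.
  by rewrite ltr_pdivrMr// ltr_pMr//; lra.
Qed.

(** The definition only provides closeness in the Sobolev norm. Two good approximants phi and psi
    differ uniformly by at most eta / 2, by the sup bound for test functions. If |v - phi| > eta at
    a point of [D], then |v - psi| >= eta / 2 on a neighbourhood [U] that does not depend on psi,
    against the L^p closeness of psi. Continuity extends the estimate to the closure. *)
Lemma W01p_W0lim v : W01p D p v -> W0lim v (wgrad D v).
Proof.
move=> [cv [[mv _] exG hG] happ]; have p0' : p != 0 by rewrite gt_eqF.
have mw : measurable_vec D (wgrad D v) by exact: wgrad_measurable.
split=> // eta eta0.
have [C C0 HC] := test_sup_bound.
(* Chosen so that an energy of at most 2^p (e0 + e0), the bound for the difference of two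
   approximants, keeps a test function below eta / 2. *)
pose q := (eta / 2 / C) `^ p / (2 `^ p * 2).
have q0 : 0 < q by rewrite divr_gt0 ?powR_gt0 ?divr_gt0 ?mulr_gt0 ?powR_gt0.
pose e0 := Num.min eta q.
have e00 : 0 < e0 by rewrite lt_min eta0.
have he0 : C * (2 `^ p * (e0 + e0)) `^ p^-1 <= eta / 2.
  rewrite -ler_pdivlMl//.
  have -> : C^-1 * (eta / 2) = ((eta / 2 / C) `^ p) `^ p^-1.
    rewrite powRK//; first by rewrite mulrC.
    exact: (divr_ge0 (divr_ge0 (ltW eta0) (ler0n _ 2)) (ltW C0)).
  apply: ge0_ler_powR; rewrite ?nnegrE ?invr_ge0 ?(ltW p0) ?powR_ge0//.
    by rewrite mulr_ge0 ?powR_ge0// addr_ge0// ltW.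
  have : e0 <= q by rewrite ge_min lexx orbT.
  rewrite /q ler_pdivlMr ?mulr_gt0 ?powR_gt0// => h; apply: le_trans h.
  by rewrite le_eqVlt; apply/orP; left; apply/eqP; ring.
pose e1 := e0 `^ p^-1.
have e10 : 0 < e1 by exact: powR_gt0.
have e1p : e1 `^ p = e0 by rewrite powRVK ?(ltW e00).
have appE e phi : 0 < e -> e <= e1 -> test_fun D phi ->
    (LqnormE D p%:E (fun y => enorm (wgrad D v y - grad phi y)) < e%:E)%E ->
    (energy D p (fun y => wgrad D v y - grad phi y)%R <= e0%:E)%E.
  move=> e_gt0 ee1 tphi; rewrite (LqnormE_enorm _ (fun y => wgrad D v y - grad phi y))//.
  move=> /poweR_lt_fin => /(_ p0 e_gt0 (energy_ge0 _ _ _)) => h.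
  apply: (le_trans (ltW h)); rewrite lee_fin -e1p; apply: ge0_ler_powR; rewrite ?nnegrE ?(ltW p0)//; exact: ltW.
have [phi [tphi _ hphi]] := happ _ e10.
have Ephi := appE _ _ e10 (lexx _) tphi hphi.
exists phi; split=> //; last by apply: (le_trans Ephi); rewrite lee_fin ge_min lexx.
have close psi : test_fun D psi -> (energy D p (fun y => wgrad D v y - grad psi y)%R <= e0%:E)%E ->
    forall y, `|phi y - psi y| <= eta / 2.
  move=> tpsi Epsi y; apply: le_trans he0.
  have tN := test_funZ (-1) tpsi.
  have -> : phi y - psi y = phi y + -1 * psi y by rewrite mulN1r.
  apply: (HC (fun y => phi y + -1 * psi y)) (test_funD tphi tN) _ _.
    by rewrite mulr_gt0 ?powR_gt0// addr_gt0.
  have mphi := measurable_vec_grad (D := D) tphi.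
  have mpsi := measurable_vec_grad (D := D) tpsi.
  have mNphi : measurable_vec D (fun y => - (wgrad D v y - grad phi y)).
    rewrite (_ : (fun y => _) = (fun y => grad phi y - wgrad D v y)); first exact: measurable_vecB.
    by apply/funext => z; rewrite opprB.
  have -> : grad (fun y => phi y + -1 * psi y) =
      fun y => - (wgrad D v y - grad phi y) + (wgrad D v y - grad psi y).
    have Cphi : C1fun phi by apply: smooth_C1; case: tphi.
    have Cpsi : C1fun psi by apply: smooth_C1; case: tpsi.
    have CN : C1fun (fun y => -1 * psi y) by apply: smooth_C1; case: tN.
    apply/funext => z; rewrite gradD// gradZ// scaleN1r opprB.
    by rewrite addrA subrK.
  apply: (le_trans (energyD mD (ltW p0) mNphi (measurable_vecB mw mpsi))).
  rewrite EFinM EFinD; apply: lee_wpmul2l; first by rewrite lee_fin powR_ge0.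
  by apply: leeD => //; rewrite energyN.
have inD y : D y -> `|v y - phi y| <= eta.
  move=> Dy; rewrite leNgt; apply/negP => hy.
  have cvy : {for y, continuous v}.
    move/subspace_continuousP/(_ _ (subset_closure Dy)) : cv => h.
    apply/(@cvgrPdist_lt _ _ _ (nbhs y)) => e e_gt0; move/cvgrPdist_lt/(_ _ e_gt0) : h => h.
    have := @filterI _ _ (nbhs_filter y) _ _ (open_nbhs_nbhs (conj oD Dy)) h.
    by apply: (@filterS _ _ (nbhs_filter y)) => x [Dx]; apply; exact: subset_closure.
  have cd : {for y, continuous (fun x => `|v x - phi x|)}.
    apply: (@continuous_comp _ _ _ (fun x => v x - phi x)); last exact: norm_continuous.
    apply: (@continuousB _ _ _ v phi) => //; apply: smooth_continuous; by case: tphi.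
  have : nbhs y [set x | D x /\ eta < `|v x - phi x|].
    apply: (@filterI _ _ (nbhs_filter y)); first exact: open_nbhs_nbhs.
    exact: (cvgr_gt _ cd).
  rewrite nbhsE => -[U [oU Uy] US].
  have mU : measurable U by exact: open_rV_measurable.
  have muU := open_measure_gt0 oU Uy.
  have muU8 : (mu U < +oo)%E.
    by apply: (le_lt_trans _ D8); apply: le_measure; rewrite ?inE// => z /US[].
  pose m := fine (mu U).
  have m0 : 0 < m by apply: fine_gt0; rewrite muU.
  have muE : mu U = m%:E by rewrite fineK// ge0_fin_numE// ltW.
  (* The tolerance is fixed after [U]: a function at least eta / 2 on [U] has L^p norm at least eta
     / 2 times |U|^(1/p). *)
  pose e2 := Num.min e1 (eta / 2 * m `^ p^-1).
  have e20 : 0 < e2 by rewrite lt_min e10 mulr_gt0 ?divr_gt0 ?powR_gt0.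
  have [psi [tpsi hpsi1 hpsi2]] := happ _ e20.
  have e2e1 : e2 <= e1 by rewrite ge_min lexx.
  have cl := close _ tpsi (appE _ _ e20 e2e1 tpsi hpsi2).
  move: hpsi1; rewrite LqnormE_pow// => /poweR_lt_fin => /(_ p0 e20).
  have i0 : (0 <= \int[mu]_(y in D) (`|v y - psi y| `^ p)%:E)%E.
    by apply: integral_ge0 => z _; rewrite lee_fin powR_ge0.
  move=> /(_ i0); apply/negP; rewrite -leNgt.
  have mvp : measurable_fun D (fun y => (`|v y - psi y| `^ p)%:E).
    apply/measurable_EFinP; apply: (measurableT_comp (measurable_powR p)).
    apply: measurableT_comp => //; apply: measurable_funB => //.
    exact: test_fun_measurable tpsi.
  apply: (@le_trans _ _ (\int[mu]_(y in U) (`|v y - psi y| `^ p)%:E)%E); last first.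
    apply: ge0_subset_integral => //; last by move=> z /US[].
  apply: (@le_trans _ _ (\int[mu]_(y in U) ((eta / 2) `^ p)%:E)%E).
    rewrite (integral_cst_fin _ mU muE) lee_fin.
    rewrite -[in leRHS](powRVK p0' (ltW m0)).
    rewrite -powRM ?powR_ge0 ?divr_ge0 ?(ltW eta0)//; apply: ge0_ler_powR;
      rewrite ?nnegrE ?mulr_ge0 ?powR_ge0 ?divr_ge0 ?(ltW eta0) ?(ltW e20) ?(ltW p0)//.
    by rewrite /e2 ge_min lexx orbT.
  apply: ge0_le_integral => //.
  - by move=> z _; rewrite lee_fin powR_ge0.
  - by apply: measurable_funS mvp => // z /US[].
  - move=> z Uz; rewrite lee_fin; apply: ge0_ler_powR; rewrite ?nnegrE ?divr_ge0 ?(ltW eta0) ?(ltW p0)//.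
    have [_ hz] := US _ Uz; have := cl z.
    have := ler_normD (v z - psi z) (psi z - phi z); rewrite addrA subrK (distrC (psi z)).
    by lra.
move=> y Dy; rewrite leNgt; apply/negP => hy.
pose d := (`|v y - phi y| - eta) / 4.
have d0 : 0 < d by rewrite divr_gt0// subr_gt0.
move/subspace_continuousP/(_ _ Dy)/cvgrPdist_lt/(_ _ d0) : cv => h.
have [sphi _ _] := tphi.
have /cvgrPdist_lt/(_ _ d0) h' : phi x @[x --> y] --> phi y by exact: smooth_continuous.
have [x [Dx [hx hx']]] := Dy _ (@filterI _ _ (nbhs_filter y) _ _ h h').
have := inD _ Dx; have {}hx := hx (subset_closure Dx); rewrite /= in hx'.
have e4 : `|v y - phi y| = eta + 4 * d by rewrite /d; field.
have := ler_normD (v y - v x) (v x - phi x + (phi x - phi y)).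
have := ler_normD (v x - phi x) (phi x - phi y).
rewrite !addrA !subrK e4 (distrC (phi x)).
by move: hx hx'; lra.
Qed.

Lemma W0lim_sup_bound : exists2 C : R, 0 < C & forall v H (e : R) y, W0lim v H -> 0 < e ->
  (energy D p H <= e%:E)%E -> closure D y -> `|v y| <= C * e `^ p^-1.
Proof.
have [C C0 HC] := test_sup_bound.
exists (C * (2 `^ p * 2) `^ p^-1); first by rewrite mulr_gt0// powR_gt0// mulr_gt0// powR_gt0.
move=> v H e y [mH hv] e0 E Dy; apply/ler_addgt0Pr => d d0.
pose e' := Num.min e d.
have e'0 : 0 < e' by rewrite lt_min e0.
have e'e : e' <= e by rewrite ge_min lexx.
have [phi [tphi h1 h2]] := hv _ e'0.
have mg := measurable_vec_grad (D := D) tphi.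
have E' : (energy D p (grad phi) <= (2 `^ p * 2 * e)%:E)%E.
  rewrite (_ : 2 `^ p * 2 * e = 2 `^ p * (e + e)); last by ring.
  apply: (energy_le_sub mD (ltW p0) mg mH E).
  by apply: (le_trans h2); rewrite lee_fin.
have q0 : 0 < 2 `^ p * 2 * e by rewrite !mulr_gt0 ?powR_gt0.
have := HC _ _ y tphi q0 E'.
rewrite powRM ?(ltW e0) ?mulr_ge0 ?powR_ge0// mulrA => hphi.
rewrite -(subrK (phi y) (v y)) (le_trans (ler_normD _ _))// addrC lerD//.
by apply: (le_trans (h1 _ Dy)); rewrite ge_min lexx orbT.
Qed.

Lemma fine_energyE v H : W0lim v H -> energy D p H = (fine (energy D p H))%:E.
Proof.
by move=> vH; rewrite fineK// ge0_fin_numE ?energy_ge0//; exact: W0lim_energy_lty vH.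
Qed.

Lemma grad_normE v H : W0lim v H -> grad_norm D p v = fine (energy D p H) `^ p^-1.
Proof.
move=> vH; rewrite /grad_norm /Lqnorm LqnormE_enorm ?gt_eqF//.
have mw := (W01p_W0lim (W0lim_W01p vH)).1.
rewrite (ae_eq_energy p mD mw vH.1 (W0lim_wgrad_ae vH)).
by rewrite (fine_energyE vH) poweR_EFin.
Qed.

Lemma grad_norm_ge0 v H : W0lim v H -> 0 <= grad_norm D p v.
Proof. by move=> vH; rewrite (grad_normE vH) powR_ge0. Qed.

Lemma grad_normX v H : W0lim v H -> grad_norm D p v `^ p = fine (energy D p H).
Proof.
move=> vH; rewrite (grad_normE vH) powRVK ?gt_eqF//; exact: fine_ge0 (energy_ge0 _ _ _).
Qed.

Lemma grad_norm_energy v H : W0lim v H -> energy D p H = (grad_norm D p v `^ p)%:E.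
Proof. by move=> vH; rewrite (grad_normX vH); exact: fine_energyE vH. Qed.

Lemma grad_norm_eq0 v H : W0lim v H -> grad_norm D p v = 0 ->
  forall y, closure D y -> v y = 0.
Proof.
move=> vH g0 y Dy; have [C C0 HC] := W0lim_sup_bound.
apply/eqP; rewrite -normr_le0; apply/ler_addgt0Pr => e e0; rewrite add0r.
have q0 : 0 < (e / C) `^ p by rewrite powR_gt0// divr_gt0.
have := HC _ _ _ y vH q0 _ Dy.
rewrite powRK ?gt_eqF//; last exact: (divr_ge0 (ltW e0) (ltW C0)).
rewrite mulrCA divff ?gt_eqF// mulr1; apply.
by rewrite (grad_norm_energy vH) g0 powR0 ?gt_eqF// lee_fin ltW.
Qed.

Lemma grad_norm_gt0 v H y : W0lim v H -> closure D y -> v y != 0 -> 0 < grad_norm D p v.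
Proof.
move=> vH Dy vy; rewrite lt0r (grad_norm_ge0 vH) andbT.
by apply/eqP => /(grad_norm_eq0 vH)/(_ _ Dy)/eqP; exact/negP.
Qed.

Lemma W0lim_sup_grad_norm : exists2 C : R, 0 < C & forall v H y, W0lim v H ->
  closure D y -> `|v y| <= C * grad_norm D p v.
Proof.
have [C C0 HC] := W0lim_sup_bound; exists C => // v H y vH Dy.
have [vy|vy] := eqVneq (v y) 0.
  by rewrite vy normr0 mulr_ge0 ?(ltW C0)// (grad_norm_ge0 vH).
have g0 := grad_norm_gt0 vH Dy vy.
have q0 : 0 < grad_norm D p v `^ p by exact: powR_gt0.
have := HC _ _ _ y vH q0 _ Dy.
rewrite powRK ?gt_eqF ?(ltW g0)//; apply.
by rewrite (grad_norm_energy vH).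
Qed.

Lemma W0lim_holder : exists2 C : R, 0 < C & forall v H y z, W0lim v H ->
  closure D y -> closure D z ->
  `|v y - v z| <= C * enorm (y - z) `^ (1 - n%:R / p) * grad_norm D p v.
Proof.
pose q : R := (2 `^ p * 2) `^ p^-1.
have q0 : 0 < q by rewrite powR_gt0// mulr_gt0// powR_gt0.
exists (holder_cst * q); first by rewrite mulr_gt0// holder_cst_gt0.
move=> v H y z vH Dy Dz.
have [vyz|vyz] := eqVneq (v y - v z) 0.
  rewrite vyz normr0 !mulr_ge0 ?powR_ge0 ?(grad_norm_ge0 vH) ?(ltW q0)//.
  by apply: ltW; rewrite invr_gt0; exact: holder_exponent_gt0.
have g0 : 0 < grad_norm D p v.
  rewrite lt0r (grad_norm_ge0 vH) andbT; apply: contra vyz => /eqP g0.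
  by rewrite !(grad_norm_eq0 vH g0)// subrr.
pose r := enorm (y - z).
have r0 : 0 < r.
  rewrite lt0r enorm_ge0 andbT; apply: contra vyz => /eqP/enorm_eq0/eqP.
  by rewrite !subr_eq0 => /eqP ->.
(* Lower corner at the coordinatewise minimum, side equal to the Euclidean distance: this cube
   contains both points. *)
pose c : 'rV[R]_n := \row_i Num.min (y 0 i) (z 0 i).
have yzr i : `|y 0 i - z 0 i| <= r by have := coord_le_enorm (y - z) i; rewrite !mxE.
have Qy : box c (c + const_mx r) y.
  apply/boxP => i; have := yzr i; rewrite !mxE ler_norml minEle.
  by case: ifP => ?; lra.
have Qz : box c (c + const_mx r) z.
  apply/boxP => i; have := yzr i; rewrite !mxE ler_norml minEle.
  by case: (leP (y 0 i) (z 0 i)) => ?; lra.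
have e0 : 0 < grad_norm D p v `^ p by exact: powR_gt0.
have := W0lim_morrey vH r0 e0 _ Qy Qz Dy Dz.
have -> : 2 `^ p * (grad_norm D p v `^ p + grad_norm D p v `^ p) =
    2 `^ p * 2 * grad_norm D p v `^ p by ring.
rewrite powRM ?mulr_ge0 ?powR_ge0// powRK ?gt_eqF ?(ltW g0)// -/q => h.
apply: le_trans (h _) _; last by rewrite le_eqVlt; apply/orP; left; apply/eqP; ring.
rewrite -(grad_norm_energy vH); apply: energyS => //; last exact: vH.1.
by apply: measurableI => //; exact: measurable_box.
Qed.

(** Supplies a competitor that is positive at [y], so that the supremum defining s_p(y) runs over a
    nonempty set and is positive. *)
Lemma bump_W0lim y : D y -> exists v H, W0lim v H /\ 0 < v y.
Proof.
move=> Dy; have [r r0 abD] := nbhs_box (open_nbhs_nbhs (conj oD Dy)).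
set a := y - _ in abD; set b := y + _ in abD.
exists (box_bump a b), (grad (box_bump a b)); split.
  by apply: W0lim_test => //; exact: box_bump_test_fun.
by apply/box_bump_gt0P => i; rewrite !mxE; lra.
Qed.

(** * The function s_p *)

Lemma s_out y : ~ D y -> s_ D p y = 0.
Proof. by move=> Dy; rewrite /s_ memNset. Qed.

Lemma s_quotient_bounded : exists2 C : R, 0 < C & forall y, D y -> ubound
  [set `|v y| / grad_norm D p v | v in
     [set v | W01p D p v /\ exists2 z, closure D z & v z != 0]] C.
Proof.
have [C C0 HC] := W0lim_sup_grad_norm; exists C => // y Dy _ [v [Wv [z Dz vz]] <-].
have vH := W01p_W0lim Wv.
rewrite ler_pdivrMr; last exact: grad_norm_gt0 vH Dz vz.
by apply: HC vH _; exact: subset_closure.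
Qed.

Lemma le_s y v H : W0lim v H -> closure D y -> `|v y| <= s_ D p y * grad_norm D p v.
Proof.
move=> vH cDy; have [Dy|Dy] := pselect (D y); last first.
  by rewrite (W0lim_boundary vH (conj cDy Dy)) normr0 s_out// mul0r.
have key w K : W0lim w K -> w y != 0 -> `|w y| / grad_norm D p w <= s_ D p y.
  move=> wK wy; rewrite /s_ mem_set//; apply: ub_le_sup.
    by have [C _ /(_ _ Dy)] := s_quotient_bounded; exists C.
  exists w => //; split; first exact: W0lim_W01p wK.
  by exists y.
have [vy|vy] := eqVneq (v y) 0.
  have [w [K [wK wy]]] := bump_W0lim Dy.
  have wy' : w y != 0 by rewrite gt_eqF.
  rewrite vy normr0 mulr_ge0 ?(grad_norm_ge0 vH)//.
  by apply: le_trans (key _ _ wK wy'); rewrite divr_ge0// (grad_norm_ge0 wK).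
by rewrite -ler_pdivrMr ?(grad_norm_gt0 vH cDy vy)// (key _ _ vH).
Qed.

Lemma s_le y (c : R) : D y -> (forall v H, W0lim v H -> `|v y| <= c * grad_norm D p v) ->
  s_ D p y <= c.
Proof.
move=> Dy h; rewrite /s_ mem_set//; apply: ge_sup.
  have [w [K [wK wy]]] := bump_W0lim Dy.
  exists (`|w y| / grad_norm D p w), w => //; split; first exact: W0lim_W01p wK.
  by exists y; [exact: subset_closure|rewrite gt_eqF].
move=> _ [v [Wv [z Dz vz]] <-]; have vH := W01p_W0lim Wv.
by rewrite ler_pdivrMr ?(grad_norm_gt0 vH Dz vz)//; exact: h vH.
Qed.

Lemma s_gt0 y : D y -> 0 < s_ D p y.
Proof.
move=> Dy; have [w [K [wK wy]]] := bump_W0lim Dy.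
have cDy := subset_closure Dy.
have wy' : w y != 0 by rewrite gt_eqF.
rewrite -(pmulr_lgt0 _ (grad_norm_gt0 wK cDy wy')).
by apply: lt_le_trans (le_s wK cDy); rewrite normr_gt0.
Qed.

Lemma s_ge0 y : 0 <= s_ D p y.
Proof. by have [/s_gt0/ltW//|/s_out ->] := pselect (D y). Qed.

(** For every competitor, |v(y)| <= |v(z)| + |v(y) - v(z)| is at most s_p(z) + C |y - z|^(1 - n/p)
    times its gradient norm, with [C] independent of v; the bound survives the supremum. *)
Lemma s_holder : holder0 D (1 - n%:R / p) (s_ D p).
Proof.
split; last by move=> y [_ Dy]; exact: s_out.
have [C C0 HC] := W0lim_holder; exists C.
have key y z : closure D y -> closure D z ->
    s_ D p y - s_ D p z <= C * enorm (y - z) `^ (1 - n%:R / p).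
  move=> cDy cDz; have [Dy|Dy] := pselect (D y); last first.
    by rewrite (s_out Dy) sub0r (@le_trans _ _ 0) ?oppr_le0 ?s_ge0// mulr_ge0 ?powR_ge0// ltW.
  rewrite lerBlDl; apply: s_le => // v H vH.
  have := HC _ _ _ _ vH cDy cDz; have := le_s vH cDz.
  rewrite mulrDl => h1 h2; apply: le_trans (lerD h1 h2).
  by rewrite -{1}(subrK (v z) (v y)) addrC ler_normD.
move=> y z cDy cDz; rewrite ler_norml key// andbT lerNl opprB.
by rewrite -enormN opprB key.
Qed.

(** * Chain rules for polynomials and powers *)

Lemma W0lim_eq v w H K : W0lim v H -> v =1 w -> H =1 K -> W0lim w K.
Proof. by move=> vH /funext <- /funext <-. Qed.

(** When P(0) is not 0, P(v) does not vanish on the boundary, so the induction on [P] carries a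
    factor [w] from the space: w (Q(v) v + c) = (w Q(v)) v + c w. *)
Lemma W0lim_mul_horner w v H K P : W0lim w K -> W0lim v H ->
  W0lim (fun y => w y * P.[v y])
    (fun y => P.[v y] *: K y + (w y * P^`().[v y]) *: H y).
Proof.
move=> wK vH; elim/poly_ind: P => [|Q c IH].
  apply: (W0lim_eq (W0limZ 0 wK)) => y /=; first by rewrite horner0 mul0r mulr0.
  by rewrite deriv0 !horner0 mulr0 !scale0r addr0.
apply: (W0lim_eq (W0limD (W0lim_mul IH vH) (W0limZ c wK))) => y /=.
  by rewrite !hornerE; ring.
by rewrite derivMXaddC !hornerE; apply/rowP => i; rewrite !mxE; ring.
Qed.

Lemma W0lim_horner v H P : P.[0] = 0 -> W0lim v H ->
  W0lim (fun y => P.[v y]) (fun y => P^`().[v y] *: H y).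
Proof.
move=> /rootP/factor_theorem[Q ->] vH.
apply: (W0lim_eq (W0lim_mul_horner Q vH vH)) => y /=.
  by rewrite subr0 hornerM hornerX mulrC.
rewrite subr0 derivM derivX mulr1 hornerD hornerM hornerX; apply/rowP => i.
by rewrite !mxE; ring.
Qed.

Lemma measurable_fun_powR v (c b : R) : measurable_fun D v ->
  measurable_fun D (fun y => (v y + c) `^ b).
Proof.
move=> mv; apply: (measurableT_comp (measurable_powR b)).
exact: measurable_funD.
Qed.

(** As in the product rule, the error splits into a bounded factor times H - grad phi and a
    uniformly small factor times [H]; the latter factor is small because t^(b-1) is Lipschitz away
    from 0. *)
Lemma W0lim_powR v H (c b d : R) : W0lim v H -> 0 < d -> 0 < c ->
  (forall y, closure D y -> d <= v y + c) ->
  W0lim (fun y => (v y + c) `^ b - c `^ b) (fun y => (b * (v y + c) `^ (b - 1)) *: H y).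
Proof.
move=> vH d0 c0 vd; have [mH hv] := vH.
have mv := W0lim_measurable vH.
have [M M0 HM] := W0lim_bounded vH.
pose EHr := fine (energy D p H).
have EHE : energy D p H = EHr%:E by exact: fine_energyE vH.
have EH0 : 0 <= EHr by exact: fine_ge0 (energy_ge0 _ _ _).
(* On the closure of [D] both v + c and phi + c will lie in [lo, hi], because |v - phi| <= min(e,
   d/2) and e <= 1. *)
pose lo := d / 2; pose hi := M + 1 + c.
have lo0 : 0 < lo by rewrite divr_gt0.
have [L1 L10 HL1] := powR_lipschitz hi b lo0.
have [L2 L20 HL2] := powR_lipschitz hi (b - 1) lo0.
pose B := lo `^ (b - 1) + hi `^ (b - 1).
have B0 : 0 <= B by rewrite addr_ge0// powR_ge0.
have ph : 0 <= 2 `^ p :> R by exact: powR_ge0.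
pose C1 := (`|b| * B) `^ p; pose C2 := (`|b| * L2) `^ p.
have C10 : 0 <= C1 by exact: powR_ge0.
have C20 : 0 <= C2 by exact: powR_ge0.
pose E := 2 `^ p * (C1 + C2 * EHr).
have E0 : 0 <= E by rewrite mulr_ge0// addr_ge0// mulr_ge0.
have mw : measurable_vec D (fun y => (b * (v y + c) `^ (b - 1)) *: H y).
  apply: measurable_vecZ => //; apply: measurable_funM => //.
  exact: measurable_fun_powR.
apply: (@W0lim_intro (L1 + E)) => // e /andP[e0 e1].
pose e' := Num.min e lo.
have e'0 : 0 < e' by rewrite lt_min e0.
have e'e : e' <= e by rewrite ge_min lexx.
have e'lo : e' <= lo by rewrite ge_min lexx orbT.
have [phi [tphi h1 h2]] := hv _ e'0.
have sphi : smooth_on setT phi by case: tphi.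
have vI y : closure D y -> lo <= v y + c <= hi.
  move=> Dy; have := vd _ Dy; have := HM _ Dy; rewrite ler_norml /lo /hi => /andP[? ?] ?.
  by apply/andP; split; lra.
have phiI y : closure D y -> lo <= phi y + c <= hi.
  move=> Dy; have := vd _ Dy; have := HM _ Dy; have := h1 _ Dy.
  rewrite !ler_norml => /andP[? ?] /andP[? ?] ?.
  by move: e'lo; rewrite /lo /hi => ?; apply/andP; split; lra.
have phic y : 0 < phi y + c.
  have [Dy|Dy] := pselect (D y); last by rewrite (test_fun0 tphi Dy) add0r.
  by have /andP[+ _] := phiI _ (subset_closure Dy); exact: lt_le_trans.
exists (fun y => (phi y + c) `^ b - c `^ b); split; first exact: test_fun_powRB.
  move=> y Dy.
  have -> : (v y + c) `^ b - c `^ b - ((phi y + c) `^ b - c `^ b) =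
    (v y + c) `^ b - (phi y + c) `^ b by ring.
  apply: (le_trans (HL1 _ _ (vI _ Dy) (phiI _ Dy))).
  have -> : v y + c - (phi y + c) = v y - phi y by ring.
  apply: (@le_trans _ _ (L1 * e)); last by rewrite mulrDl lerDl mulr_ge0// ltW.
  by rewrite ler_wpM2l// (le_trans (h1 _ Dy)).
have mphi : measurable_fun D phi := test_fun_measurable tphi.
have mgphi := measurable_vec_grad (D := D) tphi.
pose F1 y := b * (phi y + c) `^ (b - 1).
pose F2 y := b * ((v y + c) `^ (b - 1) - (phi y + c) `^ (b - 1)).
have mF1 : measurable_fun D F1 by apply: measurable_funM => //; exact: measurable_fun_powR.
have mF2 : measurable_fun D F2.
  by apply: measurable_funM => //; apply: measurable_funB; exact: measurable_fun_powR.
rewrite (_ : (fun y => _) = (fun y => F1 y *: (H y - grad phi y) + F2 y *: H y)); last first.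
  apply/funext => y; rewrite grad_powRB//; apply/rowP => i; rewrite !mxE /F1 /F2.
  by ring.
have F1B y : D y -> `|F1 y| <= `|b| * B.
  move=> Dy; rewrite normrM ler_wpM2l// ger0_norm ?powR_ge0// powR_between//.
  exact/phiI/subset_closure.
have F2B y : D y -> `|F2 y| <= `|b| * L2 * e.
  move=> Dy; have cDy := subset_closure Dy; rewrite normrM -mulrA ler_wpM2l//.
  apply: (le_trans (HL2 _ _ (vI _ cDy) (phiI _ cDy))).
  have -> : v y + c - (phi y + c) = v y - phi y by ring.
  by rewrite ler_wpM2l// (le_trans (h1 _ cDy)).
have mHg := measurable_vecB mH mgphi.
apply: (le_trans (energyD mD (ltW p0) (measurable_vecZ mF1 mHg) (measurable_vecZ mF2 mH))).
have ep : e `^ p <= e by apply: ge1r_powR; [rewrite e0|exact: ltW].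
have t1 : (energy D p (fun y => F1 y *: (H y - grad phi y))%R <= (C1 * e)%:E)%E.
  apply: (le_trans (energyZ mD (ltW p0) (mulr_ge0 (normr_ge0 b) B0) mF1 mHg F1B)).
  rewrite EFinM; apply: lee_wpmul2l; rewrite ?lee_fin//.
  by apply: (le_trans h2); rewrite lee_fin.
have t2 : (energy D p (fun y => F2 y *: H y)%R <= (C2 * EHr * e)%:E)%E.
  have bLe : 0 <= `|b| * L2 * e by rewrite !mulr_ge0// ltW.
  apply: (le_trans (energyZ mD (ltW p0) bLe mF2 mH F2B)).
  rewrite EHE -EFinM lee_fin powRM ?(ltW e0) ?mulr_ge0// -/C2 mulrAC.
  by rewrite ler_wpM2l// mulr_ge0.
apply: (@le_trans _ _ (2 `^ p * (C1 * e + C2 * EHr * e))%:E).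
  by rewrite EFinM EFinD; apply: lee_wpmul2l; [rewrite lee_fin|exact: leeD].
rewrite lee_fin.
have -> : 2 `^ p * (C1 * e + C2 * EHr * e) = E * e by rewrite /E; ring.
by rewrite mulrDl lerDr mulr_ge0// ltW.
Qed.

Lemma W0lim_mul_powR w K v H (c b d : R) : W0lim w K -> W0lim v H -> 0 < d -> 0 < c ->
  (forall y, closure D y -> d <= v y + c) ->
  W0lim (fun y => w y * (v y + c) `^ b)
    (fun y => (v y + c) `^ b *: K y + (w y * (b * (v y + c) `^ (b - 1))) *: H y).
Proof.
move=> wK vH d0 c0 vd.
have := W0limD (W0lim_mul wK (W0lim_powR b vH d0 c0 vd))
  (W0limZ (c `^ b) wK).
move=> h; apply: (W0lim_eq h) => y /=; first by ring.
by apply/rowP => i; rewrite !mxE; ring.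
Qed.

(** * The solution of the Dirac problem *)

Section solution.
Variables (x : 'rV[R]_n) (u : 'rV[R]_n -> R).
Hypotheses (Dx : D x) (sol : dirac_weak_solution D p (s_ D p x `^ (- p)) x u).
Let G := wgrad D u.

Lemma sol_W0lim : W0lim u G.
Proof. by have [Wu _] := sol; exact: W01p_W0lim. Qed.

Let uG := sol_W0lim.

(** * Normalization of the solution and the equality case *)

Section normalization.
Let s := s_ D p x.
Let s0 : 0 < s. Proof. exact: s_gt0. Qed.

Lemma W0lim_energy_integrable v H : W0lim v H ->
  mu.-integrable D (EFin \o (fun y => enorm (H y) `^ p)).
Proof.
by move=> vH; apply: energy_integrable; [exact: vH.1|exact: W0lim_energy_lty vH].
Qed.

Lemma Rintegral_energy v H : W0lim v H ->
  \int[mu]_(y in D) (enorm (H y) `^ p) = grad_norm D p v `^ p.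
Proof.
move=> vH; apply: EFin_inj; rewrite -(grad_norm_energy vH) energyE.
by rewrite Rintegral_EFin//; exact: W0lim_energy_integrable vH.
Qed.

Lemma young_integrable v H : W0lim v H -> mu.-integrable D
  (EFin \o (fun y => (1 - p^-1) * enorm (G y) `^ p + enorm (H y) `^ p / p)).
Proof.
move=> vH.
have i1 := integrableRZ mD (1 - p^-1) (W0lim_energy_integrable uG).
have i2 := integrableRZ mD p^-1 (W0lim_energy_integrable vH).
rewrite (_ : (fun y => _) = fun y : 'rV[R]_n => (1 - p^-1) * enorm (G y) `^ p + p^-1 * enorm (H y) `^ p).
  exact: integrableRD.
by apply/funext => y; rewrite (mulrC p^-1).
Qed.

Lemma plap_integrable v H : W0lim v H ->
  mu.-integrable D (EFin \o (fun y => plap p (G y) (H y))).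
Proof.
move=> vH; apply: (le_integrableR mD _ _ (young_integrable vH)).
  by apply: measurable_plap; [exact: uG.1|exact: vH.1].
by move=> y _; exact: plap_young.
Qed.

Lemma sol_test v H : W0lim v H ->
  \int[mu]_(y in D) plap p (G y) (H y) = s `^ (- p) * v x.
Proof.
move=> vH; have [_ /(_ v (W0lim_W01p vH)) <-] := sol.
have wH := (W01p_W0lim (W0lim_W01p vH)).1.
apply: (congr1 fine); apply: ae_eq_integral => //.
- by apply/measurable_EFinP; apply: measurable_plap; [exact: uG.1|exact: vH.1].
- by apply/measurable_EFinP; apply: measurable_plap; [exact: uG.1|exact: wH].
- apply: filterS (W0lim_wgrad_ae vH) => y h Dy.
  by rewrite /plap (h Dy).
Qed.

Lemma Rintegral_young v H : W0lim v H ->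
  \int[mu]_(y in D) ((1 - p^-1) * enorm (G y) `^ p + enorm (H y) `^ p / p) =
  (1 - p^-1) * grad_norm D p u `^ p + grad_norm D p v `^ p / p.
Proof.
move=> vH.
rewrite (_ : (fun y => _) = fun y : 'rV[R]_n => (1 - p^-1) * enorm (G y) `^ p + p^-1 * enorm (H y) `^ p); last first.
  by apply/funext => y; rewrite (mulrC p^-1).
have i1 := W0lim_energy_integrable uG; have i2 := W0lim_energy_integrable vH.
rewrite (RintegralD mD (integrableRZ mD _ i1) (integrableRZ mD _ i2)).
by rewrite !RintegralZl// (Rintegral_energy uG) (Rintegral_energy vH) (mulrC p^-1).
Qed.

Lemma sol_young v H : W0lim v H ->
  s `^ (- p) * v x <= (1 - p^-1) * grad_norm D p u `^ p + grad_norm D p v `^ p / p.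
Proof.
move=> vH; rewrite -(sol_test vH) -(Rintegral_young vH).
apply: le_Rintegral => //; [exact: plap_integrable vH|exact: young_integrable vH|].
by move=> y _; exact: le_trans (ler_norm _) (plap_young _ _ p1).
Qed.

Let a := grad_norm D p u.
Let a0 : 0 <= a. Proof. exact: grad_norm_ge0 uG. Qed.
Let m := s `^ (- p).
Let m0 : 0 < m. Proof. exact: powR_gt0. Qed.

Lemma sol_energy : a `^ p = m * u x.
Proof.
rewrite -(Rintegral_energy uG) -(sol_test uG).
by apply: eq_Rintegral => y _; rewrite plap_self.
Qed.

Let a_gt0 : 0 < a.
Proof.
rewrite lt0r a0 andbT; apply/eqP => a_eq0.
have [v [H [vH vx]]] := bump_W0lim Dx.
have vx' : v x != 0 by rewrite gt_eqF.
have g0 := grad_norm_gt0 vH (subset_closure Dx) vx'.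
set g := grad_norm D p v in g0.
(* If a = 0, Young's inequality for t v reads m t v(x) <= t^p g^p / p. This t solves t^(p-1) g^p = m
   v(x), so the inequality would say p <= 1. *)
pose t := (m * v x / g `^ p) `^ (p - 1)^-1.
have q0 : 0 < m * v x / g `^ p by rewrite divr_gt0 ?mulr_gt0 ?powR_gt0.
have t0 : 0 < t by exact: powR_gt0.
have p10 : p - 1 != 0 by rewrite gt_eqF// subr_gt0.
have tp : t `^ p = t * (m * v x / g `^ p).
  rewrite -(powRB1M p t0) mulrC /t -powRrM mulVf// powRr1//; exact: ltW.
have tvH := W0limZ t vH.
have := sol_young tvH.
have tg : grad_norm D p (fun y => t * v y) `^ p = t `^ p * g `^ p.
  rewrite -(Rintegral_energy tvH) -(Rintegral_energy vH) -RintegralZl//; last first.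
    exact: W0lim_energy_integrable vH.
  apply: eq_Rintegral => y _; rewrite enormZ (ger0_norm (ltW t0)) powRM ?enorm_ge0//; exact: ltW.
rewrite -/a a_eq0 powR0 ?gt_eqF// mulr0 add0r tg tp.
have -> : t * (m * v x / g `^ p) * g `^ p = t * (m * v x).
  by field; rewrite gt_eqF// powR_gt0.
rewrite -/m (mulrCA m) ler_pdivlMr// ger_pMr ?mulr_gt0//.
by rewrite leNgt p1.
Qed.

Lemma sol_holder v H : W0lim v H -> m * v x <= a `^ (p - 1) * grad_norm D p v.
Proof.
move=> vH; set g := grad_norm D p v.
have [g0|g0] := eqVneq g 0.
  by rewrite g0 mulr0 (grad_norm_eq0 vH g0) ?mulr0//; exact: subset_closure.
have gp : 0 < g by rewrite lt0r g0; exact: grad_norm_ge0 vH.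
pose t := a / g; have t0 : 0 < t := divr_gt0 a_gt0 gp.
have tvH := W0limZ t vH.
have tg : grad_norm D p (fun y => t * v y) `^ p = a `^ p.
  rewrite -(Rintegral_energy tvH).
  have -> : a = t * g by rewrite /t divfK.
  rewrite powRM ?(ltW t0) ?(ltW gp)// -(Rintegral_energy vH) -RintegralZl//; last first.
    exact: W0lim_energy_integrable vH.
  apply: eq_Rintegral => y _; rewrite enormZ (ger0_norm (ltW t0)) powRM ?enorm_ge0//; exact: ltW.
have := sol_young tvH; rewrite -/a -/m tg.
rewrite young_weightE.
exact: holder_scale.
Qed.

(** The solution is itself a competitor, so u(x) <= s a. Conversely [sol_holder], for v and for its
    opposite, bounds every competitor by s^p a^(p-1) times its gradient norm, hence s <= s^p
    a^(p-1). *)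
Lemma sol_grad_norm : s * a = 1.
Proof.
have cDx := subset_closure Dx.
apply: (extremal_scale p1 s0 a_gt0 sol_energy).
  by apply: le_trans (ler_norm _) _; exact: (le_s uG).
apply: (s_le Dx) => v H vH.
have abs : m * `|v x| <= a `^ (p - 1) * grad_norm D p v.
  have [vx|vx] := leP 0 (v x); first by rewrite ger0_norm//; exact: sol_holder vH.
  rewrite (ltr0_norm vx).
  have vN := W0limZ (-1) vH.
  have := sol_holder vN; rewrite mulN1r.
  suff -> : grad_norm D p (fun y => -1 * v y) = grad_norm D p v by [].
  rewrite (grad_normE vN) (grad_normE vH); congr (fine _ `^ _).
  by rewrite -energyN; congr energy; apply/funext => y; rewrite scaleN1r opprK.
by rewrite -mulrA -ler_pdivrMl ?powR_gt0// -powRN.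
Qed.

Lemma sol_x : u x = 1.
Proof.
have sp : 0 < s `^ p by exact: powR_gt0.
have : s `^ p * (m * u x) = 1.
  by rewrite -sol_energy -powRM ?(ltW s0)// sol_grad_norm powR1.
by rewrite mulrA /m powRN divff ?gt_eqF// mul1r.
Qed.

Lemma sol_grad_normE : a = s^-1.
Proof. by rewrite -[LHS](mulKf (lt0r_neq0 s0)) sol_grad_norm mulr1. Qed.

Lemma s_sol : s = (grad_norm D p u)^-1.
Proof. by rewrite -/a sol_grad_normE invrK. Qed.

Lemma grad_normZ v H (k : R) : W0lim v H ->
  grad_norm D p (fun y => k * v y) = `|k| * grad_norm D p v.
Proof.
move=> vH; have kvH := W0limZ k vH.
have g1 := grad_norm_ge0 vH; have g2 := grad_norm_ge0 kvH.
have E : grad_norm D p (fun y => k * v y) `^ p = (`|k| * grad_norm D p v) `^ p.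
  rewrite powRM// -(Rintegral_energy kvH) -(Rintegral_energy vH) -RintegralZl//; last first.
    exact: W0lim_energy_integrable vH.
  by apply: eq_Rintegral => y _; rewrite enormZ powRM ?enorm_ge0.
have kg0 := mulr_ge0 (normr_ge0 k) g1.
by apply: (powR_injective p0) => //; rewrite nnegrE.
Qed.

(** Both sides of Young's inequality for the gradients have the same integral a^p, so equality holds
    almost everywhere and the gradients coincide there; v - u then has gradient norm 0. *)
Lemma sol_unique v H : W0lim v H -> v x = 1 -> grad_norm D p v = a ->
  forall y, closure D y -> v y = u y.
Proof.
move=> vH vx va.
have E : \int[mu]_(y in D)
    (((1 - p^-1) * enorm (G y) `^ p + enorm (H y) `^ p / p) - plap p (G y) (H y)) = 0.
  rewrite (RintegralB mD (young_integrable vH) (plap_integrable vH)).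
  rewrite (Rintegral_young vH) (sol_test vH) va -/a -/m vx.
  by rewrite sol_energy sol_x mulr1 young_weightE subrr.
have ii := integrableRB mD (young_integrable vH) (plap_integrable vH).
have nn y : 0 <= ((1 - p^-1) * enorm (G y) `^ p + enorm (H y) `^ p / p) - plap p (G y) (H y).
  by rewrite subr_ge0; exact: le_trans (ler_norm _) (plap_young _ _ p1).
have : {ae mu, forall y, D y -> H y = G y}.
  have mi := integrable_measurable ii.
  have /measurable_EFinP mi' := mi.
  have := (ae_eq_integral_abs mu mD mi').1; rewrite /ae_eq /=.
  rewrite (eq_integral (fun y => (((1 - p^-1) * enorm (G y) `^ p + enorm (H y) `^ p / p) -
      plap p (G y) (H y))%:E)); last by move=> y _; rewrite /= ger0_norm.
  rewrite -Rintegral_EFin// E => /(_ erefl).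
  apply: filterS => y h Dy; have := congr1 fine (h Dy).
  by move=> /subr0_eq/esym; exact: plap_young_eq.
move=> HG.
have wH := W0limD vH (W0limZ (-1) uG).
have w0 : grad_norm D p (fun y => v y + -1 * u y) = 0.
  rewrite (grad_normE wH).
  have m00 : measurable_vec D (fun=> 0 : 'rV[R]_n).
    by move=> i; rewrite (_ : (fun y => _) = fun=> 0)//; apply/funext => y; rewrite mxE.
  rewrite (ae_eq_energy p mD wH.1 m00); last first.
    by apply: filterS HG => y h Dy; rewrite (h Dy) scaleN1r subrr.
  rewrite energyE (_ : (fun y => _) = fun=> 0%E).
    by rewrite integral0 /= powR0// invr_eq0 gt_eqF.
  by apply/funext => y; rewrite enorm0 powR0// gt_eqF.
move=> y Dy; have := grad_norm_eq0 wH w0 Dy.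
by rewrite mulN1r => /eqP; rewrite subr_eq0 => /eqP.
Qed.

Lemma sol_extremal v H : W0lim v H -> (`|v x| = s * grad_norm D p v <->
  exists k : R, forall y, closure D y -> v y = k * u y).
Proof.
move=> vH; have cDx := subset_closure Dx; split=> [vx|[k vk]].
  have [vx0|vx0] := eqVneq (v x) 0.
    exists 0 => y Dy; rewrite mul0r; apply: (grad_norm_eq0 vH) => //.
    by move/esym/eqP : vx; rewrite vx0 normr0 mulf_eq0 (gt_eqF s0)/= => /eqP.
  exists (v x) => y Dy.
  have vi := W0limZ (v x)^-1 vH.
  rewrite -(sol_unique vi _ _ Dy); [by rewrite mulrA divff// mul1r|by rewrite mulVf|].
  rewrite (grad_normZ _ vH) normfV sol_grad_normE.
  by rewrite vx; field; rewrite (gt_eqF s0)/=; apply: contra vx0 => /eqP g0;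
    rewrite -normr_eq0 vx g0 mulr0.
have kuG := W0limZ k uG.
have vkG := W0lim_ext kuG vk.
rewrite (vk _ cDx) sol_x mulr1 (grad_normE vkG) -(grad_normE kuG).
by rewrite (grad_normZ _ uG) -/a mulrCA sol_grad_norm mulr1.
Qed.

End normalization.

(** * The bounds on the solution *)

Section range.

(** The constant 1 makes the polynomial vanish at 0, as membership in the space requires; its
    derivative is a positive multiple of an even power, so testing with it controls an integral of a
    nonnegative function. *)
Definition odd_power_poly j : {poly R} := (2 *: 'X - 1) ^+ (2 * j).+1 + 1.

Lemma odd_power_polyE j t : (odd_power_poly j).[t] = (2 * t - 1) ^+ (2 * j).+1 + 1.
Proof. by rewrite /odd_power_poly !hornerE. Qed.

Lemma deriv_odd_power_poly j t :
  (odd_power_poly j)^`().[t] = 2 * (2 * j).+1%:R * (2 * t - 1) ^+ (2 * j).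
Proof.
rewrite /odd_power_poly derivD -polyC1 derivC addr0 deriv_exp derivB derivZ derivX derivC subr0.
by rewrite hornerMn !hornerE -mulr_natl; ring.
Qed.

Lemma odd_power_poly_W0lim j : W0lim (fun y => (odd_power_poly j).[u y])
  (fun y => (odd_power_poly j)^`().[u y] *: G y).
Proof.
apply: W0lim_horner => //; rewrite odd_power_polyE mulr0 add0r exprS exprM.
by rewrite sqrrN !expr1n mulr1 addNr.
Qed.

Let f j (y : 'rV[R]_n) := (2 * u y - 1) ^+ (2 * j) * enorm (G y) `^ p.

Let fE j : (fun y => plap p (G y) ((odd_power_poly j)^`().[u y] *: G y)) =
  (fun y => 2 * (2 * j).+1%:R * f j y).
Proof. by apply/funext => y; rewrite plapZr plap_self// deriv_odd_power_poly mulrA. Qed.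

Lemma even_moment_integrable j : mu.-integrable D (EFin \o f j).
Proof.
have := plap_integrable (odd_power_poly_W0lim j); rewrite -/G fE.
move=> /(integrableRZ mD (2 * (2 * j).+1%:R)^-1).
rewrite (_ : (fun y => _) = f j)//; apply/funext => y.
by rewrite mulKf// mulf_neq0// pnatr_eq0.
Qed.

(** The polynomial takes the value 2 at u(x) = 1, so testing gives 2 (2j+1) times the moment equal
    to 2 s_p(x)^(-p). *)
Lemma even_moment_le j : \int[mu]_(y in D) f j y <= s_ D p x `^ (- p).
Proof.
have := sol_test (odd_power_poly_W0lim j); rewrite -/G fE.
rewrite RintegralZl//; last exact: even_moment_integrable.
rewrite odd_power_polyE sol_x.
have -> : 2 * 1 - 1 = 1 :> R by ring.
rewrite expr1n (mulrC (s_ _ _ _ `^ _)) -mulrA => /mulfI => /(_ ltac:(by rewrite pnatr_eq0)) <-.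
rewrite ler_peMl ?ler1n//; apply: Rintegral_ge0 => y _.
by rewrite mulr_ge0 ?powR_ge0// exprM exprn_ge0// sqr_ge0.
Qed.

Lemma sol_range y : closure D y -> 0 <= u y <= 1.
Proof.
move=> Dy.
have [C C0 HC] := W0lim_sup_grad_norm.
set m := s_ D p x `^ (- p); set a := grad_norm D p u.
have m0 : 0 <= m by exact: powR_ge0.
pose B := C * (a `^ p + m) `^ p^-1.
have am0 : 0 <= a `^ p + m by rewrite addr_ge0 ?powR_ge0.
have B0 : 0 <= B by rewrite mulr_ge0 ?powR_ge0// ltW.
(* A natural number at least p: t^p <= 1 + t^q for t >= 0, and for t = (2u - 1)^(2j) the power t^q
   is again an even power of 2u - 1. *)
pose q := (Num.truncn p).+1; have pq : p <= q%:R by exact/ltW/truncnS_gt.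
suff : `|2 * u y - 1| <= 1 by rewrite ler_norml => /andP[? ?]; apply/andP; split; lra.
apply: (linear_powers_le1 B0) => j.
have vH := odd_power_poly_W0lim j; set v := (fun y => _) in vH.
pose k : R := 2 * (2 * j).+1%:R.
have k0 : 0 <= k by rewrite mulr_ge0.
have gv0 : 0 <= grad_norm D p v by exact: grad_norm_ge0 vH.
(* The factor k = 2 (2j+1) from the derivative is the only dependence on [j] of the resulting
   gradient norm, whence the linear growth. *)
have E : grad_norm D p v `^ p <= k `^ p * (a `^ p + m).
  rewrite -(Rintegral_energy vH).
  have i1 := W0lim_energy_integrable uG.
  have i2 := even_moment_integrable (j * q).
  apply: (@le_trans _ _ (\int[mu]_(y in D) (k `^ p * (enorm (G y) `^ p + f (j * q) y)))).
    apply: le_Rintegral => //.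
    - exact: W0lim_energy_integrable vH.
    - by apply: integrableRZ => //; exact: integrableRD.
    move=> z _; rewrite enormZ deriv_odd_power_poly -/k normrM (ger0_norm k0).
    rewrite powRM ?mulr_ge0 ?enorm_ge0// powRM// -mulrA ler_wpM2l ?powR_ge0//.
    rewrite /f -{2}[enorm (G z) `^ p]mul1r -mulrDl ler_wpM2r ?powR_ge0//.
    set t := `|_ ^+ _|.
    have t0 : 0 <= t by exact: normr_ge0.
    have -> : (2 * u z - 1) ^+ (2 * (j * q)) = t ^+ q.
      rewrite /t mulnA exprM; congr (_ ^+ q).
      by rewrite ger0_norm// exprM exprn_ge0// sqr_ge0.
    have [t1|t1] := leP t 1.
      apply: (@le_trans _ _ 1); last by rewrite lerDl exprn_ge0.
      suff : t `^ p <= 1 `^ p by rewrite powR1.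
      by apply: ge0_ler_powR; rewrite ?nnegrE ?(ltW p0).
    rewrite -powR_mulrn//; apply: le_trans (ler_powR (ltW t1) pq) _.
    by rewrite lerDr.
  rewrite RintegralZl//; last exact: integrableRD.
  rewrite ler_wpM2l ?powR_ge0// RintegralD// (Rintegral_energy uG) lerD2l.
  exact: even_moment_le.
rewrite -odd_power_polyE; apply: (le_trans (HC _ _ _ vH Dy)).
rewrite /B mulrCA -/k ler_wpM2l ?(ltW C0)//.
rewrite -(powRK (lt0r_neq0 p0) gv0) -{1}(powRK (lt0r_neq0 p0) k0).
rewrite -powRM ?powR_ge0//; apply: ge0_ler_powR => //; rewrite ?nnegrE ?powR_ge0 ?invr_ge0 ?(ltW p0)//.
by rewrite mulr_ge0 ?powR_ge0.
Qed.

End range.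

(* Applied with sg = 1, c = 0 (tau = u + e) and with sg = -1, c = 1 (tau = 1 - u + e). *)
Section caccioppoli.
Variables (sg c e : R) (q : nat) (eta : 'rV[R]_n -> R) (K : 'rV[R]_n -> 'rV[R]_n).
Hypotheses (sg1 : `|sg| = 1) (c0 : 0 <= c) (e0 : 0 < e) (pq : p <= q%:R).
Hypothesis uc : forall y, closure D y -> 0 <= sg * u y + c.
Hypotheses (etaK : W0lim eta K) (eta01 : forall y, 0 <= eta y <= 1) (sgx : 0 <= sg * eta x).

Let tau y := sg * u y + (c + e).
Let tau_ge y : closure D y -> e <= tau y.
Proof. by move=> /uc; rewrite /tau; lra. Qed.
Let tau_gt0 y : closure D y -> 0 < tau y.
Proof. by move=> /tau_ge; exact: lt_le_trans. Qed.

Let sgu : W0lim (fun y => sg * u y) (fun y => sg *: G y).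
Proof. exact: W0limZ. Qed.

Let q0 : (0 < q)%N.
Proof. by rewrite -(ltr_nat R); exact: lt_le_trans pq. Qed.

Let zetaZ : W0lim (fun y => eta y ^+ q) (fun y => (q%:R * eta y ^+ q.-1) *: K y).
Proof.
have h : ('X^q : {poly R}).[0] = 0 by rewrite hornerXn expr0n gtn_eqF.
apply: (W0lim_eq (W0lim_horner h etaK)) => y /=; first by rewrite hornerXn.
by rewrite derivXn hornerMn hornerXn mulr_natl.
Qed.

(** Since |sg| = 1, this is eta^q times the p-th power of the length of the gradient of log tau. *)
Definition weighted_density y := eta y ^+ q * tau y `^ (- p) * enorm (G y) `^ p.

Lemma weighted_density_ge0 y : 0 <= weighted_density y.
Proof. by rewrite !mulr_ge0 ?powR_ge0// exprn_ge0//; case/andP: (eta01 y). Qed.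

Let mtau b : measurable_fun D (fun y => tau y `^ b).
Proof.
apply: measurable_fun_powR; apply: measurable_funM => //.
exact: W0lim_measurable uG.
Qed.

Let tauN_le b y : closure D y -> 0 <= b -> tau y `^ (- b) <= e `^ (- b).
Proof.
move=> Dy b0; rewrite !powRN lef_pV2 ?posrE ?powR_gt0 ?tau_gt0//.
by apply: ge0_ler_powR => //; rewrite ?nnegrE ?(ltW e0) ?(ltW (tau_gt0 Dy)) ?tau_ge.
Qed.

Lemma weighted_density_integrable : mu.-integrable D (EFin \o weighted_density).
Proof.
have i1 := W0lim_energy_integrable uG.
apply: (le_integrableR mD _ _ (integrableRZ mD (e `^ (- p)) i1)).
  apply: measurable_funM; last by apply: measurable_energy_fun; exact: uG.1.
  apply: measurable_funM => //; exact: W0lim_measurable zetaZ.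
move=> y Dy; rewrite ger0_norm ?weighted_density_ge0// /weighted_density.
rewrite ler_wpM2r ?powR_ge0// -[leRHS]mul1r.
have /andP[h0 h1] := eta01 y.
rewrite ler_pM ?powR_ge0 ?exprn_ge0 ?exprn_ile1//.
by apply: tauN_le; [exact: subset_closure|exact: ltW].
Qed.

(** The contribution in which the gradient of the test function falls on eta^q. *)
Let cutoff y := tau y `^ (1 - p) * plap p (G y) ((q%:R * eta y ^+ q.-1) *: K y).

Let cutoff_le y : D y ->
  `|cutoff y| <= (1 - p^-1) * weighted_density y + q%:R `^ p / p * enorm (K y) `^ p.
Proof.
move=> Dy; rewrite normrM (ger0_norm (powR_ge0 _ _)).
have /andP[h0 h1] := eta01 y.
have tp := tau_gt0 (subset_closure Dy).
apply: (@le_trans _ _ (tau y `^ (1 - p) *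
    (enorm (G y) `^ (p - 1) * (q%:R * eta y ^+ q.-1 * enorm (K y))))).
  rewrite ler_wpM2l ?powR_ge0//; apply: le_trans (plap_norm_le _ _ _) _.
  by rewrite enormZ ger0_norm// mulr_ge0// exprn_ge0.
apply: (le_trans (caccioppoli_young p1 pq (eta01 y) tp (enorm_ge0 _) (enorm_ge0 _))).
have kE : (q%:R * enorm (K y)) `^ p = q%:R `^ p * enorm (K y) `^ p by rewrite powRM ?enorm_ge0.
by rewrite /weighted_density lerD2l kE mulrAC.
Qed.

Let cutoff_bound_integrable : mu.-integrable D
  (EFin \o (fun y => (1 - p^-1) * weighted_density y + q%:R `^ p / p * enorm (K y) `^ p)).
Proof.
apply: integrableRD => //; first exact: integrableRZ weighted_density_integrable.
by apply: integrableRZ => //; exact: W0lim_energy_integrable etaK.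
Qed.

Let cutoff_measurable : measurable_fun D cutoff.
Proof.
by apply: measurable_funM => //; apply: measurable_plap; [exact: uG.1|exact: zetaZ.1].
Qed.

Let cutoff_integrable : mu.-integrable D (EFin \o cutoff).
Proof.
apply: (le_integrableR mD cutoff_measurable _ cutoff_bound_integrable) => y; exact: cutoff_le.
Qed.

Lemma caccioppoli : \int[mu]_(y in D) weighted_density y <=
  q%:R `^ p / (p - 1) ^+ 2 * grad_norm D p eta `^ p.
Proof.
have sg2 : sg * sg = 1 by rewrite -expr2 -real_normK ?num_real// sg1 expr1n.
have ce0 : 0 < c + e by rewrite ltr_wpDl.
have h := W0lim_mul_powR (1 - p) zetaZ sgu e0 ce0 tau_ge.
have := sol_test h; rewrite -/G.
have -> : (fun y => plap p (G y) (tau y `^ (1 - p) *: ((q%:R * eta y ^+ q.-1) *: K y) +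
    (eta y ^+ q * ((1 - p) * tau y `^ (1 - p - 1))) *: (sg *: G y))) =
    (fun y => cutoff y + (1 - p) * sg * weighted_density y).
  apply/funext => y; rewrite /cutoff /weighted_density plapDr !plapZr plap_self//.
  rewrite (_ : 1 - p - 1 = - p); last by ring.
  by ring.
have iwd := weighted_density_integrable.
rewrite (RintegralD mD cutoff_integrable (integrableRZ mD _ iwd)).
rewrite RintegralZl//.
set X := Rintegral mu D weighted_density; set Y := Rintegral mu D cutoff.
set k := s_ D p x `^ (- p) => E.
have k0 : 0 <= k by exact: powR_ge0.
have Y1 : (p - 1) * X <= `|Y|.
  have -> : (p - 1) * X = sg * Y - k * ((sg * eta x) * eta x ^+ q.-1 * tau x `^ (1 - p)).
    have E' : sg * (Y + (1 - p) * sg * X) = sg * (k * (eta x ^+ q * tau x `^ (1 - p))) by rewrite E.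
    have -> : (p - 1) * X = sg * Y - sg * (Y + (1 - p) * sg * X).
      rewrite mulrDr opprD addNKr -[LHS]mul1r -sg2; by ring.
    by rewrite E' -{1}(prednK q0) exprS; ring.
  apply: (@le_trans _ _ (sg * Y)).
    rewrite gerBl; apply: mulr_ge0 => //; apply: mulr_ge0; last exact: powR_ge0.
    by apply: mulr_ge0 => //; apply: exprn_ge0; case/andP: (eta01 x).
  by apply: le_trans (ler_norm _) _; rewrite normrM sg1 mul1r.
have Y2 : `|Y| <= (1 - p^-1) * X + q%:R `^ p / p * grad_norm D p eta `^ p.
  have := abs_Rintegral_le mD cutoff_measurable cutoff_bound_integrable cutoff_le.
  have iK := W0lim_energy_integrable etaK.
  rewrite (RintegralD mD (integrableRZ mD _ iwd) (integrableRZ mD _ iK)).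
  by rewrite !RintegralZl// (Rintegral_energy etaK).
have p10 : 0 < p - 1 by rewrite subr_gt0.
have := le_trans Y1 Y2; rewrite -lerBlDl.
have -> : (p - 1) * X - (1 - p^-1) * X = (p - 1) ^+ 2 / p * X by field; rewrite gt_eqF.
move: (grad_norm _ _ _ `^ p) (q%:R `^ p) => g r hX.
rewrite mulrAC ler_pdivlMr ?exprn_gt0// -(ler_pM2r (_ : 0 < p^-1)) ?invr_gt0//.
by apply: le_trans (le_trans _ hX) _; rewrite le_eqVlt; apply/orP; left; apply/eqP; ring.
Qed.

(** The field is the gradient of tau^(-b). Its length to the power p is b^p tau^(-bp) |grad u|^p /
    tau^p: the factor tau^(-bp) is bounded through tau >= e, and the rest by the weighted density,
    since eta >= h on [Q]. The powers of b and e stay in front, so that b can be chosen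
    afterwards. *)
Lemma energy_powR_le (Q : set 'rV[R]_n) (b h C : R) : measurable Q -> 0 <= b -> 0 < h ->
  (forall y, (Q `&` D) y -> h <= eta y) ->
  q%:R `^ p / (p - 1) ^+ 2 * grad_norm D p eta `^ p / h ^+ q <= C ->
  (energy (Q `&` D) p (fun y => (- b * tau y `^ (- b - 1)) *: (sg *: G y))%R <=
   (b `^ p * e `^ (- b) `^ p * C)%:E)%E.
Proof.
move=> mQ b0 h0 etah hC.
have hq : 0 < h ^+ q by rewrite exprn_gt0.
pose k := b `^ p * e `^ (- b) `^ p / h ^+ q.
have k0 : 0 <= k by rewrite !mulr_ge0 ?powR_ge0// invr_ge0 ltW.
have iwd := integrableRZ mD k weighted_density_integrable.
have mQD : measurable (Q `&` D) by exact: measurableI.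
have QD : Q `&` D `<=` D by move=> y [].
have mwd : measurable_fun D (fun y => k * weighted_density y) by exact: integrable_measurable iwd.
apply: (@le_trans _ _ (\int[mu]_(y in D) (k * weighted_density y)%:E)%E).
  apply: (@le_trans _ _ (\int[mu]_(y in Q `&` D) (k * weighted_density y)%:E)%E).
    rewrite energyE; apply: ge0_le_integral => //.
    - by move=> y _; rewrite lee_fin powR_ge0.
    - apply/measurable_EFinP; apply: (measurable_funS mD QD); apply: measurable_energy_fun.
      apply: measurable_vecZ; last exact: sgu.1.
      by apply: measurable_funM.
    - by apply/measurable_EFinP; exact: measurable_funS mwd.
    move=> y [Qy Dy]; rewrite lee_fin.
    have cDy := subset_closure Dy; have tp := tau_gt0 cDy.
    rewrite !enormZ sg1 mul1r normrM normrN (ger0_norm b0) (ger0_norm (powR_ge0 _ _)).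
    rewrite !powRM ?mulr_ge0 ?powR_ge0 ?enorm_ge0//.
    have -> : tau y `^ (- b - 1) `^ p = tau y `^ (- b) `^ p * tau y `^ (- p).
      rewrite -!powRrM -powRD; first by congr (_ `^ _); ring.
      by rewrite (gt_eqF tp) implybT.
    have eh : 1 <= eta y ^+ q / h ^+ q.
      rewrite ler_pdivlMr// mul1r lerXn2r ?nnegrE ?(ltW h0) ?etah//.
      by case/andP: (eta01 y).
    have tb : tau y `^ (- b) `^ p <= e `^ (- b) `^ p.
      by apply: ge0_ler_powR; rewrite ?nnegrE ?powR_ge0 ?(ltW p0)// tauN_le.
    rewrite /k /weighted_density.
    have -> : b `^ p * e `^ (- b) `^ p / h ^+ q * (eta y ^+ q * tau y `^ (- p) * enorm (G y) `^ p) =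
      b `^ p * (e `^ (- b) `^ p * (eta y ^+ q / h ^+ q) * tau y `^ (- p)) * enorm (G y) `^ p by ring.
    rewrite ler_wpM2r ?powR_ge0// ler_wpM2l ?powR_ge0// ler_wpM2r ?powR_ge0//.
    by rewrite -[leLHS]mulr1 ler_pM ?powR_ge0.
  apply: ge0_subset_integral => //; first exact/measurable_EFinP.
  by move=> y _; rewrite lee_fin mulr_ge0 ?weighted_density_ge0.
rewrite -Rintegral_EFin// lee_fin RintegralZl//; last exact: weighted_density_integrable.
rewrite /k -!mulrA !ler_wpM2l ?powR_ge0//; apply: le_trans hC.
by rewrite mulrC ler_wpM2r ?invr_ge0 ?(ltW hq)// caccioppoli.
Qed.

End caccioppoli.

(** At y0 one has tau = e. Morrey's inequality for tau^(-be) between y0 and a nearby z bounds the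
    difference of the values by A be e^(-be), at most half of e^(-be), so that tau(z) <= 2^(1/be) e;
    the constant does not depend on e, which then tends to 0. *)
Lemma touching_local (sg c : R) y0 : `|sg| = 1 -> 0 <= c ->
  (forall y, closure D y -> 0 <= sg * u y + c) ->
  D y0 -> sg * u y0 + c = 0 -> 0 <= sg \/ y0 != x ->
  \forall z \near y0, sg * u z + c = 0.
Proof.
move=> sg1 c0 uc Dy0 u0 sgx.
have near_sgx : \forall z \near y0, 0 <= sg \/ z <> x.
  case: sgx => [sg0|/eqP yx]; first by apply: (@filterE _ _ (nbhs_filter y0)) => z; left.
  have oC : open (~` [set x]).
    apply: closed_openC; apply: accessible_closed_set1.
    exact: hausdorff_accessible (@norm_hausdorff _ _).
  by apply: (@filterS _ _ (nbhs_filter y0) _ _ _ (open_nbhs_nbhs (conj oC yx))) => z; right.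
have [rho rho0 abV] := nbhs_box (@filterI _ _ (nbhs_filter y0) _ _ (open_nbhs_nbhs (conj oD Dy0)) near_sgx).
set a := y0 - _ in abV; set b := y0 + _ in abV.
have abD : box a b `<=` D by move=> z /abV[].
pose eta := box_bump a b.
have teta : test_fun D eta by exact: box_bump_test_fun.
have eta01 y : 0 <= eta y <= 1 by rewrite box_bump_ge0 box_bump_le1.
have etaK := W0lim_test teta.
have etay : 0 < eta y0 by apply/box_bump_gt0P => i; rewrite !mxE; lra.
(* If [sg] is negative, the box was chosen to avoid x and the cutoff vanishes there; otherwise the
   sign is right. *)
have etax : 0 <= sg * eta x.
  have [ex0|ex0] := eqVneq (eta x) 0; first by rewrite ex0 mulr0.
  have /box_bump_gt0P hx : 0 < box_bump a b x by rewrite lt0r ex0 box_bump_ge0.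
  have [|_ [sg0|//]] := abV x; first by apply/boxP => i; case/andP: (hx i) => *; rewrite !ltW.
  by rewrite mulr_ge0// box_bump_ge0.
pose h := eta y0 / 2; have h0 : 0 < h by rewrite divr_gt0.
have ceta : {for y0, continuous eta} by apply: smooth_continuous; case: teta.
have : nbhs y0 [set y | h < eta y].
  by apply: (cvgr_gt _ ceta); rewrite /h; lra.
move=> /nbhs_ballP[r /= r0 hr].
pose cc : 'rV[R]_n := y0 - const_mx (r / 2).
pose Q := box cc (cc + const_mx r).
have Qball : Q `<=` ball y0 r.
  move=> z /boxP hz; rewrite -ball_normE /=.
  apply: (@le_lt_trans _ _ (r / 2)); last lra.
  apply: rV_norm_le => [|i]; first lra.
  by have := hz i; rewrite !mxE ler_norml; lra.
have Qeta y : Q y -> h <= eta y by move=> /Qball/hr/ltW.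
have QD : Q `<=` D.
  move=> y /Qeta hy; apply: contrapT => nDy; move: hy.
  by rewrite (test_fun0 teta nDy) leNgt h0.
have Qy0 : Q y0 by apply/boxP => i; rewrite !mxE; lra.
pose q := (Num.truncn p).+1; have pq : p <= q%:R by exact/ltW/truncnS_gt.
pose C := q%:R `^ p / (p - 1) ^+ 2 * grad_norm D p eta `^ p / h ^+ q + 1.
have C0 : 0 < C.
  rewrite ltr_wpDl// !mulr_ge0 ?powR_ge0// invr_ge0 ?exprn_ge0//.
    by rewrite subr_ge0 ltW.
  exact: ltW.
pose A := holder_cst * r `^ (1 - n%:R / p) * (2 `^ p * 2 * C) `^ p^-1.
have A0 : 0 <= A.
  by rewrite !mulr_ge0 ?powR_ge0// ltW// invr_gt0; exact: holder_exponent_gt0.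
(* [A] depends neither on e nor on the exponent, so the exponent can be fixed by A be <= 1/2. *)
pose be := (2 * (A + 1))^-1.
have A1 : 0 < A + 1 by rewrite ltr_wpDl.
have be0 : 0 < be by rewrite invr_gt0 mulr_gt0.
have sgu := W0limZ sg uG.
have main z e : Q z -> 0 < e -> sg * u z + c <= 2 `^ be^-1 * e.
  move=> Qz e0.
  have cDz := subset_closure (QD _ Qz).
  have ce0 : 0 < c + e by rewrite ltr_wpDl.
  have tau_ge y : closure D y -> e <= sg * u y + (c + e) by move=> /uc; lra.
  have wH := W0lim_powR (- be) sgu e0 ce0 tau_ge.
  pose w := be `^ p * e `^ (- be) `^ p * C.
  have E : (energy (Q `&` D) p (fun y =>
      (- be * (sg * u y + (c + e)) `^ (- be - 1)) *: (sg *: G y))%R <= w%:E)%E.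
    apply: (energy_powR_le sg1 c0 e0 pq uc etaK eta01 etax _ (ltW be0) h0).
    - exact: measurable_box.
    - by move=> y [Qy _]; exact: Qeta.
    - by rewrite lerDl.
  have w0 : 0 < w by rewrite !mulr_gt0 ?powR_gt0.
  have := W0lim_morrey wH r0 w0 E Qy0 Qz (subset_closure Dy0) cDz.
  have -> : (2 `^ p * (w + w)) `^ p^-1 = be * e `^ (- be) * (2 `^ p * 2 * C) `^ p^-1.
    have -> : 2 `^ p * (w + w) = be `^ p * e `^ (- be) `^ p * (2 `^ p * 2 * C) by rewrite /w; ring.
    rewrite !powRM ?mulr_ge0 ?powR_ge0 ?(ltW C0)//.
    by rewrite -!(powRrM _ p p^-1) divff ?gt_eqF// !powRr1 ?powR_ge0 ?(ltW be0).
  rewrite opprB addrA subrK.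
  have -> : sg * u y0 + (c + e) = e by rewrite addrA u0 add0r.
  move=> H.
  have tz : 0 < sg * u z + (c + e) by apply: lt_le_trans (tau_ge _ cDz).
  have : `|e `^ (- be) - (sg * u z + (c + e)) `^ (- be)| <= e `^ (- be) / 2.
    apply: (le_trans H).
    have -> : holder_cst * r `^ (1 - n%:R / p) *
      (be * e `^ (- be) * (2 `^ p * 2 * C) `^ p^-1) = e `^ (- be) * (A * be) by rewrite /A; ring.
    rewrite ler_wpM2l ?powR_ge0// /be ler_pdivrMr ?mulr_gt0//.
    lra.
  move=> /(powR_half_le be0 tz e0); apply: le_trans; lra.
apply/nbhs_ballP; exists (r / 2); first by rewrite /= divr_gt0.
move=> z; rewrite -ball_normE /= => zr.
have Qz : Q z.
  apply/boxP => i; have := le_lt_trans (rV_coord_le (y0 - z) i) zr.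
  by rewrite !mxE ltr_norml; lra.
apply/eqP; rewrite eq_le uc ?andbT; last exact/subset_closure/QD.
apply/ler_addgt0Pr => d d0; rewrite add0r.
have B0 : 0 < 2 `^ be^-1 :> R by exact: powR_gt0.
have := main z (d / 2 `^ be^-1) Qz ltac:(by rewrite divr_gt0).
by rewrite mulrCA divff ?mulr1// gt_eqF.
Qed.

(** * Positivity, strict maximum and sup norm *)

Let ux : u x = 1. Proof. exact: sol_x. Qed.
Let u01 y : closure D y -> 0 <= u y <= 1. Proof. exact: sol_range. Qed.

Lemma W0lim_level_closed v H (c : R) y : W0lim v H -> closure D y ->
  closure [set z | closure D z /\ v z = c] y -> v y = c.
Proof.
move=> vH Dy cy; apply/eqP; rewrite -subr_eq0 -normr_le0; apply/ler_addgt0Pr => e e0.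
rewrite add0r; have [z [[Dz vz] h]] := cy _ (W0lim_near vH Dy e0).
by rewrite -vz; exact/ltW/h.
Qed.

Lemma sol_gt0 y : connected D -> D y -> 0 < u y.
Proof.
move=> cD Dy; have := u01 (subset_closure Dy); rewrite le_eqVlt => /andP[/orP[/eqP u0|//] _].
pose A := D `&` [set z | u z = 0].
have AD : A = D.
  apply: cD; first by exists y.
    exists A; last by rewrite /A setIA setIid.
    rewrite openE => z [Dz uz].
    have h1 : nbhs z D by exact: open_nbhs_nbhs.
    have h2 : \forall t \near z, 1 * u t + 0 = 0.
      apply: (touching_local (normr1 R) (lexx 0) _ Dz _ (or_introl ler01)).
        by move=> t /u01; rewrite mul1r addr0 => /andP[].
      by rewrite mul1r addr0.
    apply: (@filterS _ _ (nbhs_filter z) _ _ _ (@filterI _ _ (nbhs_filter z) _ _ h1 h2)).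
    by move=> t [Dt]; rewrite mul1r addr0.
  exists (closure A); first exact: closed_closure.
  apply/seteqP; split=> [z Az|z [Dz cz]]; first by split; [case: Az|exact: subset_closure].
  split=> //; apply: (W0lim_level_closed uG (subset_closure Dz)).
  by apply: (closureS _ cz) => t [Dt ut]; split=> //; exact: subset_closure.
have : A x by rewrite AD.
by move=> [_] /=; rewrite ux => /eqP; rewrite oner_eq0.
Qed.

Lemma sol_lt1 y : closure D y -> y != x -> u y < u x.
Proof.
move=> Dy yx; rewrite ux lt_neqAle; have /andP[_ ->] := u01 Dy; rewrite andbT.
apply/eqP => uy.
pose K := [set z | closure D z /\ u z = 1].
have KD z : K z -> D z.
  move=> [cz uz]; apply: contrapT => nDz.
  by move/eqP : uz; rewrite (W0lim_boundary uG (conj cz nDz)) eq_sym oner_eq0.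
have cK : compact K.
  have [k Dk] := bounded_sub_cube bD.
  apply: (subclosed_compact _ (@box_compact _ _ _ _) (subset_trans _ Dk)); last by move=> z [].
  move=> z cz; have Dz : closure D z.
    by rewrite (closure_id (closure D)).1; [apply: (closureS _ cz) => t []|exact: closed_closure].
  by split=> //; exact: (W0lim_level_closed uG).
have [i yxi] : exists i, y 0 i != x 0 i.
  apply: contrapT => h; move/eqP : yx; apply; apply/rowP => i.
  by apply/eqP/negPn/negP => yxi; apply: h; exists i.
(* [f] is a signed coordinate that is larger at [y] than at [x], so a maximum point z of [f] on [K]
   differs from [x]. *)
pose sg : R := Num.sg (y 0 i - x 0 i).
pose f (z : 'rV[R]_n) := sg * z 0 i.
have sg0 : sg != 0 by rewrite sgr_eq0 subr_eq0.
have cf : continuous f.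
  by apply: continuous_mulf; [exact: cst_continuous|exact: coord_continuous].
have Ky : K y by [].
have [z Kz fz] := @compact_EVT_max _ _ f K (ex_intro _ y Ky) cK (continuous_subspaceT cf).
have {}Kz : K z by exact: set_mem Kz.
have fzx : f x < f z.
  apply: (@lt_le_trans _ _ (f y)); last by apply: fz; exact: mem_set.
  by rewrite /f -subr_gt0 -mulrBr -normrEsg normr_gt0 subr_eq0.
have zx : z != x by apply: contraTneq fzx => ->; rewrite ltxx.
have near1 : \forall t \near z, -1 * u t + 1 = 0.
  apply: touching_local => //.
  - by rewrite normrN1.
  - by move=> t /u01 /andP[_ h]; lra.
  - exact: KD.
  - by rewrite Kz.2; ring.
  - by right.
have := @filterI _ _ (nbhs_filter z) _ _ (open_nbhs_nbhs (conj oD (KD _ Kz))) near1.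
move=> /nbhs_ballP[e /= e0 he].
(* [K] contains a neighbourhood of z, in particular this point, at which [f] is larger by e / 2. *)
pose t := z + (e / 2 * sg) *: delta_mx 0 i.
have sg1 : `|sg| = 1 by rewrite normr_sg subr_eq0 yxi.
have [Dt ut] : D t /\ -1 * u t + 1 = 0.
  apply: he; rewrite -ball_normE /= /t opprD addrA subrr add0r normrN.
  apply: (@le_lt_trans _ _ (e / 2)); last lra.
  apply: rV_norm_le => [|j]; first lra.
  rewrite !mxE eqxx/= normrM normrM sg1 mulr1 (ger0_norm (_ : 0 <= e / 2)); last lra.
  by case: (j == i); rewrite ?normr1 ?normr0; lra.
have /mem_set Kt : K t by split; [exact: subset_closure|lra].
have := fz _ Kt; rewrite leNgt /f /t !mxE !eqxx mulr1 mulrDr => /negP; apply.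
have -> : sg * (e / 2 * sg) = e / 2 * (sg * sg) by ring.
have -> : sg * sg = 1 by rewrite -expr2 -real_normK ?num_real// sg1 expr1n.
by lra.
Qed.

(** The upper bound is 0 <= u <= 1. If the essential supremum were below 1, some r < 1 would bound u
    almost everywhere in [D], while by continuity u > r on an open set around x, which has positive
    measure. *)
Lemma sol_Loo_norm : Lqnorm D +oo%E u = 1.
Proof.
suff E : LqnormE D +oo%E u = 1%E by rewrite /Lqnorm E.
(* The norm with infinite exponent is defined by cases on the positivity of the total measure. *)
have muT : (0 < mu setT)%E by exact: (open_measure_gt0 openT (y := x)).
rewrite /LqnormE unlock /= muT; apply/eqP; rewrite eq_le; apply/andP; split.
  apply/ess_supP; apply: nearW => y /=; rewrite lee_fin patchE.
  case: ifPn => [/set_mem Dy|_]; last by rewrite normr0.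
  by have /andP[h1 h2] := u01 (subset_closure Dy); rewrite ger0_norm.
rewrite leNgt; apply/negP => h.
have [r] : exists2 r : R, r < 1 & {ae mu, forall y, D y -> u y <= r}.
  have := ess_sup_ge mu (abse \o (EFin \o u \_ D)); move: h.
  case: (ess_sup _ _) => [r| |] //.
    rewrite lte_fin => r1 hr; exists r => //.
    apply: filterS hr => y /= + Dy; rewrite lee_fin patchE mem_set//.
    exact: le_trans (ler_norm _).
  (* Essential supremum equal to minus infinity: the almost everywhere bound is absurd at each point
     where it holds, so any r < 1 serves. *)
  move=> _ hr; exists 0 => //; apply: filterS hr => y /=.
  by rewrite leNgt ltNye.
move=> r1 [A [mA A0 hA]].
have /W0lim_near/(_ (subset_closure Dx)) := uG.
have r10 : 0 < 1 - r by rewrite subr_gt0.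
move=> /(_ _ r10) near_x.
have := @filterI _ _ (nbhs_filter x) _ _ (open_nbhs_nbhs (conj oD Dx)) near_x.
rewrite nbhsE => -[U [oU Ux] US].
have mU : measurable U by exact: open_rV_measurable.
have := open_measure_gt0 oU Ux; rewrite lt_neqAle => /andP[/eqP + _]; apply.
apply/esym/eqP; rewrite eq_le measure_ge0 andbT -A0; apply: le_measure; rewrite ?inE//.
move=> z Uz; apply: hA => /= hz; have [Dz] := US _ Uz.
move=> /(_ (subset_closure Dz)); rewrite ux => h1; have := hz Dz.
by move: h1; rewrite ltr_norml; lra.
Qed.

Lemma sol_M : M_ D p x u.
Proof.
split; first by case: sol.
- by rewrite ux normr1.
- exact: sol_Loo_norm.
Qed.

End solution.

End sobolev.

Theorem theorem2p5 (R : realType) (N : nat) (Omega : set 'rV[R]_N) (p : R)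
    (x : 'rV[R]_N) :
  (1 <= N)%N -> N%:R < p -> smooth_bounded_domain Omega -> Omega x ->
  (forall u : 'rV[R]_N -> R,
     dirac_weak_solution Omega p (s_ Omega p x `^ (- p)) x u ->
     [/\ M_ Omega p x u,
         (forall y, Omega y -> 0 < u y),
         (forall y, closure Omega y -> y != x -> u y < u x),
         s_ Omega p x = (grad_norm Omega p u)^-1 &
         (* (b) *)
         forall v : 'rV[R]_N -> R, W01p Omega p v ->
           (`|v x| = s_ Omega p x * grad_norm Omega p v <->
            exists k : R, forall y, closure Omega y -> v y = k * u y)]) /\
  (* (a) *)
  (forall (y : 'rV[R]_N) (v : 'rV[R]_N -> R),
     closure Omega y -> W01p Omega p v ->
     `|v y| <= s_ Omega p y * grad_norm Omega p v) /\
  (* (c) *)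
  holder0 Omega (1 - N%:R / p) (s_ Omega p).
Proof.
move=> n0 np [oD _ cD bD _] Dx; split; last split.
- move=> u sol; split.
  + exact: sol_M.
  + by move=> y Dy; exact: (sol_gt0 n0 np oD bD Dx sol cD Dy).
  + by move=> y Dy; exact: (sol_lt1 n0 np oD bD Dx sol Dy).
  + exact: s_sol.
  + by move=> v Wv; exact: (sol_extremal n0 np oD bD Dx sol (W01p_W0lim n0 np oD bD Wv)).
- by move=> y v Dy Wv; exact: (le_s n0 np oD bD (W01p_W0lim n0 np oD bD Wv) Dy).
- exact: s_holder.
Qed.
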